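(* There is a constant $C$ depending only on the dimension $n$ such that $$\|f\,\nabla_\xi f\|_{\mathcal{H}^1}\le C|\xi|\,\|\nabla f\|_2\,\|f\|_2$$ for every $f\in H^1(\mathbb{R}^n)=W^{1,2}(\mathbb{R}^n)$ and every $\xi\in\mathbb{R}^n$, where $\|\cdot\|_{\mathcal{H}^1}$ denotes the Hardy norm.
   Context: $\nabla_\xi f=\xi\cdot\nabla f$ is the derivative of $f$ in direction $\xi$. $\mathcal{H}^1=\mathcal{H}^1(\mathbb{R}^n)$ is the real Hardy space, with norm $\|g\|_{\mathcal{H}^1}=\big\|\sup_{t>0}|h_t*g|\big\|_{L^1(\mathbb{R}^n)}$, where $h$ is a fixed smooth non-negative function on $\mathbb{R}^n$ supported in the unit ball $B_1(0)$ with $\int_{\mathbb{R}^n} h=1$, and $h_t(x)=t^{-n}h(x/t)$ (different choices of $h$ give equivalent norms). $\|\cdot\|_2$ is the $L^2(\mathbb{R}^n)$ norm. *)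

(* Defs.v *)
From HB Require Import structures.
From mathcomp Require Import all_boot all_order all_algebra.
From mathcomp Require Import all_classical all_reals all_analysis.

Set Implicit Arguments.
Unset Strict Implicit.
Unset Printing Implicit Defensive.
Import Order.TTheory GRing.Theory Num.Theory.
Import numFieldNormedType.Exports.

Local Open Scope classical_set_scope.
Local Open Scope ring_scope.

Fact rV_display : measure_display.
Proof. exact: default_measure_display. Qed.

(* R^n is 'rV[R]_n with the sigma-algebra generated by the coordinates, i.e.
   the Borel sigma-algebra (cf. the library instance for [n.-tuple T]). *)
Section measurable_rV.
Context {R : realType} {n : nat}.

Definition rV_coord (i : 'I_n) (x : 'rV[R]_n) : R := x ord0 i.

Let rV_set0 : g_sigma_preimage rV_coord set0.
Proof. exact: sigma_algebra0. Qed.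

Let rV_setC A : g_sigma_preimage rV_coord A -> g_sigma_preimage rV_coord (~` A).
Proof. exact: sigma_algebraC. Qed.

Let rV_bigcup (F : _^nat) : (forall i, g_sigma_preimage rV_coord (F i)) ->
  g_sigma_preimage rV_coord (\bigcup_i (F i)).
Proof. exact: sigma_algebra_bigcup. Qed.

HB.instance Definition _ := @isMeasurable.Build rV_display 'rV[R]_n
  (g_sigma_preimage rV_coord) rV_set0 rV_setC rV_bigcup.

Lemma measurable_rV_coord (i : 'I_n) : measurable_fun setT (rV_coord i).
Proof.
move=> _ Y mY; rewrite setTI; apply: sub_sigma_algebra => /=.
rewrite -bigcup_seq/=; exists i => /=; first by rewrite mem_index_enum.
by exists Y => //; rewrite setTI.
Qed.

Lemma measurable_fun_rV d (T : measurableType d) (f : T -> 'rV[R]_n) :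
  (forall i, measurable_fun setT (fun t => f t ord0 i)) -> measurable_fun setT f.
Proof.
move=> mf; apply: (@measurability _ _ _ _ setT f
  (\big[setU/set0]_(i < n) preimage_set_system setT (rV_coord i) measurable)) => //.
move=> _ [B + <-]; rewrite -bigcup_seq => -[i /= _ [C mC <-]].
by rewrite !setTI; have := mf i measurableT C mC; rewrite setTI.
Qed.

End measurable_rV.

(* The sigma-finite instance of the library for [m1 \x m2] is not found by
   inference: the one on products of subprobabilities shadows it. *)
Lemma sigma_finite_product d1 d2 (T1 : measurableType d1)
    (T2 : measurableType d2) (R : realType)
    (m1 : {sigma_finite_measure set T1 -> \bar R})
    (m2 : {sigma_finite_measure set T2 -> \bar R}) :
  sigma_finite setT (m1 \x m2)%E.
Proof.
have /sigma_finiteP[F [TF ndF Foo]] := sigma_finiteT m1.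
have /sigma_finiteP[G [TG ndG Goo]] := sigma_finiteT m2.
exists (fun k => F k `*` G k).
  rewrite -setXTT TF TG predeqE => -[x y]; split.
    move=> [/= [i _ Fix] [j _ Gjy]]; exists (maxn i j) => //; split.
    - by move: x Fix; exact/subsetPset/ndF/leq_maxl.
    - by move: y Gjy; exact/subsetPset/ndG/leq_maxr.
  by move=> [k _ []/= ? ?]; split; exists k.
move=> k; have [? ?] := Foo k; have [? ?] := Goo k.
split; first exact: measurableX.
by rewrite product_measure1E// lte_mul_pinfty// ge0_fin_numE.
Qed.

Section lebesgue_rV.
Context {R : realType}.

Definition rV_cons n (p : measurableTypeR R * 'rV[R]_n) : 'rV[R]_n.+1 :=
  row_mx (p.1%:M : 'rV[R]_1) p.2.

Lemma rV_cons0 n p : @rV_cons n p ord0 ord0 = p.1.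
Proof.
rewrite /rV_cons mxE; case: splitP => [j _|k]; last by case: k.
by rewrite mxE (ord1 j) eqxx mulr1n.
Qed.

Lemma rV_consS n p (i : 'I_n) : @rV_cons n p ord0 (lift ord0 i) = p.2 ord0 i.
Proof.
rewrite /rV_cons mxE; case: splitP => [j|k] /=.
  by rewrite (ord1 j).
by rewrite /bump leq0n => -[/val_inj ->].
Qed.

Lemma measurable_rV_cons n : measurable_fun setT (@rV_cons n).
Proof.
apply: measurable_fun_rV => i; have [->|] := eqVneq i ord0.
  under eq_fun do rewrite rV_cons0.
  exact: measurable_fst.
case: (unliftP ord0 i) => [j ->{i} _|->]; last by rewrite eqxx.
under eq_fun do rewrite rV_consS.
by apply: (measurableT_comp (measurable_rV_coord j)).
Qed.

Definition rV_box n (A : 'I_n -> set R) : set 'rV[R]_n :=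
  [set x | forall i, A i (x ord0 i)].

Lemma measurable_rV_box n (A : 'I_n -> set R) :
  (forall i, measurable (A i)) -> measurable (rV_box A).
Proof.
move=> mA; rewrite (_ : rV_box A = \bigcap_(i in [set: 'I_n]) (rV_coord i @^-1` A i)).
  apply: fin_bigcap_measurable => // i _.
  by rewrite -[X in measurable X]setTI; exact: measurable_rV_coord.
by apply/seteqP; split => [x Ax i _|x Ax i]; exact: Ax.
Qed.

Let rV_uncons n (x : 'rV[R]_n.+1) : measurableTypeR R * 'rV[R]_n :=
  (x ord0 ord0, \row_i x ord0 (lift ord0 i)).

Let measurable_rV_uncons n : measurable_fun setT (@rV_uncons n).
Proof.
apply/measurable_fun_pairP; split; first exact: measurable_rV_coord.
apply: measurable_fun_rV => i.
rewrite (_ : (fun _ => _) = rV_coord (lift ord0 i)); first exact: measurable_rV_coord.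
by apply/funext => x; rewrite /= mxE.
Qed.

Let rV_consK n : cancel (@rV_cons n) (@rV_uncons n).
Proof.
move=> p; rewrite [RHS]surjective_pairing; congr (_, _); first exact: rV_cons0.
by apply/rowP => i; rewrite mxE rV_consS.
Qed.

Section step.
Context n (m : {sigma_finite_measure set 'rV[R]_n -> \bar R}).

Definition lebesgue_rV_step : set 'rV[R]_n.+1 -> \bar R :=
  pushforward (@lebesgue_measure R \x m)%E (@rV_cons n).

HB.instance Definition _ := Measure.copy lebesgue_rV_step
  (measure_function_pushforward__canonical__measure_function_Measure
    (@lebesgue_measure R \x m)%E (@measurable_rV_cons n)).

Let step_sigma_finite : sigma_finite setT lebesgue_rV_step.
Proof.
have [F FT mF] := sigma_finite_product (@lebesgue_measure R) m.
exists (fun k => @rV_uncons n @^-1` F k).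
  by rewrite -preimage_bigcup -FT.
move=> k; have [mFk Fkoo] := mF k; split.
  by rewrite -[X in measurable X]setTI; exact: measurable_rV_uncons.
rewrite /lebesgue_rV_step /pushforward -comp_preimage (_ : _ \o _ = id) //.
by apply/funext => p /=; rewrite rV_consK.
Qed.

HB.instance Definition _ :=
  Measure_isSigmaFinite.Build _ _ _ lebesgue_rV_step step_sigma_finite.

End step.

Fixpoint lebesgue_rV n : {sigma_finite_measure set 'rV[R]_n -> \bar R} :=
  match n with
  | 0 => \d_(0%R : 'rV[R]_0)
  | k.+1 => lebesgue_rV_step (lebesgue_rV k)
  end.

Lemma lebesgue_rV_box n (A : 'I_n -> set R) : (forall i, measurable (A i)) ->
  lebesgue_rV n (rV_box A) = (\prod_(i < n) lebesgue_measure (A i))%E.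
Proof.
elim: n A => [|n IHn] A mA.
  by rewrite big_ord0 /= diracE mem_set// => -[].
rewrite big_ord_recl -(IHn (fun i => A (lift ord0 i)))//.
rewrite -product_measure1E//=; first last.
- exact: measurable_rV_box.
- exact: mA.
rewrite /lebesgue_rV_step /pushforward; congr (_ _).
apply/seteqP; split => [p Ap|p [Ap0 ApS] i].
  split; first by have := Ap ord0; rewrite rV_cons0.
  by move=> i; have := Ap (lift ord0 i); rewrite rV_consS.
by case: (unliftP ord0 i) => [j ->|->]; rewrite ?rV_consS ?rV_cons0//; exact: ApS.
Qed.

End lebesgue_rV.

Section euclidean.
Context {R : realType} {n : nat}.
Implicit Types x y : 'rV[R]_n.

Definition dot x y : R := \sum_(i < n) x ord0 i * y ord0 i.

(* The norm [`|x|] of the library on ['rV[R]_n] is the sup norm. *)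
Definition enorm x : R := Num.sqrt (dot x x).

Definition partial (i : 'I_n) (f : 'rV[R]_n -> R) : 'rV[R]_n -> R :=
  'D_(delta_mx ord0 i) f.

Fixpoint Ck (k : nat) (f : 'rV[R]_n -> R) : Prop :=
  continuous f /\
  match k with
  | 0 => True
  | k'.+1 => forall i : 'I_n,
      (forall x, derivable f x (delta_mx ord0 i)) /\ Ck k' (partial i f)
  end.

Definition smooth (f : 'rV[R]_n -> R) : Prop := forall k, Ck k f.

Definition test_function (phi : 'rV[R]_n -> R) : Prop :=
  smooth phi /\ compact (closure [set x | phi x != 0]).

End euclidean.

Section sobolev.
Context {R : realType} {n : nat}.
Local Notation mu := (@lebesgue_rV R n).

Definition weak_gradient (f : 'rV[R]_n -> R) (g : 'rV[R]_n -> 'rV[R]_n) : Prop :=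
  forall phi, test_function phi -> forall i : 'I_n,
    \int[mu]_x (f x * partial i phi x) = - \int[mu]_x (g x ord0 i * phi x).

(* [sobolev12 f g]: f lies in W^{1,2}(R^n) and g is (a version of) its weak
   gradient. *)
Definition sobolev12 (f : 'rV[R]_n -> R) (g : 'rV[R]_n -> 'rV[R]_n) : Prop :=
  [/\ f \in Lfun mu 2%:E,
      forall i : 'I_n, (fun x => g x ord0 i) \in Lfun mu 2%:E
    & weak_gradient f g].

End sobolev.

Section hardy.
Context {R : realType} {n : nat}.
Local Notation mu := (@lebesgue_rV R n).

(* For continuous h, vanishing off the open unit ball is the same as vanishing
   off the closed one, so this covers both readings of "supported in B_1(0)". *)
Definition hardy_kernel (h : 'rV[R]_n -> R) : Prop :=
  [/\ smooth h,
      forall x, 0 <= h x,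
      forall x, h x != 0 -> enorm x < 1
    & \int[mu]_x h x = 1].

Definition dilate (h : 'rV[R]_n -> R) (t : R) : 'rV[R]_n -> R :=
  fun x => t ^- n * h (t^-1 *: x).

Definition convolution (u v : 'rV[R]_n -> R) : 'rV[R]_n -> R :=
  fun x => \int[mu]_y (u (x - y) * v y).

Definition hardy_maximal (h g : 'rV[R]_n -> R) (x : 'rV[R]_n) : \bar R :=
  ereal_sup [set `|convolution (dilate h t) g x|%:E | t in [set t : R | 0 < t]].

Definition hardy_norm (h g : 'rV[R]_n -> R) : \bar R :=
  'N[mu]_1[hardy_maximal h g]%E.

Definition L2norm (f : 'rV[R]_n -> R) : \bar R := 'N[mu]_2%:E[EFin \o f]%E.

End hardy.

(* Main.v *)
(** For a kernel [h_t] write [f_s] for the mollification [h_s * f], so that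
    [d_i f_s = h_s * g_i].  Fix [x], [t] and put [psi y := h_t (x - y)] and
    [T s := int f_s (d_i f_s) psi = - int f_s^2 (d_i psi) / 2].  As [s] goes
    to 0, [T s] tends to [h_t * (f g_i)] at [x], while [T t] is at most
    [C H x], where [H := M f * M |g|] is a product of maximal functions.
    By the second expression, [T s - T (s/4)] is controlled by
    [(s/t) t^-n int_(B(x,2t)) (average of f) (average of |g|)], averages being
    taken at scale [s].  This integrand is at most [C H y], and also at most
    [C (t/s)^2n H x]; interpolating with the small exponent [theta] gives
    [C (t/s)^(1/2) (H x)^theta (H y)^(1-theta)], so the differences sum
    geometrically over [s = t/4^k] and
    [|h_t * (f g_i)| <= C (H + M(H^(1-theta))^(1/(1-theta)))] pointwise.
    The maximal theorem with exponent [1/(1-theta) > 1], and then with exponent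
    2 for [f] and [|g|], bounds the integral of the right-hand side. *)

Require Import Defs.
From mathcomp Require Import all_boot all_order all_algebra.
From mathcomp Require Import all_classical all_reals all_analysis.
From mathcomp Require Import measurable_realfun normed_module matrix_normedtype.
From mathcomp Require Import ring lra.
Set Implicit Arguments.
Unset Strict Implicit.
Unset Printing Implicit Defensive.
Import Order.TTheory GRing.Theory Num.Theory.
Import numFieldNormedType.Exports.
Local Open Scope classical_set_scope.
Local Open Scope ring_scope.

(** * Lebesgue measure and integrals under affine changes of variable *)

Section lebesgue_rV_affine.
Context {R : realType}.

(** A product of two [L^2] functions is only in [L^1], so some cancellation has to enter; it comes
    from [f (d_i f) = d_i (f^2) / 2], which moves the derivative onto the smooth [psi] at the price
    [1/t]. Comparing two scales of [f] gains a factor [s], hence [s/t]. The obstacle is the last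
    average: [H] is merely integrable, and the maximal operator is not bounded on [L^1]. Averaging
    [H^(1-theta)] instead, whose power [1/(1-theta)] is integrable, costs [(t/s)^(2 n theta)];
    [theta] is chosen so that this loss is at most a constant times [(t/s)^(1/2)], still beaten by
    [s/t]. Since [f] and [g] are only square integrable, the limit [s -> 0] rests on the [L^2]
    convergence of mollifiers; both that and the final integration use the [L^2] maximal inequality.
    Cauchy-Schwarz is replaced by [u v <= l u^2 + v^2 / l] with a well chosen [l]. The constant
    depends on [n] and on [h], the latter only through a common bound [K] for [h] and its first
    partial derivatives. *)

Lemma lebesgue_measure_affine (a b : R) (A : set R) : b != 0 -> measurable A ->
  lebesgue_measure ((fun x => a + b * x) @^-1` A) =
    (`|b|^-1%:E * lebesgue_measure A)%E.
Proof.
move=> b0 mA.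
have mf : measurable_fun setT (fun x : measurableTypeR R => a + b * x : measurableTypeR R).
  by apply: measurable_funD => //; apply: measurable_funM.
pose m := mscale (NngNum (normr_ge0 b))
  (measure_function_pushforward__canonical__measure_function_Measure
    (@lebesgue_measure R) mf).
have mE X : m X = (`|b|%:E * lebesgue_measure ((fun x => a + b * x)%R @^-1` X))%E by [].
have -> : lebesgue_measure A = m A.
  apply: lebesgue_measure_unique => //.
  move=> _ [[c d]] _ <-; apply: etrans (esym (mE _)).
  (* By uniqueness of Lebesgue measure it suffices to test [m] on the intervals []c, d]]. Their
     preimages are closed on the right or on the left according to the sign of [b]. *)
  have [bp|bn] := ltP 0 b.
    rewrite (_ : _ @^-1` _ = `]((c - a) / b), ((d - a) / b)]%classic).
      rewrite !lebesgue_measure_itv/= !lte_fin ltr_pM2r ?invr_gt0// ltrD2r.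
      case: ifPn => cd; last by rewrite mule0.
      rewrite -!EFinB -EFinM gtr0_norm// -mulrBl opprB addrA subrK.
      by rewrite mulrC divfK.
    apply/seteqP; split => x /=; rewrite !in_itv/= ltr_pdivrMr// ler_pdivlMr//;
      by rewrite ltrBlDl lerBrDl (mulrC x).
  have {}bn : b < 0 by rewrite lt_neqAle b0.
  rewrite (_ : _ @^-1` _ = `[((d - a) / b), ((c - a) / b)[%classic).
    rewrite !lebesgue_measure_itv/= !lte_fin ltr_nM2r ?invr_lt0// ltrD2r.
    case: ifPn => cd; last by rewrite mule0.
    rewrite -!EFinB -EFinM ltr0_norm// -mulrBl opprB addrA subrK.
    by rewrite mulrC mulrN divfK// opprB.
  apply/seteqP; split => x /=; rewrite !in_itv/= ltr_ndivlMr// ler_ndivrMr//;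
    rewrite ltrBlDl lerBrDl (mulrC x) => /andP[-> ->] //.
by rewrite mE muleA -EFinM mulVf ?normr_eq0// mul1e.
Qed.

Context {n : nat}.
Local Notation mu := (@lebesgue_rV R n).

Lemma measurable_rV_boxE :
  (measurable : set (set 'rV[R]_n)) =
  <<s [set rV_box A | A in [set A : 'I_n -> set R | forall i, measurable (A i)]] >>.
Proof.
apply/seteqP; split.
  rewrite [X in X `<=` _](_ : _ = g_sigma_preimage (@rV_coord R n))//.
  apply: smallest_sub; first exact: smallest_sigma_algebra.
  move=> A; rewrite -bigcup_seq => -[i _ [B mB <-]]; rewrite setTI.
  apply: sub_sigma_algebra; exists (fun j => if j == i then B else setT).
    by move=> j; case: ifPn.
  apply/seteqP; split => x /=.
    by move=> /(_ i); rewrite eqxx.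
  by move=> Bx j; case: eqP => // ->.
apply: smallest_sub; first exact: sigma_algebra_measurable.
by move=> _ [A mA <-]; exact: measurable_rV_box.
Qed.

Lemma setI_closed_rV_box : setI_closed
  [set rV_box A | A in [set A : 'I_n -> set R | forall i, measurable (A i)]].
Proof.
move=> _ _ [A mA <-] [B mB <-]; exists (fun i => A i `&` B i).
  by move=> i; exact: measurableI.
apply/seteqP; split => x /=; first by move=> H; split => i; have [] := H i.
by move=> [HA HB] i; split.
Qed.

(** Measurable boxes are stable under intersection and generate the sigma-algebra, and the cubes
    with sides []-k, k]] exhaust the space with finite measure, so the uniqueness theorem for
    measures applies. *)
Lemma lebesgue_rV_unique (m : {measure set 'rV[R]_n -> \bar R}) :
  (forall A : 'I_n -> set R, (forall i, measurable (A i)) ->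
    m (rV_box A) = mu (rV_box A)) ->
  forall A, measurable A -> m A = mu A.
Proof.
move=> H A mA; apply/esym.
apply: (measure_unique [set rV_box A | A in [set A : 'I_n -> set R | forall i, measurable (A i)]]
  (fun k => rV_box (fun=> `]-k%:R, k%:R[%classic)) ) => //.
- exact: measurable_rV_boxE.
- exact: setI_closed_rV_box.
- by move=> k; exists (fun=> `]-k%:R, k%:R[%classic).
- apply/seteqP; split => // x _.
  exists (Num.trunc (\big[Num.max/0]_(i < n) `|x ord0 i|)).+1 => //= i.
  change (x ord0 i \in `]- (Num.trunc (\big[Num.max/0]_(i < n) `|x ord0 i|)).+1%:R, (Num.trunc (\big[Num.max/0]_(i < n) `|x ord0 i|)).+1%:R[).
  rewrite in_itv/= -ltr_norml.
  apply: le_lt_trans (truncnS_gt _).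
  exact: (le_bigmax _ (fun i => `|x ord0 i|) i).
- by move=> _ [B mB <-]; rewrite H.
- move=> k; rewrite [X in (X < _)%E](_ : _ =
    (\prod_(i < n) lebesgue_measure (`]-k%:R, k%:R[%classic : set R)%R)%E); last first.
    by apply: lebesgue_rV_box.
  rewrite (eq_bigr (fun=> (k%:R + k%:R)%:E)); last first.
    move=> i _; rewrite lebesgue_measure_itv/= lte_fin.
    have [//|] := ltP (- k%:R) (k%:R : R); first by rewrite -EFinB opprK.
    by case: k => [|k]; rewrite ?addr0// leNgt ltrNl (lt_le_trans (y := 0)) ?oppr_lt0//.
  by rewrite prodEFin ltry.
Qed.

(** Balls of the sup norm are cubes, so their measure factorizes. Positivity of [r] matters for
    [n = 0]: membership in a ball includes [0 < r], whereas a box without coordinates is the whole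
    space. *)
Lemma rV_ballE (x : 'rV[R]_n) (r : R) : 0 < r ->
  ball x r = rV_box (fun i => ball (x ord0 i) r).
Proof.
move=> r0; apply/seteqP; split => y /=.
  by move=> [_ H] i; exact: H.
by move=> H; split=> // i j; rewrite (ord1 i); exact: H.
Qed.

Lemma measurable_rV_ball (x : 'rV[R]_n) (r : R) : measurable (ball x r).
Proof.
have [r0|r0] := ltP 0 r.
  by rewrite rV_ballE//; apply: measurable_rV_box => i; exact: measurable_ball.
by rewrite (_ : ball x r = set0)//; apply/seteqP; split => // y [/lt_le_trans/(_ r0)]; rewrite ltxx.
Qed.

Lemma lebesgue_rV_ball (x : 'rV[R]_n) (r : R) : 0 < r ->
  mu (ball x r) = ((r *+ 2) ^+ n)%:E.
Proof.
move=> r0; rewrite rV_ballE// lebesgue_rV_box; last by move=> i; exact: measurable_ball.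
under eq_bigr do rewrite lebesgue_measure_ball ?ltW//.
by rewrite prodEFin prodr_const card_ord.
Qed.

Lemma measurable_rV_affine (a : 'rV[R]_n) (b : R) :
  measurable_fun setT (fun x : 'rV[R]_n => a + b *: x).
Proof.
apply: measurable_fun_rV => i; under eq_fun do rewrite !mxE.
apply: measurable_funD => //; apply: measurable_funM => //.
exact: measurable_rV_coord.
Qed.

Lemma lebesgue_rV_affine (a : 'rV[R]_n) (b : R) (A : set 'rV[R]_n) : b != 0 ->
  measurable A ->
  mu ((fun x => a + b *: x) @^-1` A) = ((`|b| ^- n)%:E * mu A)%E.
Proof.
move=> b0 mA.
pose m := mscale (NngNum (exprn_ge0 n (normr_ge0 b)))
  (measure_function_pushforward__canonical__measure_function_Measure
    mu (measurable_rV_affine a b)).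
have mE X : m X = ((`|b| ^+ n)%:E * mu ((fun x => a + b *: x)%R @^-1` X))%E by [].
have <- : m A = mu A.
  apply: lebesgue_rV_unique => //.
  move=> B mB; apply: (etrans (mE _)).
  rewrite (_ : _ @^-1` _ = rV_box (fun i => (fun x => a ord0 i + b * x) @^-1` B i)).
    rewrite !lebesgue_rV_box//; last first.
      move=> i; rewrite -[X in measurable X]setTI.
      have mf : measurable_fun setT (fun x : R => a ord0 i + b * x).
        by apply: measurable_funD => //; apply: measurable_funM.
      exact: mf.
    under eq_bigr do rewrite lebesgue_measure_affine//.
    rewrite big_split/= prodEFin prodr_const card_ord muleA -EFinM.
    by rewrite -exprMn mulfV ?normr_eq0// expr1n mul1e.
  by apply/seteqP; split => x /= Hx i; have := Hx i; rewrite !mxE.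
rewrite mE muleA -EFinM mulVf ?mul1e//.
by rewrite expf_neq0// normr_eq0.
Qed.

End lebesgue_rV_affine.

Section integral_rV_affine.
Context {R : realType} {n : nat}.
Local Notation mu := (@lebesgue_rV R n).

Lemma ge0_integral_rV_affine (a : 'rV[R]_n) (b : R) (F : 'rV[R]_n -> \bar R) :
  b != 0 -> measurable_fun setT F -> (forall x, 0 <= F x)%E ->
  (\int[mu]_x F (a + b *: x)%R = (`|b| ^- n)%:E * \int[mu]_x F x)%E.
Proof.
move=> b0 mF F0.
have c0 : 0 <= `|b| ^- n by rewrite invr_ge0 exprn_ge0.
transitivity (\int[pushforward mu (fun x => a + b *: x)%R]_x F x)%E.
  by rewrite (ge0_integral_pushforward (measurable_rV_affine a b)).
rewrite -[in RHS](@ge0_integral_mscale _ _ _ mu _ _ (NngNum c0))//.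
apply: eq_measure_integral => [|mf A mA _]; first exact: measurable_rV_affine.
exact: lebesgue_rV_affine.
Qed.

Lemma integrable_rV_affine (a : 'rV[R]_n) (b : R) (F : 'rV[R]_n -> R) :
  b != 0 -> mu.-integrable setT (EFin \o F) ->
  mu.-integrable setT (EFin \o (fun x => F (a + b *: x))).
Proof.
move=> b0 /integrableP[mF iF]; apply/integrableP; split.
  by apply: (measurableT_comp mF); exact: measurable_rV_affine.
rewrite /= (ge0_integral_rV_affine a b0 (F := fun x => `|(F x)%:E|%E))//.
  by rewrite lte_mul_pinfty// lee_fin invr_ge0 exprn_ge0.
exact: measurableT_comp.
Qed.

Lemma Rintegral_rV_affine (a : 'rV[R]_n) (b : R) (F : 'rV[R]_n -> R) :
  b != 0 -> mu.-integrable setT (EFin \o F) ->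
  \int[mu]_x F (a + b *: x) = `|b| ^- n * \int[mu]_x F x.
Proof.
move=> b0 iF; have /integrableP[mF _] := iF.
have c0 : 0 <= `|b| ^- n by rewrite invr_ge0 exprn_ge0.
rewrite /Rintegral -[X in _ = X * _]/(fine (`|b| ^- n)%:E) -fineM//; last first.
  exact: integrable_fin_num.
congr fine; rewrite (integralE mu setT (fun x => (F (a + b *: x))%:E)).
rewrite (integralE mu setT (fun x => (F x)%:E)).
pose G := EFin \o F.
have -> : (\int[mu]_x ((fun x => (F (a + b *: x))%:E)^\+ x) =
   (`|b| ^- n)%:E * \int[mu]_x (G^\+ x))%E.
  rewrite -(ge0_integral_rV_affine a b0 (F := G^\+%E))//.
    by apply: eq_integral => x _; rewrite !funeposE.
  exact: measurable_funepos.
have -> : (\int[mu]_x ((fun x => (F (a + b *: x))%:E)^\- x) =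
   (`|b| ^- n)%:E * \int[mu]_x (G^\- x))%E.
  rewrite -(ge0_integral_rV_affine a b0 (F := G^\-%E))//.
    by apply: eq_integral => x _; rewrite !funenegE.
  exact: measurable_funeneg.
rewrite [RHS]muleBr//.
rewrite fin_num_adde_defr//.
by apply: integrable_fin_num => //; exact: integrable_funepos.
Qed.

End integral_rV_affine.

(** * The maximal function *)

Section rational_balls.
Context {R : realType} {n : nat}.

(** An enumeration of the cubes with rational centre and radius. Invalid codes and nonpositive radii
    receive a default radius 1, so that every index names a genuine ball. *)
Definition rat_ball_data (k : nat) : 'rV[R]_n * R :=
  if @unpickle ('rV[rat]_n * rat)%type k is Some (q, r) then
    (map_mx ratr q, if 0 < r then ratr r else 1)
  else (0, 1).

Definition rat_ball k : set 'rV[R]_n :=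
  ball (rat_ball_data k).1 (rat_ball_data k).2.

Lemma rat_ball_radius_gt0 k : 0 < (rat_ball_data k).2.
Proof.
rewrite /rat_ball_data; case: unpickle => // -[q r] /=.
by case: ifPn => // r0; rewrite ltr0q.
Qed.

Lemma rat_ball_approx (x : 'rV[R]_n) (e a b : R) : 0 < e -> 0 <= a -> a < b ->
  exists k, ball x e (rat_ball_data k).1 /\ a < (rat_ball_data k).2 < b.
Proof.
move=> e0 a0 ab.
have [r rab] := @rat_in_itvoo R a b ab.
have H i : exists q : rat, ball (x ord0 i) e (ratr q).
  have [|q] := @rat_in_itvoo R (x ord0 i - e) (x ord0 i + e).
    by rewrite ltrBlDr -addrA ltrDl addr_gt0.
  by move=> xq; exists q; rewrite ball_itv.
have {H}[q Hq] := choice H.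
have r0 : 0 < r.
  by move: rab; rewrite in_itv/= => /andP[ar _]; rewrite -(ltr0q R) (le_lt_trans a0).
exists (pickle (\row_i q i, r)); rewrite /rat_ball_data pickleK/= r0; split; last first.
  by move: rab; rewrite in_itv.
by split=> // i j; rewrite (ord1 i) !mxE; exact: Hq.
Qed.

(** An open set is the union of the countably many rational cubes that it contains. This links the
    coordinate sigma-algebra to the topology and makes continuous functions measurable. *)
Lemma open_measurable_rV (U : set 'rV[R]_n) : open U -> measurable U.
Proof.
move=> oU.
rewrite (_ : U = \bigcup_(k in [set k | rat_ball k `<=` U]) rat_ball k); last first.
  apply/seteqP; split => [x Ux|x [k /= kU]]; last exact: kU.
  have /nbhs_ballP[e /= e0 xeU] : nbhs x U by exact: open_nbhs_nbhs.
  have e20 : 0 < e / 2 by rewrite divr_gt0.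
  have e40 : 0 < e / 2 / 2 by rewrite divr_gt0.
  have e42 : e / 2 / 2 < e / 2 by rewrite ltr_pdivrMr// ltr_pMr// ltr1n.
  (* A centre within [e/4] of [x] and a radius between [e/4] and [e/2]: the cube contains [x] and
     stays within [e] of it. *)
  have [k [xk /andP[ak kb]]] := rat_ball_approx x e40 (ltW e40) e42.
  exists k => /=; last first.
    by apply: ball_sym; apply: le_ball xk; exact: ltW.
  move=> y ky; apply: xeU; rewrite [e]splitr.
  apply: (@ball_triangle _ _ (rat_ball_data k).1).
    by apply: le_ball xk; exact: ltW.
  by apply: le_ball ky; exact: ltW.
by apply: bigcup_measurable => k _; exact: measurable_rV_ball.
Qed.

Lemma continuous_measurable_rV (f : 'rV[R]_n -> R) :
  continuous f -> measurable_fun setT f.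
Proof.
move=> cf; apply: (measurability _ (RGenOInfty.measurableE R)) => //.
move=> _ [_ [r ->] <-]; rewrite setTI; apply: open_measurable_rV.
by move/continuousP: cf; apply; exact: interval_open.
Qed.

Lemma measurable_rV_sub : measurable_fun setT
  (fun p : 'rV[R]_n * 'rV[R]_n => p.1 - p.2).
Proof.
apply: measurable_fun_rV => i; under eq_fun do rewrite !mxE.
apply: measurable_funB.
  by apply: (measurableT_comp (measurable_rV_coord i)).
by apply: (measurableT_comp (measurable_rV_coord i)).
Qed.

End rational_balls.

Section maximal.
Context {R : realType} {n : nat}.
Local Notation mu := (@lebesgue_rV R n).
Local Notation B := (@rat_ball R n).
Implicit Types F : 'rV[R]_n -> \bar R.

Lemma measurable_rat_ball k : measurable (B k).
Proof. exact: measurable_rV_ball. Qed.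

Lemma lebesgue_rat_ball k :
  mu (B k) = (((@rat_ball_data R n k).2 *+ 2) ^+ n)%:E.
Proof. by rewrite lebesgue_rV_ball// rat_ball_radius_gt0. Qed.

(** Vitali's covering argument for finitely many balls, by induction on their number. Select a ball
    [B b] of largest radius; every ball meeting it lies in the ball with the same centre and three
    times the radius, whence [3 ^+ n]. The remaining balls are disjoint from [B b], so the integral
    over them adds to the integral over [B b]. *)
Lemma covering_le F (l : R) (s : seq nat) :
  measurable_fun setT F -> (forall x, 0 <= F x)%E -> 0 <= l ->
  (forall k, k \in s -> l%:E * mu (B k) <= \int[mu]_(x in B k) F x)%E ->
  (l%:E * mu (\big[setU/set0]_(k <- s) B k) <=
   (3 ^+ n)%:E * \int[mu]_(x in \big[setU/set0]_(k <- s) B k) F x)%E.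
Proof.
move=> mF F0 l0; have [m] := ubnP (size s); elim: m s => // m IH s sm Hs.
have mU (t : seq nat) : measurable (\big[setU/set0]_(k <- t) B k).
  by apply: bigsetU_measurable => k _; exact: measurable_rat_ball.
have [->|s0] := eqVneq s [::].
  by rewrite big_nil measure0 mule0 integral_set0 mule0.
have [b [bs bmax]] : exists b, b \in s /\
    forall k, k \in s -> (@rat_ball_data R n k).2 <= (@rat_ball_data R n b).2.
  elim: s s0 {sm Hs} => // a s IHs _; have [->|/IHs[b [bs bmax]]] := eqVneq s [::].
    exists a; split; first by rewrite inE.
    by move=> k; rewrite inE => /eqP ->.
  have [ab|ba] := leP (@rat_ball_data R n a).2 (@rat_ball_data R n b).2.
    exists b; split; first by rewrite inE bs orbT.
    by move=> k; rewrite inE => /predU1P[->//|]; exact: bmax.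
  exists a; split; first by rewrite inE eqxx.
  move=> k; rewrite inE => /predU1P[->//|/bmax] /le_trans; apply; exact: ltW.
(* The balls to which the induction hypothesis applies; [b] itself is not among them, so the list is
   strictly shorter. *)
pose s1 := [seq k <- s | `[< B k `&` B b = set0 >]].
have s1s k : k \in s1 -> k \in s /\ B k `&` B b = set0.
  by rewrite mem_filter => /andP[/asboolP].
have bB : B b (@rat_ball_data R n b).1 by apply: ballxx; exact: rat_ball_radius_gt0.
have s1m : (size s1 < m)%N.
  rewrite (leq_trans _ (_ : size s <= m)%N)// size_filter.
  rewrite -(count_predC (fun k => `[< B k `&` B b = set0 >]) s).
  rewrite -[X in (X < _)%N]addn0 ltn_add2l -has_count; apply/hasP; exists b => //=.
  by apply/asboolPn => bb; move: bB; rewrite -[B b]setIid bb.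
have {}IH := IH s1 s1m (fun k ks => Hs k (s1s k ks).1).
set U1 := \big[setU/set0]_(k <- s1) B k in IH.
set U := \big[setU/set0]_(k <- s) B k.
pose r := (@rat_ball_data R n b).2; pose c := (@rat_ball_data R n b).1.
have r0 : 0 < r := rat_ball_radius_gt0 b.
have bU : B b `<=` U by move=> x bx; rewrite /U -bigcup_seq; exists b.
have U1U : U1 `<=` U.
  rewrite /U /U1 -!bigcup_seq => x [k /= /s1s[ks _] kx]; by exists k.
have bU1 : B b `&` U1 = set0.
  rewrite /U1 -bigcup_seq; apply/seteqP; split => // x [bx [k /= /s1s[_ kb] kx]].
  by have : (B k `&` B b) x by []; rewrite kb.
have UU : U `<=` ball c (3 * r) `|` U1.
  rewrite /U -bigcup_seq => x [k /= ks kx].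
  have [kb|/eqP/set0P[y [ky by_]]] := pselect (B k `&` B b = set0).
    right; rewrite /U1 -bigcup_seq; exists k => //=.
    by rewrite mem_filter ks andbT; exact/asboolP.
  left; have rk := bmax _ ks.
  rewrite (_ : 3 * r = r + (r + r)); last by ring.
  apply: (ball_triangle by_); apply: (@ball_triangle _ _ (@rat_ball_data R n k).1).
    by apply: ball_sym; apply: le_ball ky.
  exact: le_ball kx.
apply: (@le_trans _ _ (l%:E * (mu (ball c (3 * r)) + mu U1))%E).
  apply: lee_wpmul2l; first by rewrite lee_fin.
  apply: le_trans (measureU2 _ (measurable_rV_ball _ _) (mU _)).
  apply: le_measure => //; rewrite ?inE//; first exact: mU.
  by apply: measurableU => //; exact: measurable_rV_ball.
rewrite ge0_muleDr//.
apply: (@le_trans _ _ ((3 ^+ n)%:E * \int[mu]_(x in B b) F x +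
  (3 ^+ n)%:E * \int[mu]_(x in U1) F x)%E).
  apply: leeD => //.
  rewrite lebesgue_rV_ball ?mulr_gt0// -mulrnAr exprMn EFinM muleCA.
  apply: lee_wpmul2l; first by rewrite lee_fin exprn_ge0.
  by have := Hs _ bs; rewrite lebesgue_rat_ball.
rewrite -ge0_muleDr//; try by apply: integral_ge0.
apply: lee_wpmul2l; first by rewrite lee_fin exprn_ge0.
rewrite -ge0_integral_setU//; first last.
- by apply/disj_setPS; rewrite bU1.
- exact: measurable_funTS.
- exact: mU.
- exact: measurable_rat_ball.
apply: ge0_subset_integral => //.
- by apply: measurableU; [exact: measurable_rat_ball|exact: mU].
- exact: mU.
- exact: measurable_funTS.
- by rewrite subUset.
Qed.

Definition avg_rat F k : \bar R :=
  (((@rat_ball_data R n k).2 *+ 2) ^- n)%:E * \int[mu]_(x in B k) F x.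

(* The balls are cubes, since the norm is the sup norm; restricting to rational
   ones makes the supremum countable, hence measurable. *)
Definition maximal F (x : 'rV[R]_n) : \bar R :=
  ereal_sup (range (fun k => avg_rat F k * (\1_(B k) x)%:E)%E).

Lemma avg_rat_ge0 F k : (forall x, 0 <= F x)%E -> (0 <= avg_rat F k)%E.
Proof.
move=> F0; rewrite /avg_rat mule_ge0 ?integral_ge0// lee_fin invr_ge0 exprn_ge0//.
by rewrite mulrn_wge0// ltW// rat_ball_radius_gt0.
Qed.

Lemma maximal_ge0 F x : (forall x, 0 <= F x)%E -> (0 <= maximal F x)%E.
Proof.
move=> F0; apply: le_trans (ereal_sup_ubound _); last by exists 0%N.
by rewrite mule_ge0 ?avg_rat_ge0// lee_fin.
Qed.

Lemma measurable_maximal F : measurable_fun setT (maximal F).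
Proof.
rewrite (_ : maximal F =
  (fun x => esups (fun k => avg_rat F k * (\1_(B k) x)%:E)%E 0)).
  apply: measurable_fun_esups => k.
  apply: measurable_funeM; apply/measurable_EFinP.
  by apply: measurable_indic; exact: measurable_rat_ball.
apply/funext => x; rewrite /maximal /esups; congr ereal_sup.
by apply/seteqP; split => y [k _ <-]; exists k.
Qed.

Lemma avg_rat_le_maximal F k x : B k x -> (avg_rat F k <= maximal F x)%E.
Proof.
move=> kx; apply: ereal_sup_ubound; exists k => //=.
by rewrite indicE mem_set// mule1.
Qed.

(** The centre [y] is arbitrary and [x] is any point of the ball. A rational cube centred within [r]
    of [y], of radius between [2 r] and [3 r], contains the ball and hence [x]; its volume is at
    most [(6 r)^n]. *)
Lemma integral_ball_le_maximal F (x y : 'rV[R]_n) (r : R) :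
  measurable_fun setT F -> (forall x, 0 <= F x)%E -> ball y r x ->
  (\int[mu]_(z in ball y r) F z <= ((6 * r) ^+ n)%:E * maximal F x)%E.
Proof.
move=> mF F0 yx.
have r0 : 0 < r by case: yx.
have r23 : 2 * r < 3 * r by lra.
have [k [yk /andP[k2 k3]]] := @rat_ball_approx R n y r (2 * r) (3 * r) r0
  (mulr_ge0 (ler0n _ 2) (ltW r0)) r23.
have k0 := @rat_ball_radius_gt0 R n k.
have sub : ball y r `<=` B k.
  move=> z yz; apply: (@le_ball _ _ _ (r + r)).
    by rewrite -mulr2n -mulr_natl ltW.
  by apply: ball_triangle yz; exact: ball_sym.
apply: (@le_trans _ _ (\int[mu]_(z in B k) F z)%E).
  apply: ge0_subset_integral => //; [exact: measurable_rV_ball|exact: measurable_rat_ball|].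
  exact: measurable_funTS.
apply: (@le_trans _ _ ((((@rat_ball_data R n k).2 *+ 2) ^+ n)%:E * avg_rat F k)%E).
  rewrite /avg_rat muleA -EFinM mulfV ?mul1e// expf_neq0// mulrn_eq0/=.
  by rewrite gt_eqF.
apply: lee_pmul.
- by rewrite lee_fin exprn_ge0// mulrn_wge0// ltW.
- exact: avg_rat_ge0.
- rewrite lee_fin lerXn2r ?nnegrE ?mulrn_wge0 ?mulr_ge0 ?(ltW k0) ?(ltW r0)//.
  by rewrite -mulr_natl; move: k3; lra.
- by apply: avg_rat_le_maximal; exact: sub.
Qed.

(** The superlevel set is the increasing union of the sets [E N], the unions of those among the
    first [N] rational balls whose average exceeds [l]. The covering lemma bounds the measure of
    each of them uniformly in [N]. *)
Lemma maximal_weak F (l : R) :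
  measurable_fun setT F -> (forall x, 0 <= F x)%E -> 0 <= l ->
  (l%:E * mu [set x | l%:E < maximal F x] <= (3 ^+ n)%:E * \int[mu]_x F x)%E.
Proof.
move=> mF F0 l0.
pose s N := [seq k <- iota 0 N | (l%:E < avg_rat F k)%E].
pose E N := \big[setU/set0]_(k <- s N) B k.
have mE N : measurable (E N).
  by apply: bigsetU_measurable => k _; exact: measurable_rat_ball.
have EE : [set x | (l%:E < maximal F x)%E] = \bigcup_N E N.
  apply/seteqP; split => x /=.
    move=> /ereal_sup_gt[_ [k _ <-]].
    rewrite indicE; case: (boolP (x \in B k)) => [|_]; last first.
      by rewrite mule0 lte_fin ltNge l0.
    rewrite inE mule1 => kx lk; exists k.+1 => //.
    rewrite /E -bigcup_seq; exists k => //=.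
    by rewrite mem_filter lk mem_iota add0n ltnS leqnn.
  move=> [N _]; rewrite /E -bigcup_seq => -[k /=].
  rewrite mem_filter => /andP[lk _] kx; apply: (lt_le_trans lk).
  exact: avg_rat_le_maximal.
have bound N : (l%:E * mu (E N) <= (3 ^+ n)%:E * \int[mu]_x F x)%E.
  apply: (le_trans (covering_le mF F0 l0 _)).
    move=> k; rewrite mem_filter => /andP[/ltW lk _].
    have k0 := @rat_ball_radius_gt0 R n k.
    rewrite lebesgue_rat_ball muleC.
    apply: (@le_trans _ _ ((((@rat_ball_data R n k).2 *+ 2) ^+ n)%:E * avg_rat F k)%E).
      apply: lee_wpmul2l => //.
      by rewrite lee_fin exprn_ge0// mulrn_wge0// ltW.
    rewrite /avg_rat muleA -EFinM mulfV ?mul1e// expf_neq0// mulrn_eq0/=.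
    by rewrite gt_eqF.
  apply: lee_wpmul2l; first by rewrite lee_fin exprn_ge0.
  by apply: ge0_subset_integral => //; exact: (mE N).
have cv : (l%:E * mu (E N))%E @[N --> \oo] --> (l%:E * mu (\bigcup_N E N))%E.
  apply: cvgeZl => //.
  apply: nondecreasing_cvg_mu => //.
    by apply: bigcup_measurable => N _; exact: mE.
  move=> p q pq; apply/subsetPset; rewrite /E -!bigcup_seq => x [k /= kp kx].
  exists k => //=; move: kp; rewrite !mem_filter !mem_iota !add0n.
  by move=> /andP[-> /leq_trans->].
rewrite EE -(cvg_lim _ cv)//; apply: lime_le; first by apply/cvg_ex; eexists; exact: cv.
by apply: nearW => N; exact: bound.
Qed.

(** Where [2 F <= l], the function contributes at most [l / 2] to any average. Hence if [maximal F]
    exceeds [l], the maximal function of the part of [F] above [l / 2] exceeds [l / 2]. Integrating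
    only over that part is what makes the later sum over levels converge, as in Marcinkiewicz
    interpolation. *)
Lemma maximal_weak_cut F (l : R) :
  measurable_fun setT F -> (forall x, 0 <= F x)%E -> 0 < l ->
  (l%:E * mu [set x | l%:E < maximal F x] <=
   (2 * 3 ^+ n)%:E * \int[mu]_(x in [set x | l%:E < 2%:E * F x]) F x)%E.
Proof.
move=> mF F0 l0.
pose D := [set x | (l%:E < 2%:E * F x)%E].
have mD : measurable D.
  rewrite /D -[X in measurable X]setTI; apply: emeasurable_fun_o_infty => //.
  exact: measurable_funeM.
pose F1 := F \_ D.
have mF1 : measurable_fun setT F1.
  by apply/(measurable_restrictT F mD); exact: measurable_funTS.
have F10 x : (0 <= F1 x)%E by rewrite /F1 patchE; case: ifPn.
have l20 : 0 <= l / 2 by rewrite divr_ge0// ltW.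
have F1F x : (F x <= F1 x + (l / 2)%:E)%E.
  rewrite /F1 patchE; case: ifPn => [_|]; first by rewrite leeDl// lee_fin.
  rewrite notin_setE /D/= => /negP; rewrite -leNgt add0e => h.
  by rewrite mulrC EFinM lee_pdivlMl.
have avgle k : (avg_rat F k <= avg_rat F1 k + (l / 2)%:E)%E.
  have k0 := @rat_ball_radius_gt0 R n k.
  have c0 : 0 <= ((@rat_ball_data R n k).2 *+ 2) ^- n.
    by rewrite invr_ge0 exprn_ge0// mulrn_wge0// ltW.
  apply: (@le_trans _ _ ((((@rat_ball_data R n k).2 *+ 2) ^- n)%:E *
     \int[mu]_(x in B k) (F1 x + (l / 2)%:E))%E).
    apply: lee_wpmul2l; first by rewrite lee_fin.
    apply: ge0_le_integral => //; first exact: measurable_rat_ball.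
    - exact: measurable_funTS.
    - by apply: emeasurable_funD => //; exact: measurable_funTS.
  rewrite ge0_integralD//; [|exact: measurable_rat_ball|exact: measurable_funTS].
  rewrite integral_cst; last exact: measurable_rat_ball.
  rewrite ge0_muleDr ?integral_ge0 ?mule_ge0 ?lee_fin//.
  rewrite leeD2l//.
  rewrite [X in (_ * (_ * X) <= _)%E](_ : _ = (((@rat_ball_data R n k).2 *+ 2) ^+ n)%:E); last first.
    exact: lebesgue_rat_ball.
  rewrite -!EFinM lee_fin mulrCA mulVf ?mulr1//.
  by rewrite expf_neq0// mulrn_eq0/= gt_eqF.
have sub : [set x | (l%:E < maximal F x)%E] `<=` [set x | ((l / 2)%:E < maximal F1 x)%E].
  move=> x /= /ereal_sup_gt[_ [k _ <-]].
  rewrite indicE; case: (boolP (x \in B k)) => [|_]; last first.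
    by rewrite mule0 lte_fin ltNge (ltW l0).
  rewrite inE mule1 => kx lk; apply: (lt_le_trans _ (avg_rat_le_maximal F1 kx)).
  have := lt_le_trans lk (avgle k).
  by rewrite {1}(splitr l) EFinD lteD2rE.
have H := maximal_weak mF1 F10 l20.
rewrite (_ : (\int[mu]_(x in D) F x = \int[mu]_x F1 x)%E); last first.
  by rewrite /F1 integral_mkcond.
apply: (@le_trans _ _ (l%:E * mu [set x | ((l / 2)%:E < maximal F1 x)%E])%E).
  apply: lee_wpmul2l; first by rewrite lee_fin ltW.
  have mm F' c : measurable [set x | (c%:E < maximal F' x)%E].
    rewrite -[X in measurable X]setTI; apply: emeasurable_fun_o_infty => //.
    exact: measurable_maximal.
  by apply: le_measure => //; rewrite inE; exact: mm.
rewrite EFinM -muleA -lee_pdivrMl// muleA -EFinM mulrC.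
exact: H.
Qed.

End maximal.

(** * The strong-type maximal inequality for exponents above 1 *)

Section maximal_strong.
Context {R : realType}.

Lemma le_limn_einf (u : (\bar R)^nat) (L : \bar R) :
  (forall M : R, (M%:E <= L)%E -> exists K, forall k, (K <= k)%N -> (M%:E <= u k)%E) ->
  (L <= limn_einf u)%E.
Proof.
move=> H; have key M : (M%:E <= L)%E -> (M%:E <= limn_einf u)%E.
  move=> /H[K HK]; rewrite limn_einf_lim.
  have -> : limn (einfs u) = ereal_sup (range (einfs u)).
    by apply/cvg_lim => //; exact: cvg_einfs_sup.
  apply: (@le_trans _ _ (einfs u K)); last by apply: ereal_sup_ubound; exists K.
  by apply: le_ereal_inf_tmp => _ [k /= Kk <-]; exact: HK.
case: L H key => [r||] H key; first exact: key.
- rewrite leye_eq; apply/eqP/eq_infty => r; exact: key (leey _).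
- exact: leNye.
Qed.

Lemma dyadic_level (e v : R) (N : nat) : e < v -> v <= e * 2 ^+ N ->
  exists k, [/\ (k < N)%N, e * 2 ^+ k < v & v <= e * 2 ^+ k.+1].
Proof.
move=> ev; elim: N => [|N IH]; first by rewrite expr0 mulr1 leNgt ev.
move=> vN; have [/IH[k [kN k1 k2]]|Nv] := leP v (e * 2 ^+ N).
  by exists k; split => //; exact: ltnW.
by exists N.
Qed.

Lemma powR2_gt1 (q : R) : 0 < q -> 1 < 2 `^ q.
Proof.
move=> q0; have := @gt0_ltr_powR _ q q0 1 2; rewrite powR1; apply.
- by rewrite nnegrE.
- by rewrite nnegrE.
- by rewrite ltr1n.
Qed.

Lemma powR_exprn (a q : R) k : 0 <= a -> (a ^+ k) `^ q = (a `^ q) ^+ k.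
Proof.
by move=> a0; rewrite -(powR_mulrn k a0) -(powR_mulrn k (powR_ge0 _ _)) powRAC.
Qed.

Lemma geometric_level_sum (e q : R) (b : \bar R) (N : nat) :
  0 < e -> 0 < q -> (0 <= b)%E ->
  (\sum_(k < N) ((e * 2 ^+ k) `^ q *
      (if ((e * 2 ^+ k)%:E < b)%E then 1 else 0))%R%:E <=
   ((2 `^ q / (2 `^ q - 1))%:E * b `^ q))%E.
Proof.
move=> e0 q0; case: b => [b||//]; last first.
  move=> _; rewrite poweRyr ?gt_eqF// gt0_muley ?leey// lte_fin.
  have q1 := powR2_gt1 q0.
  by rewrite divr_gt0 ?subr_gt0// powR_gt0.
rewrite lee_fin => b0.
have q1 := powR2_gt1 q0.
have q10 : 0 < 2 `^ q - 1 by rewrite subr_gt0.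
rewrite poweR_EFin sumEFin -EFinM lee_fin.
elim: N => [|N IH].
  by rewrite big_ord0 mulr_ge0 ?powR_ge0// divr_ge0 ?powR_ge0// ltW.
rewrite big_ord_recr/= lte_fin; case: ifPn => [Nb|_]; last first.
  by rewrite mulr0 addr0.
have geo M : \sum_(k < M) (e * 2 ^+ k) `^ q <= e `^ q * (((2 `^ q) ^+ M) / (2 `^ q - 1)).
  rewrite [leLHS](_ : _ = e `^ q * \sum_(k < M) (2 `^ q) ^+ k); last first.
    rewrite mulr_sumr; apply: eq_bigr => k _.
    rewrite powRM ?exprn_ge0//; last exact: ltW.
    by rewrite powR_exprn.
  rewrite ler_wpM2l ?powR_ge0// ler_pdivlMr// mulrC -subrX1.
  by rewrite gerBl.
apply: (@le_trans _ _ (\sum_(k < N.+1) (e * 2 ^+ k) `^ q)).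
  rewrite big_ord_recr/= mulr1 lerD2r; apply: ler_sum => k _.
  by rewrite ler_piMr ?powR_ge0//; case: ifP.
apply: (le_trans (geo _)).
rewrite exprS [leLHS](_ : _ = (2 `^ q / (2 `^ q - 1)) * (e * 2 ^+ N) `^ q); last first.
  rewrite powRM ?exprn_ge0//; last exact: ltW.
  by rewrite powR_exprn//; ring.
rewrite ler_wpM2l//; first by rewrite divr_ge0 ?powR_ge0// ltW.
rewrite ge0_ler_powR ?nnegrE// ?(ltW q0) ?(ltW Nb)//.
by rewrite mulr_ge0 ?exprn_ge0 ?ltW.
Qed.

Lemma poweR_mul1 (x : \bar R) (q : R) : 0 < q -> (0 <= x)%E ->
  (x * x `^ q = x `^ (q + 1))%E.
Proof.
move=> q0; case: x => [x||//]; last first.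
  by move=> _; rewrite !poweRyr ?mulyy// gt_eqF// addr_gt0.
rewrite lee_fin => x0; rewrite !poweR_EFin -EFinM.
by rewrite -(@mulr_powRB1 _ x (q + 1)) ?addrK// addr_gt0.
Qed.

Context {n : nat}.
Local Notation mu := (@lebesgue_rV R n).

Definition maximal_cst (p : R) : R :=
  2 `^ p * (2 * 3 ^+ n) * (2 `^ (p - 1) / (2 `^ (p - 1) - 1)) * 2 `^ (p - 1).

Lemma maximal_cst_ge0 p : 1 < p -> 0 <= maximal_cst p.
Proof.
move=> p1; have p10 : 0 < p - 1 by rewrite subr_gt0.
have q1 := powR2_gt1 p10.
by rewrite !mulr_ge0 ?powR_ge0 ?exprn_ge0// invr_ge0 subr_ge0 ltW.
Qed.

(** A dyadic layer-cake sum: the truncated weak-type bound is applied at each level, sum and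
    integral are exchanged, and the levels below [2 F x] are summed for fixed [x]. *)
Lemma maximal_level_sum (F : 'rV[R]_n -> \bar R) (p e : R) (N : nat) :
  measurable_fun setT F -> (forall x, 0 <= F x)%E -> 1 < p -> 0 < e ->
  (\sum_(k < N) ((e * 2 ^+ k.+1) `^ p)%:E *
      mu [set x | ((e * 2 ^+ k)%:E < maximal F x)%E] <=
  (maximal_cst p)%:E * \int[mu]_x (F x `^ p))%E.
Proof.
move=> mF F0 p1 e0; set q := p - 1.
have q0 : 0 < q by rewrite subr_gt0.
have a0 k : 0 < e * 2 ^+ k by rewrite mulr_gt0// exprn_gt0.
pose D k := [set x | ((e * 2 ^+ k)%:E < 2%:E * F x)%E].
have mD k : measurable (D k).
  rewrite /D -[X in measurable X]setTI; apply: emeasurable_fun_o_infty => //.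
  exact: measurable_funeM.
apply: (@le_trans _ _ (\sum_(k < N) (2 `^ p * (2 * 3 ^+ n))%:E *
   \int[mu]_x (((e * 2 ^+ k) `^ q *
      (if ((e * 2 ^+ k)%:E < 2%:E * F x)%E then 1 else 0))%R%:E * F x))%E).
  apply: lee_sum => k _.
  have -> : (e * 2 ^+ k.+1) `^ p = 2 `^ p * (e * 2 ^+ k) `^ q * (e * 2 ^+ k).
    rewrite exprS mulrCA (powRM _ (ler0n R 2) (ltW (a0 k))) -[RHS]mulrA.
    rewrite [X in _ = _ * X]mulrC /q mulr_powRB1 ?(ltW (a0 _))//.
    by rewrite (lt_trans _ p1).
  rewrite EFinM -muleA.
  apply: (@le_trans _ _ ((2 `^ p * (e * 2 ^+ k) `^ q)%:E *
    ((2 * 3 ^+ n)%:E * \int[mu]_(x in D k) F x))%E).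
    apply: lee_wpmul2l; first by rewrite lee_fin mulr_ge0 ?powR_ge0.
    exact: maximal_weak_cut.
  rewrite muleA -EFinM mulrAC EFinM -muleA.
  apply: lee_wpmul2l; first by rewrite lee_fin !mulr_ge0 ?powR_ge0 ?exprn_ge0.
  rewrite integral_mkcond -ge0_integralZl//; first last.
  - by rewrite lee_fin powR_ge0.
  - by move=> x _; rewrite patchE; case: ifPn.
  - by apply/(measurable_restrictT F (mD k)); exact: measurable_funTS.
  rewrite le_eqVlt; apply/orP; left; apply/eqP; apply: eq_integral => x _.
  rewrite patchE; case: ifPn => [|].
    by rewrite inE /D/= => ->; rewrite mulr1.
  by rewrite notin_setE /D/= => /negP/negbTE ->; rewrite mulr0 mule0 mul0e.
have mI k : measurable_fun setT (fun x => ((e * 2 ^+ k) `^ q *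
      (if ((e * 2 ^+ k)%:E < 2%:E * F x)%E then 1 else 0))%R%:E * F x)%E.
  apply: emeasurable_funM => //; apply/measurable_EFinP.
  apply: measurable_funM => //.
  rewrite (_ : (fun x => _) = \1_(D k)); first exact: measurable_indic.
  apply/funext => x; rewrite indicE /D; case: ifPn => h.
    by rewrite mem_set.
  by rewrite memNset//; exact/negP.
rewrite -ge0_sume_distrr; last first.
  move=> k _; apply: integral_ge0 => x _; rewrite mule_ge0// lee_fin.
  by rewrite mulr_ge0 ?powR_ge0//; case: ifP.
rewrite -ge0_integral_sum//; last first.
  move=> k x _; rewrite mule_ge0// lee_fin.
  by rewrite mulr_ge0 ?powR_ge0//; case: ifP.
rewrite /maximal_cst -/q -mulrA [X in (_ <= X * _)%E]EFinM -[X in (_ <= X)%E]muleA.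
apply: lee_wpmul2l; first by rewrite lee_fin !mulr_ge0 ?powR_ge0 ?exprn_ge0.
have c0 : 0 <= 2 `^ q / (2 `^ q - 1) * 2 `^ q :> R.
  have q1 := powR2_gt1 q0.
  by rewrite !mulr_ge0 ?powR_ge0// invr_ge0 subr_ge0 ltW.
have mFp : measurable_fun setT (fun x => F x `^ p)%E.
  by apply: (measurableT_comp (measurable_poweR _)).
rewrite -ge0_integralZl//; last by move=> x _; exact: poweR_ge0.
apply: ge0_le_integral => //.
- move=> x _; apply: sume_ge0 => k _; rewrite mule_ge0// lee_fin.
  by rewrite mulr_ge0 ?powR_ge0//; case: ifP.
- exact: emeasurable_sum.
- exact: measurable_funeM.
move=> x _; rewrite -ge0_sume_distrl; last first.
  by move=> k _; rewrite lee_fin mulr_ge0 ?powR_ge0//; case: ifP.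
have F20 : (0 <= 2%:E * F x)%E by rewrite mule_ge0.
apply: (le_trans (lee_wpmul2r (F0 x) (geometric_level_sum N e0 q0 F20))).
rewrite poweRM// poweR_EFin muleA -EFinM -muleA (muleC (_ `^ _)%E) poweR_mul1//.
by rewrite /q subrK.
Qed.

(** The step functions [G K] have integrals bounded uniformly in [K] by the level sum, and their
    lower limit dominates the power of the maximal function at every point, including those where it
    is infinite. Fatou's lemma concludes. *)
Lemma maximal_strong (F : 'rV[R]_n -> \bar R) (p : R) :
  measurable_fun setT F -> (forall x, 0 <= F x)%E -> 1 < p ->
  (\int[mu]_x (maximal F x `^ p) <=
   (maximal_cst p)%:E * \int[mu]_x (F x `^ p))%E.
Proof.
move=> mF F0 p1; have p0 : 0 < p by rewrite (lt_trans _ p1).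
pose e K : R := 2 ^- K.
have e0 K : 0 < e K by rewrite invr_gt0 exprn_gt0.
pose A K k := [set x | ((e K * 2 ^+ k)%:E < maximal F x)%E].
have mA K k : measurable (A K k).
  rewrite /A -[X in measurable X]setTI; apply: emeasurable_fun_o_infty => //.
  exact: measurable_maximal.
(* The levels run from [2^-K] to [2^K]. The summand carries the upper end of its dyadic interval, so
   [G K x] dominates the power of [maximal F x] as soon as that value lies above [2^-K] and is at
   most [2^(K+1)]. *)
pose G K x : \bar R := (\sum_(k < (K + K).+1)
  ((e K * 2 ^+ k.+1) `^ p)%:E * (\1_(A K k) x)%:E)%E.
have mG K : measurable_fun setT (G K).
  apply: emeasurable_sum => k; apply: measurable_funeM.
  by apply/measurable_EFinP; exact: measurable_indic.
have G0 K x : (0 <= G K x)%E.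
  by apply: sume_ge0 => k _; rewrite mule_ge0// lee_fin// powR_ge0.
have term K k x : (k < (K + K).+1)%N -> ((e K * 2 ^+ k)%:E < maximal F x)%E ->
    (((e K * 2 ^+ k.+1) `^ p)%:E <= G K x)%E.
  move=> kK kx; rewrite /G (bigD1 (Ordinal kK))//= indicE mem_set// mule1.
  by rewrite leeDl// sume_ge0// => i _; rewrite mule_ge0// lee_fin// powR_ge0.
have eK K : e K * 2 ^+ (K + K) = 2 ^+ K.
  by rewrite exprD mulrA mulVf ?mul1r// expf_neq0.
have natK (v : R) : exists K0 : nat, forall K, (K0 <= K)%N -> v < 2 ^+ K.
  exists (Num.trunc `|v|).+1 => K hK.
  rewrite (le_lt_trans (ler_norm v))// (lt_le_trans (truncnS_gt _))//.
  apply: (@le_trans _ _ (K%:R)); first by rewrite ler_nat.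
  by rewrite -natrX ler_nat ltnW// ltn_expl.
have Hlim x : (maximal F x `^ p <= limn_einf (fun K => G K x))%E.
  apply: le_limn_einf => M HM.
  have := maximal_ge0 x F0; case mx : (maximal F x) => [v||//]; last first.
    move=> _; have [K0 HK] := natK M; exists K0 => K /HK MK.
    apply: le_trans (term K (K + K)%N x (leqnn _) _); last by rewrite mx ltry.
    rewrite lee_fin exprS mulrCA eK (le_trans (ltW MK))//.
    have K1 : 1 <= 2 ^+ K :> R by rewrite exprn_ege1// ler1n.
    have K2 : 2 ^+ K <= 2 * 2 ^+ K :> R by move: K1; lra.
    by rewrite (le_trans K2)// le1r_powR ?(ltW p1)// (le_trans K1).
  rewrite lee_fin le_eqVlt => /predU1P[v0|v0].
    exists 0%N => K _; apply: le_trans (G0 K x).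
    by move: HM; rewrite mx -v0 poweR0r// gt_eqF.
  have [K1 HK1] := natK v^-1; have [K2 HK2] := natK v.
  exists (maxn K1 K2) => K; rewrite geq_max => /andP[/HK1 h1 /HK2 h2].
  have ev : e K < v.
    by rewrite -(invrK v) ltf_pV2 ?posrE ?exprn_gt0 ?invr_gt0.
  have vK : v <= e K * 2 ^+ (K + K).+1.
    by rewrite exprS mulrCA eK; move: (ltW h2) v0; lra.
  have [k [kK k1 k2]] := dyadic_level ev vK.
  rewrite (le_trans HM)// mx; apply: le_trans (term K k x kK _); last by rewrite mx.
  rewrite poweR_EFin lee_fin ge0_ler_powR ?nnegrE// ?(ltW p0) ?(ltW v0)//.
  by rewrite mulr_ge0 ?exprn_ge0 ?(ltW (e0 K)).
have mMp : measurable_fun setT (fun x => maximal F x `^ p)%E.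
  by apply: (measurableT_comp (measurable_poweR _)); exact: measurable_maximal.
apply: (@le_trans _ _ (\int[mu]_x limn_einf (fun K => G K x))%E).
  apply: ge0_le_integral => //; first by move=> x _; exact: poweR_ge0.
  apply: (emeasurable_fun_cvg (fun K x => einfs (fun k => G k x) K)).
    by move=> K; exact: measurable_fun_einfs.
  by move=> x _; rewrite limn_einf_lim; exact: is_cvg_einfs.
apply: le_trans (fatou _ _ _ _) _ => //.
rewrite limn_einf_lim.
apply: lime_le; first exact: is_cvg_einfs.
apply: nearW => K; apply: (@le_trans _ _ (\int[mu]_x G K x)%E).
  by apply: ereal_inf_lbound; exists K => /=.
rewrite /G ge0_integral_sum//; last 2 first.
- move=> k; apply: measurable_funeM.
  by apply/measurable_EFinP; exact: measurable_indic.
- by move=> k x _; rewrite mule_ge0// lee_fin// powR_ge0.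
apply: le_trans (maximal_level_sum _ mF F0 p1 (e0 K)).
rewrite le_eqVlt; apply/orP; left; apply/eqP; apply: eq_bigr => k _.
rewrite ge0_integralZl//; first last.
- by rewrite lee_fin powR_ge0.
- by apply/measurable_EFinP; exact: measurable_indic.
by rewrite integral_indic// setIT.
Qed.

End maximal_strong.

(** * Partial derivatives and convolution *)

Section partial_derivatives.
Context {R : realType} {n : nat}.
Implicit Types (u v : 'rV[R]_n -> R) (x y : 'rV[R]_n).
Local Notation e_ i := (delta_mx ord0 i : 'rV[R]_n).

Lemma ball_normP x y (r : R) : ball x r y <-> `|x - y| < r.
Proof. by rewrite -ball_normE. Qed.

Lemma coord_le_norm x (i : 'I_n) : `|x ord0 i| <= `|x|.
Proof.
rewrite -[X in _ <= X]/(mx_norm x) mx_normrE.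
exact: (le_bigmax _ (fun ij : 'I_1 * 'I_n => `|x ij.1 ij.2|) (ord0, i)).
Qed.

Lemma norm_le_coord x (r : R) : 0 <= r -> (forall i, `|x ord0 i| <= r) -> `|x| <= r.
Proof.
move=> r0 H; rewrite -[X in X <= _]/(mx_norm x) mx_normrE.
by apply: bigmax_le => // -[i j] _ /=; rewrite (ord1 i).
Qed.

Lemma norm_delta_le (i : 'I_n) : `|e_ i| <= 1.
Proof.
apply: norm_le_coord => // j; rewrite mxE eqxx/=.
by case: eqP; rewrite ?normr1 ?normr0.
Qed.

Lemma line_quotientE u x (i : 'I_n) (t : R) :
  (fun h : R => h^-1 *: (((fun t => u (x + t *: e_ i)) \o shift t) (h *: 1) -
     u (x + t *: e_ i))) =
  (fun h : R => h^-1 *: ((u \o shift (x + t *: e_ i)) (h *: e_ i) -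
     u (x + t *: e_ i))).
Proof.
apply/funext => h /=; congr (_ *: (u _ - _)).
have -> : h *: (1 : R^o) = h by rewrite /GRing.scale/= mulr1.
by rewrite scalerDl addrCA.
Qed.

Lemma derivable_line u x (i : 'I_n) (t : R) :
  derivable u (x + t *: e_ i) (e_ i) <->
  derivable (fun t : R => u (x + t *: e_ i)) t 1.
Proof. by rewrite /derivable line_quotientE. Qed.

Lemma derive_line u x (i : 'I_n) (t : R) :
  'D_1 (fun t : R => u (x + t *: e_ i)) t = partial i u (x + t *: e_ i).
Proof. by rewrite /partial /derive line_quotientE. Qed.

Lemma line_lipschitz u x (i : 'I_n) (a L : R) :
  (forall y, derivable u y (e_ i)) ->
  (forall t, (0 <= t <= a) || (a <= t <= 0) -> `|partial i u (x + t *: e_ i)| <= L) ->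
  `|u (x + a *: e_ i) - u x| <= L * `|a|.
Proof.
move=> du dL; pose g t := u (x + t *: e_ i).
have dg t : derivable g t 1 by apply/derivable_line.
have cg (I : interval R) : {within [set` I], continuous g}.
  by apply: derivable_within_continuous => t _.
have dg' (t : R) : is_derive t (1 : R) g (partial i u (x + t *: e_ i)).
  by rewrite -derive_line; apply: DeriveDef.
have -> : u x = g 0 by rewrite /g scale0r addr0.
rewrite -/(g a).
have [a0|a0] := leP 0 a.
  have [c] := MVT_segment a0 (fun t _ => dg' t) (cg _).
  rewrite in_itv/= => /andP[c0 ca] ->; rewrite subr0 normrM ler_wpM2r//.
  by apply: dL; rewrite c0 ca.
have [c] := MVT_segment (ltW a0) (fun t _ => dg' t) (cg _).
rewrite in_itv/= => /andP[ca c0]; rewrite sub0r distrC => ->.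
rewrite normrM normrN ler_wpM2r//.
by apply: dL; rewrite ca c0 orbT.
Qed.

(* Points of the coordinate path from [x] to [y] stay in any ball (a cube)
   containing both ends. *)
Definition coord_path x y (k : nat) : 'rV[R]_n :=
  \row_j (if (j < k)%N then y ord0 j else x ord0 j).

(** Only partial derivatives are at hand, so the mean value theorem is applied along each of the [n]
    coordinate segments of the path, which accounts for the factor [n]. *)
Lemma ball_lipschitz u c (r L : R) x y :
  (forall i z, derivable u z (e_ i)) ->
  (forall i z, ball c r z -> `|partial i u z| <= L) ->
  ball c r x -> ball c r y -> `|u y - u x| <= n%:R * L * `|y - x|.
Proof.
move=> du dL cx cy.
have r0 : 0 < r by case: cx.
have path0 : coord_path x y 0 = x by apply/rowP => j; rewrite mxE.
have pathn : coord_path x y n = y by apply/rowP => j; rewrite mxE ltn_ord.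
have step (i : 'I_n) : `|u (coord_path x y i.+1) - u (coord_path x y i)| <= L * `|y - x|.
  have L0 : 0 <= L by apply: le_trans (dL i _ cx).
  have -> : coord_path x y i.+1 = coord_path x y i + (y ord0 i - x ord0 i) *: e_ i.
    apply/rowP => j; rewrite !mxE eqxx/= ltnS leq_eqVlt.
    have [/eqP/val_inj->|ji] := boolP (j == i :> nat).
      by rewrite !eqxx ltnn/= mulr1 addrC subrK.
    rewrite /=; have -> : (j == i) = false by apply/negbTE; apply: contra ji => /eqP ->.
    by rewrite mulr0 addr0.
  apply: (le_trans (line_lipschitz (L := L) _ _)) => //; last first.
    rewrite ler_wpM2l//; have := coord_le_norm (y - x) i.
    by rewrite !mxE.
  move=> t ty; apply: dL; split => // i0 j; rewrite (ord1 i0) {i0}.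
  case: cx => _ /(_ ord0) cx; case: cy => _ /(_ ord0) cy.
  rewrite !mxE eqxx/=; have [->|ji] := eqVneq j i; last first.
    by rewrite mulr0 addr0; case: ifP.
  rewrite ltnn mulr1; move: (cx i) (cy i); rewrite /ball/= !ltr_norml.
  by case/orP: ty; lra.
have -> : u y - u x = \sum_(i < n) (u (coord_path x y i.+1) - u (coord_path x y i)).
  rewrite -(big_mkord xpredT (fun i => u (coord_path x y i.+1) - u (coord_path x y i))).
  by rewrite (telescope_sumr (fun k => u (coord_path x y k)))// pathn path0.
rewrite (le_trans (ler_norm_sum _ _ _))//.
rewrite (le_trans (ler_sum _ (fun i _ => step i)))//.
by rewrite sumr_const card_ord -mulrA mulr_natl.
Qed.

Lemma derivable_partial_affine u (a : 'rV[R]_n) (b c : R) (i : 'I_n) x :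
  (forall y, derivable u y (e_ i)) ->
  derivable (fun z => c * u (a + b *: z)) x (e_ i) /\
  partial i (fun z => c * u (a + b *: z)) x =
    c * (b * partial i u (a + b *: x)).
Proof.
move=> du.
have dg (t : R) : is_derive t (1 : R) (fun t : R => u (a + b *: x + t *: e_ i))
    (partial i u (a + b *: x + t *: e_ i)).
  have d := (derivable_line u (a + b *: x) i t).1 (du _).
  by rewrite -derive_line; apply: DeriveDef.
have H : is_derive (0 : R) (1 : R)
    (fun t : R => c * u (a + b *: (x + t *: e_ i)))
    (c * (b * partial i u (a + b *: x))).
  have -> : (fun t : R => c * u (a + b *: (x + t *: e_ i))) =
      c \*: ((fun t : R => u (a + b *: x + t *: e_ i)) \o (fun t => b * t)).
    by apply/funext => t /=; rewrite scalerDr scalerA addrA.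
  have hb : is_derive (0 : R) (1 : R) (fun t : R => b * t) b.
    by rewrite -[X in is_derive _ _ _ X](mulr1 b); exact: is_deriveZ.
  have := dg (b * 0); rewrite mulr0 scale0r addr0 => dg0.
  have := @is_derive1_comp _ (fun t : R => u (a + b *: x + t *: e_ i))
    (fun t => b * t) 0 (partial i u (a + b *: x)) b.
  rewrite mulr0 => /(_ dg0 hb) h1.
  by have := is_deriveZ c h1; rewrite /GRing.scale/= [_ * b]mulrC.
split.
  rewrite -[x]addr0 -(scale0r (e_ i)); apply/derivable_line.
  by have [] := H.
rewrite -[x in LHS]addr0 -(scale0r (e_ i)) -derive_line.
by have [_ ->] := H.
Qed.

Lemma continuous_rV_affine (a : 'rV[R]_n) (b : R) :
  continuous (fun z : 'rV[R]_n => a + b *: z).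
Proof. by move=> z; apply: continuousD; [exact: cst_continuous|exact: scaler_continuous]. Qed.

Lemma continuous_comp_affine u (a : 'rV[R]_n) (b : R) :
  continuous u -> continuous (fun z : 'rV[R]_n => u (a + b *: z)).
Proof.
by move=> cu z; have := cvg_comp _ _ (@continuous_rV_affine a b z) (cu (a + b *: z)).
Qed.

Lemma Ck_affine k u (a : 'rV[R]_n) (b c : R) :
  Ck k u -> Ck k (fun z => c * u (a + b *: z)).
Proof.
elim: k u c => [|k IH] u c /= [cu H].
  split=> // z; apply: continuousM; first exact: cst_continuous.
  exact: continuous_comp_affine.
split.
  move=> z; apply: continuousM; first exact: cst_continuous.
  exact: continuous_comp_affine.
move=> i; have [du Cu] := H i; split.
  by move=> x; have [] := derivable_partial_affine a b c x du.
rewrite (_ : partial i _ = (fun z => c * b * partial i u (a + b *: z))).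
  exact: IH.
apply/funext => x; have [_ ->] := derivable_partial_affine a b c x du.
by rewrite mulrA.
Qed.

(** The condition [s < |x|] is open, so [u] vanishes in a neighbourhood of [x]. *)
Lemma partial_support u (s : R) :
  (forall x, s < `|x| -> u x = 0) -> forall i x, s < `|x| -> partial i u x = 0.
Proof.
move=> us i x sx; rewrite /partial.
rewrite (@near_eq_derive _ _ _ u (cst 0)) ?derive_cst//.
  near=> y; apply: us.
  near: y.
  have : open [set y : 'rV[R]_n | s < `|y|].
    rewrite (_ : [set _ | _] = (fun y : 'rV[R]_n => `|y|) @^-1` `]s, +oo[%classic).
      move/continuousP: (@norm_continuous R 'rV[R]_n); apply; exact: interval_open.
    by apply/seteqP; split => y /=; rewrite in_itv/= andbT.
  by move=> oU; exact: open_nbhs_nbhs.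
Unshelve. all: end_near. Qed.

Lemma continuous_support_bounded u (s : R) : 0 <= s ->
  continuous u -> (forall x, s < `|x| -> u x = 0) ->
  exists2 K, 0 <= K & forall x, `|u x| <= K.
Proof.
move=> s0 cu us.
have cB : compact [set x : 'rV[R]_n | `|x| <= s].
  apply: bounded_closed_compact.
    exists s; split; first exact: ger0_real.
    by move=> r sr x /= /le_trans; apply; exact: ltW.
  rewrite (_ : [set _ | _] = (fun y : 'rV[R]_n => `|y|) @^-1` `]-oo, s]%classic).
    apply: closed_comp; first by move=> y _; exact: norm_continuous.
    exact: interval_closed.
  by apply/seteqP; split => y /=; rewrite in_itv.
have cnu : continuous (fun x => `|u x|).
  move=> x; apply: (continuous_comp (f := u)); first exact: cu.
  exact: norm_continuous.
have [||c _ Hc] := @EVT_max_rV R n (fun x => `|u x|) _ _ cB.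
- by exists 0; rewrite /= normr0.
- exact: continuous_subspaceT.
exists `|u c| => // x; have [xs|xs] := leP `|x| s.
  by apply: Hc; rewrite inE.
by rewrite us// normr0.
Qed.

(* [s] bounds the support, [K] the function, and [L] its partial derivatives. *)
Definition C1c u (s K L : R) : Prop :=
  [/\ continuous u,
      forall i x, derivable u x (e_ i),
      forall i, continuous (partial i u),
      forall x, s < `|x| -> u x = 0
    & (forall x, `|u x| <= K) /\ (forall i x, `|partial i u x| <= L)].

Lemma Ck1_C1c u (s : R) : 0 <= s -> Ck 1 u -> (forall x, s < `|x| -> u x = 0) ->
  exists2 K, 0 <= K & C1c u s K K.
Proof.
move=> s0 [cu Hu] us.
have [K K0 uK] := continuous_support_bounded s0 cu us.
have H i : exists L, 0 <= L /\ forall x, `|partial i u x| <= L.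
  have [L L0 uL] := continuous_support_bounded s0 (Hu i).2.1 (partial_support us i).
  by exists L.
have {H}[L HL] := choice H.
exists (K + \sum_i L i).
  by rewrite addr_ge0// sumr_ge0// => i _; have [] := HL i.
split => //.
- by move=> i x; have [+ _] := Hu i; apply.
- by move=> i; have [_ []] := Hu i.
split=> [x|i x].
  by rewrite (le_trans (uK x))// lerDl sumr_ge0// => i _; have [] := HL i.
rewrite (le_trans ((HL i).2 x))//.
rewrite (bigD1 i)//= addrCA lerDl addr_ge0// sumr_ge0// => j _.
by have [] := HL j.
Qed.

End partial_derivatives.

(** * Convolution of a compactly supported [C^1] kernel with a locally integrable function *)

Section convolution.
Context {R : realType} {n : nat}.
Local Notation mu := (@lebesgue_rV R n).
Implicit Types (u v w f G : 'rV[R]_n -> R) (x y z : 'rV[R]_n).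
Local Notation e_ i := (delta_mx ord0 i : 'rV[R]_n).

Definition locint v := measurable_fun setT v /\
  forall y (r : R), mu.-integrable (ball y r) (EFin \o v).

Definition absint v y (r : R) : R := \int[mu]_(z in ball y r) `|v z|.

Lemma EFin_absint v y r : locint v ->
  (absint v y r)%:E = (\int[mu]_(z in ball y r) `|v z|%:E)%E.
Proof.
move=> [mv /(_ y r) iv]; rewrite /absint /Rintegral fineK//.
apply: (integrable_fin_num _ _ (f := fun z => `|v z|%:E)) => //.
  exact: measurable_rV_ball.
by have := integrable_abse iv.
Qed.

Lemma absint_ge0 v y r : 0 <= absint v y r.
Proof. exact: Rintegral_ge0. Qed.

Lemma absint_le v y r y' r' : locint v -> ball y r `<=` ball y' r' ->
  absint v y r <= absint v y' r'.
Proof.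
move=> lv sub; rewrite -lee_fin.
rewrite [X in (X <= _)%E](EFin_absint y r lv) [X in (_ <= X)%E](EFin_absint y' r' lv).
apply: ge0_subset_integral => //; [exact: measurable_rV_ball|exact: measurable_rV_ball|].
apply: measurable_funTS; apply/measurable_EFinP; apply: measurableT_comp => //.
by case: lv.
Qed.

(** The common source of the convolution estimates below: domination by [K |v|] on one cube yields
    both integrability and a bound for the integral. *)
Lemma dominated_on_ball w v y (r K : R) : measurable_fun setT w -> locint v ->
  0 <= K -> (forall z, ball y r z -> `|w z| <= K * `|v z|) ->
  (forall z, ~ ball y r z -> w z = 0) ->
  mu.-integrable setT (EFin \o w) /\ `|\int[mu]_z w z| <= K * absint v y r.
Proof.
move=> mw lv K0 wv w0.
have mb : measurable (ball y r : set 'rV[R]_n) by exact: measurable_rV_ball.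
pose Kv z : \bar R := (K * `|v z|)%:E.
have iKv : mu.-integrable setT (Kv \_ (ball y r)).
  apply/(integrable_mkcond _ mb).
  have -> : Kv = (fun z => K%:E * `|(v z)%:E|)%E.
    by apply/funext => z; rewrite /Kv EFinM.
  by apply: integrableZl => //; apply: integrable_abse; case: lv.
have leKv z : (`|w z|%:E <= ((fun z => (K * `|v z|)%:E) \_ (ball y r)) z)%E.
  rewrite patchE; case: ifPn => [|]; first by rewrite inE lee_fin; exact: wv.
  by rewrite notin_setE => /w0 ->; rewrite normr0.
have iw : mu.-integrable setT (EFin \o w).
  apply: (le_integrable _ _ _ iKv) => //; first exact/measurable_EFinP.
  move=> z _; apply: (le_trans (leKv z)).
  exact: lee_abs.
split => //.
rewrite -lee_fin EFin_normr_Rintegral//.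
apply: (le_trans (le_abse_integral _ _ _)) => //; first exact/measurable_EFinP.
rewrite EFinM EFin_absint// -ge0_integralZl//; last first.
  apply: measurable_funTS; apply/measurable_EFinP; apply: measurableT_comp => //.
  by case: lv.
rewrite [leRHS]integral_mkcond; apply: ge0_le_integral => //.
- by apply: measurableT_comp => //; exact/measurable_EFinP.
- by have /integrableP[] := iKv.
- by move=> z _; exact: leKv.
Qed.

Lemma measurable_reflect u y : continuous u ->
  measurable_fun setT (fun z => u (y - z)).
Proof.
move=> cu; rewrite (_ : (fun z => _) = (fun z => u (y + (-1) *: z))).
  by apply: continuous_measurable_rV; exact: continuous_comp_affine.
by apply/funext => z; rewrite scaleN1r.
Qed.

Lemma convolution_bound u v y (s K r : R) :
  continuous u -> (forall x, `|u x| <= K) -> (forall x, s < `|x| -> u x = 0) ->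
  locint v -> s < r ->
  mu.-integrable setT (EFin \o (fun z => u (y - z) * v z)) /\
  `|convolution u v y| <= K * absint v y r.
Proof.
move=> cu uK us lv sr; apply: dominated_on_ball => //.
- by apply: measurable_funM; [exact: measurable_reflect|case: lv].
- by rewrite (le_trans _ (uK 0)).
- by move=> z _; rewrite normrM ler_wpM2r.
move=> z /ball_normP /negP; rewrite -leNgt => rz.
by rewrite us ?mul0r// (lt_le_trans sr).
Qed.

Lemma C1c_lipschitz u (s K L : R) x y : C1c u s K L ->
  `|u y - u x| <= n%:R * L * `|y - x|.
Proof.
move=> [_ du _ _ [_ uL]].
apply: (@ball_lipschitz _ _ u x (`|x - y| + 1)) => //.
  by apply: ballxx; rewrite ltr_wpDl.
by apply/ball_normP; rewrite ltrDl.
Qed.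

Lemma convolution_continuous u v (s K L : R) : 0 <= L ->
  C1c u s K L -> locint v -> continuous (convolution u v).
Proof.
move=> L0 Cu lv y; have [cu _ _ us [uK _]] := Cu.
(* If [y'] is within 1 of [y], both [u (y - z)] and [u (y' - z)] vanish for [z] outside the ball of
   radius [s + 2] about [y]. There the Lipschitz bound for [u] applies. *)
pose M := n%:R * L * absint v y (s + 2).
have M0 : 0 <= M by rewrite !mulr_ge0// absint_ge0.
have key y' : `|y - y'| < 1 ->
    `|convolution u v y - convolution u v y'| <= M * `|y - y'|.
  move=> yy'.
  have s1 : s < s + 1 by rewrite ltrDl.
  have [i1 _] := convolution_bound y cu uK us lv s1.
  have [i2 _] := convolution_bound y' cu uK us lv s1.
  rewrite /convolution -RintegralB//.
  rewrite /M mulrAC.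
  apply: (dominated_on_ball _ _ _ _ _).2 => //.
  - apply: measurable_funB; apply: measurable_funM; try (by case: lv);
      exact: measurable_reflect.
  - by rewrite !mulr_ge0.
  - move=> z _; rewrite -mulrBl normrM ler_wpM2r//.
    rewrite (le_trans (C1c_lipschitz _ _ Cu))//.
    by rewrite opprB addrA subrK.
  - move=> z /ball_normP /negP; rewrite -leNgt => rz.
    have h1 : s < `|y - z| by rewrite (lt_le_trans _ rz)// ltrDl.
    have h2 : s < `|y' - z|.
      have : `|y - z| <= `|y - y'| + `|y' - z|.
        by rewrite (le_trans _ (ler_normD _ _))// addrA subrK.
      by move: rz yy'; lra.
    by rewrite us// us// !mul0r subrr.
apply/(@cvgrPdist_le R R^o _ (nbhs (y : 'rV[R]_n)) (nbhs_filter (y : 'rV[R]_n))) => e e0 /=.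
near=> y'.
have d1 : `|y - y'| < 1 by near: y'; exact: cvgr_dist_lt.
have d2 : `|y - y'| < e / (M + 1).
  by near: y'; apply: cvgr_dist_lt => //; rewrite divr_gt0// ltr_wpDl.
rewrite (le_trans (key y' d1))//.
rewrite (@le_trans _ _ ((M + 1) * `|y - y'|))//.
  by rewrite ler_wpM2r// lerDl.
by rewrite mulrC -ler_pdivlMr ?ltW// ltr_wpDl.
Unshelve. all: end_near. Qed.

(** Differentiation under the integral sign. All derivatives fall on the kernel; for [|t| < 1] the
    differentiated integrand is dominated by [L |v|] on the ball of radius [s + 2] about [y]. *)
Lemma convolution_partial u v (s K L : R) (i : 'I_n) y : 0 <= s -> 0 <= L ->
  C1c u s K L -> locint v ->
  derivable (convolution u v) y (e_ i) /\
  partial i (convolution u v) y = convolution (partial i u) v y.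
Proof.
move=> s0 L0 Cu lv; have [cu du cdu us [uK uL]] := Cu.
have [mv iv] := lv.
pose F (t : R) z := u (y + t *: e_ i - z) * v z.
have FE t z : F t z = v z *: u ((y - z) + t *: e_ i).
  by rewrite /F addrAC mulrC.
have dF (t : R) z : is_derive t (1 : R) (F ^~ z)
    (v z * partial i u (y + t *: e_ i - z)).
  have -> : F ^~ z = v z \*: (fun t : R => u ((y - z) + t *: e_ i)).
    by apply/funext => t'; rewrite FE.
  apply: is_deriveZ; rewrite addrAC -derive_line; apply: DeriveDef => //.
  by apply/derivable_line; exact: du.
have s1 : s < s + 1 by rewrite ltrDl.
have iF (t : R) : mu.-integrable setT (EFin \o F t).
  by have [] := convolution_bound (y + t *: e_ i) cu uK us lv s1.
pose G z := L * `|v z| * \1_(ball y (s + 2)) z.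
have G0 z : 0 <= G z by rewrite !mulr_ge0.
have iG : mu.-integrable setT (EFin \o G).
  have mb : measurable (ball y (s + 2) : set 'rV[R]_n) by exact: measurable_rV_ball.
  apply: (@dominated_on_ball G v y (s + 2) L _ lv L0 _ _).1 => [||z nyz].
  - apply: measurable_funM; last exact: measurable_indic.
    by apply: measurable_funM => //; exact: measurableT_comp.
  - move=> z yz; rewrite /G indicE mem_set// mulr1 normrM normr_id.
    by rewrite ger0_norm.
  - by rewrite /G indicE memNset// mulr0.
have d1F (t : R) z : partial1of2 F t z = v z * partial i u (y + t *: e_ i - z).
  by rewrite partial1of2E; have [_ ->] := dF t z.
have FG (t : R) z : `]-1, 1[%classic t -> setT z -> `|partial1of2 F t z| <= G z.
  rewrite /= in_itv/= -ltr_norml => t1 _; rewrite d1F /G normrM.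
  rewrite indicE; case: (boolP (z \in (ball y (s + 2) : set 'rV[R]_n))) => [_|].
    by rewrite mulr1 mulrC ler_wpM2r.
  rewrite notin_setE => /ball_normP /negP; rewrite -leNgt => rz.
  rewrite (partial_support us) ?normr0 ?mulr0//.
  have h1 : `|t *: e_ i| <= `|t|.
    by rewrite normrZ ler_piMr// norm_delta_le.
  have : `|y - z| <= `|y + t *: e_ i - z| + `|t *: e_ i|.
    have -> : y - z = (y + t *: e_ i - z) - t *: e_ i by rewrite addrAC addrK.
    exact: ler_normB.
  by move: rz t1 h1; lra.
have I0 : `](-1)%R, 1%R[%classic (0 : R) by rewrite /= in_itv/=; lra.
have derF (t : R) z : `](-1)%R, 1%R[%classic t -> setT z -> derivable (F ^~ z) t 1.
  by move=> _ _; have [] := dF t z.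
have H := @cvg_differentiation_under_integral R _ _ mu F setT measurableT 0 (-1) 1
  I0 (fun t _ => iF t) derF G G0 iG FG.
have {}H : h^-1 *: ((convolution u v \o shift y) (h *: e_ i) - convolution u v y)
    @[h --> 0^'] --> convolution (partial i u) v y.
  have -> : convolution (partial i u) v y = \int[mu]_z partial1of2 F 0 z.
    by apply: eq_Rintegral => z _; rewrite d1F scale0r addr0 mulrC.
  rewrite [X in X @ _ --> _](_ : _ =
    (fun h => h^-1 *: ((\int[mu]_z F (h + 0) z) - \int[mu]_z F 0 z))).
    exact: H.
  apply/funext => h; rewrite /convolution/=; congr (_ *: (_ - _)).
    by apply: eq_Rintegral => z _; rewrite /F addr0 (addrC y).
  by apply: eq_Rintegral => z _; rewrite /F scale0r addr0.
split; first by apply/cvg_ex; eexists; exact: H.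
exact: cvg_lim H.
Qed.

Lemma locint_cst (c : R) : locint (fun=> c).
Proof.
split=> // y r; have [r0|r0] := ltP 0 r; last first.
  rewrite (_ : ball y r = set0); first exact: integrable_set0.
  by apply/seteqP; split => // z [/lt_le_trans/(_ r0)]; rewrite ltxx.
apply/integrableP; split; first exact: (measurable_cst c%:E).
rewrite [X in (X < _)%E](_ : _ = \int[mu]_(x in ball y r) cst `|c|%:E x)%E//.
rewrite integral_cst; last exact: measurable_rV_ball.
rewrite [X in (_ * X < _)%E](_ : _ = ((r *+ 2) ^+ n)%:E); first by rewrite ltry.
exact: lebesgue_rV_ball.
Qed.

Lemma locint_continuous v : continuous v -> locint v.
Proof.
move=> cv; have mv := continuous_measurable_rV cv.
split=> // y r; have [r0|r0] := ltP 0 r; last first.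
  rewrite (_ : ball y r = set0); first exact: integrable_set0.
  by apply/seteqP; split => // z [/lt_le_trans/(_ r0)]; rewrite ltxx.
have cB : compact [set x : 'rV[R]_n | `|x| <= `|y| + r].
  apply: bounded_closed_compact.
    exists (`|y| + r); split; first by rewrite ger0_real// addr_ge0// ltW.
    by move=> e sr x /= /le_trans; apply; exact: ltW.
  rewrite (_ : [set _ | _] = (fun y : 'rV[R]_n => `|y|) @^-1` `]-oo, `|y| + r]%classic).
    apply: closed_comp; first by move=> z _; exact: norm_continuous.
    exact: interval_closed.
  by apply/seteqP; split => z /=; rewrite in_itv.
have cnu : continuous (fun x => `|v x|).
  move=> x; apply: (continuous_comp (f := v)); first exact: cv.
  exact: norm_continuous.
have [||c _ Hc] := @EVT_max_rV R n (fun x => `|v x|) _ _ cB.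
- by exists 0; rewrite /= normr0 addr_ge0// ltW.
- exact: continuous_subspaceT.
have mb : measurable (ball y r : set 'rV[R]_n) by exact: measurable_rV_ball.
apply: (le_integrable mb _ _ ((locint_cst (`|v c|)).2 y r)).
  by apply/measurable_EFinP; exact: measurable_funTS.
move=> x /ball_normP yx; rewrite /= normr_id lee_fin; apply: Hc; rewrite inE/=.
have : `|x| <= `|y| + `|x - y|.
  by rewrite (le_trans _ (ler_normD _ _))// addrC subrK.
by rewrite distrC; move: yx; lra.
Qed.

Lemma integrable_continuous_support u (s : R) : 0 <= s -> continuous u ->
  (forall x, s < `|x| -> u x = 0) -> mu.-integrable setT (EFin \o u).
Proof.
move=> s0 cu us; have [K K0 uK] := continuous_support_bounded s0 cu us.
have s1 : s < s + 1 by rewrite ltrDl.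
have [H _] := convolution_bound 0 cu uK us (locint_cst 1) s1.
have := integrable_rV_affine (0 : 'rV[R]_n) (_ : -1 != 0 :> R) H.
rewrite oppr_eq0 oner_eq0 => /(_ isT); congr (mu.-integrable _ _).
by apply/funext => z /=; rewrite mulr1 sub0r add0r scaleN1r opprK.
Qed.

(** The integral of [partial i u] is the convolution of [partial i u] with the constant 1, hence a
    partial derivative of the convolution of [u] with 1. The latter is a constant function by
    translation and reflection invariance. No iterated integration is involved. *)
Lemma integral_partial_eq0 u (s K L : R) (i : 'I_n) : 0 <= s -> 0 <= L ->
  C1c u s K L -> \int[mu]_z partial i u z = 0.
Proof.
move=> s0 L0 Cu; have [cu du cdu us [uK uL]] := Cu.
have [_ ] := convolution_partial i 0 s0 L0 Cu (locint_cst 1).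
have int_reflect w y : mu.-integrable setT (EFin \o w) ->
    convolution w (fun=> 1) y = \int[mu]_z w z.
  move=> iw; rewrite -[RHS]mul1r.
  have := Rintegral_rV_affine y (_ : -1 != 0 :> R) iw.
  rewrite normrN normr1 expr1n invr1 => <-; last by rewrite oppr_eq0 oner_eq0.
  by apply: eq_Rintegral => z _; rewrite mulr1 scaleN1r.
rewrite (int_reflect (partial i u)); last first.
  exact: (integrable_continuous_support s0 (cdu i) (partial_support us i)).
move=> <-; rewrite (_ : convolution u (fun=> 1) = cst (\int[mu]_z u z)).
  by rewrite /partial derive_cst.
by apply/funext => y; apply: int_reflect; exact: integrable_continuous_support us.
Qed.

Lemma absint_le_fun f G y (r : R) : locint f -> locint G ->
  (forall x, `|f x| <= `|G x|) -> absint f y r <= absint G y r.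
Proof.
move=> lf lG fG; apply: le_Rintegral => //.
- exact: measurable_rV_ball.
- by have := integrable_abse (lf.2 y r).
- by have := integrable_abse (lG.2 y r).
Qed.

End convolution.
#[global] Opaque absint.

Section convolution_more.
Context {R : realType} {n : nat}.
Local Notation mu := (@lebesgue_rV R n).
Implicit Types (u v w f : 'rV[R]_n -> R) (x y z : 'rV[R]_n).
Local Notation e_ i := (delta_mx ord0 i : 'rV[R]_n).

Lemma continuous_translate v z :
  continuous v -> continuous (fun x : 'rV[R]_n => v (x - z)).
Proof.
move=> cv; rewrite (_ : (fun x => _) = (fun x => v (- z + 1 *: x))).
  exact: continuous_comp_affine.
by apply/funext => x; rewrite scale1r addrC.
Qed.

(** By Fubini each side is the integral of [f] against a composed kernel, and the two composed
    kernels agree after a reflection of the inner variable. This serves to compare mollifications at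
    two scales. *)
Lemma convolution_comm u v f y (s r K L K' L' : R) :
  0 <= s -> 0 <= r ->
  C1c u s K L -> C1c v r K' L' -> locint f ->
  convolution u (convolution v f) y = convolution v (convolution u f) y.
Proof.
move=> s0 r0 Cu Cv lf.
have [cu _ _ us [uK _]] := Cu; have [cv _ _ vr [vK _]] := Cv.
have [mf _] := lf.
have K0 : 0 <= K by rewrite (le_trans _ (uK 0)).
have K'0 : 0 <= K' by rewrite (le_trans _ (vK 0)).
pose k u v z := \int[mu]_w (u (y - w) * v (w - z)).
have key (u1 v1 : 'rV[R]_n -> R) (s1 r1 K1 K2 : R) : 0 <= s1 -> 0 <= r1 -> 0 <= K1 -> 0 <= K2 ->
    continuous u1 -> continuous v1 ->
    (forall x, `|u1 x| <= K1) -> (forall x, `|v1 x| <= K2) ->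
    (forall x, s1 < `|x| -> u1 x = 0) -> (forall x, r1 < `|x| -> v1 x = 0) ->
    convolution u1 (convolution v1 f) y = \int[mu]_z (k u1 v1 z * f z).
  move=> s10 r10 K10 K20 cu1 cv1 u1K v1K u1s v1r.
  pose F (p : 'rV[R]_n * 'rV[R]_n) : \bar R :=
    (u1 (y - p.1) * v1 (p.1 - p.2) * f p.2)%:E.
  have mF : measurable_fun setT F.
    apply/measurable_EFinP; apply: measurable_funM.
      apply: measurable_funM.
        by apply: (measurableT_comp (measurable_reflect y cu1)).
      apply: (measurableT_comp (continuous_measurable_rV cv1)).
      exact: measurable_rV_sub.
    exact: (measurableT_comp mf).
  have iF : (\int[mu]_x \int[mu]_z `|F (x, z)| < +oo)%E.
    (* The outer integrand vanishes off the ball of radius [s1 + 1] about [y]. For [x] in it, the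
       inner integral runs over the ball of radius [r1 + 1] about [x], which lies in the ball of
       radius [s1 + r1 + 2] about [y]. *)
    pose M := K1 * K2 * absint f y (s1 + r1 + 2).
    have M0 : 0 <= M by rewrite !mulr_ge0// absint_ge0.
    apply: (@le_lt_trans _ _ (\int[mu]_x ((fun=> M%:E) \_ (ball y (s1 + 1))) x)%E).
      apply: ge0_le_integral => //.
      - by move=> x _; exact: integral_ge0.
      - have mFa : measurable_fun setT (fun p => `|F p|%E) by exact: measurableT_comp.
        exact: (@measurable_fun_fubini_tonelli_F _ _ _ _ _ mu (fun p => `|F p|%E) mFa (fun _ => abse_ge0 _)).
      - apply/(measurable_restrictT _ (measurable_rV_ball _ _)).
        exact: measurable_cst.
      move=> x _; rewrite patchE.
      have [xB|xB] := boolP (x \in (ball y (s1 + 1) : set 'rV[R]_n)); last first.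
        rewrite le_eqVlt; apply/orP; left; apply/eqP; apply: integral0_eq => z _.
        move: xB; rewrite notin_setE => /ball_normP /negP; rewrite -leNgt => yx.
        by rewrite /F/= u1s ?mul0r ?normr0// (lt_le_trans _ yx)// ltrDl.
      move: xB; rewrite inE => /ball_normP yx.
      pose w z := u1 (y - x) * v1 (x - z) * f z.
      have [iw wM] : mu.-integrable setT (EFin \o (fun z => `|w z|)) /\
         `|\int[mu]_z `|w z| | <= K1 * K2 * absint f x (r1 + 1).
        apply: dominated_on_ball => //.
        - apply: measurableT_comp => //; apply: measurable_funM => //.
          by apply: measurable_funM => //; exact: measurable_reflect.
        - by rewrite mulr_ge0.
        - by move=> z _; rewrite normr_id /w !normrM ler_wpM2r// ler_pM.
        move=> z /ball_normP /negP; rewrite -leNgt => rz.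
        by rewrite /w v1r ?mulr0 ?mul0r ?normr0// (lt_le_trans _ rz)// ltrDl.
      rewrite [leLHS](_ : _ = (\int[mu]_z `|w z|)%:E); last first.
        by rewrite /Rintegral fineK//; apply: integrable_fin_num.
      rewrite lee_fin; apply: (le_trans (ler_norm _)); apply: (le_trans wM).
      apply: ler_wpM2l; first exact: mulr_ge0.
      apply: absint_le => // z /ball_normP xz; apply/ball_normP.
      have : `|y - z| <= `|y - x| + `|x - z|.
        by rewrite (le_trans _ (ler_normD _ _))// addrA subrK.
      by move: yx xz; lra.
    rewrite -integral_mkcond integral_cst; last exact: measurable_rV_ball.
    rewrite [X in (_ * X < _)%E](_ : _ = (((s1 + 1) *+ 2) ^+ n)%:E) ?ltry//.
    by apply: lebesgue_rV_ball; rewrite ltr_wpDl.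
  have {}iF := (@integrable12ltyP _ _ _ _ _ mu mu F mF).2 iF.
  have s11 : s1 < s1 + 1 by rewrite ltrDl.
  have r11 : r1 < r1 + 1 by rewrite ltrDl.
  have lhs x : (u1 (y - x) * convolution v1 f x)%:E = (\int[mu]_z F (x, z))%E.
    have [ic _] := convolution_bound x cv1 v1K v1r lf r11.
    rewrite /convolution -RintegralZl// /Rintegral fineK; last first.
      apply: integrable_fin_num => //.
      rewrite (_ : (fun z => _) = (fun z => (u1 (y - x))%:E * (v1 (x - z) * f z)%:E)%E).
        exact: integrableZl.
      by apply/funext => z; rewrite EFinM.
    by apply: eq_integral => z _; rewrite /F/= mulrA.
  have rhs z : (k u1 v1 z * f z)%:E = (\int[mu]_x F (x, z))%E.
    have cz := @continuous_translate v1 z cv1.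
    have [ic _] := convolution_bound y cu1 u1K u1s (locint_continuous cz) s11.
    rewrite /k -RintegralZr// /Rintegral fineK//.
    apply: integrable_fin_num => //.
    rewrite (_ : (fun x => _) = (fun x => (u1 (y - x) * v1 (x - z))%:E * (f z)%:E)%E).
      exact: integrableZr.
    by apply/funext => x; rewrite EFinM.
  rewrite {1}/convolution /Rintegral; congr fine.
  under eq_integral do rewrite lhs.
  under [in RHS]eq_integral do rewrite rhs.
  exact: (@Fubini _ _ _ _ _ mu mu F iF).
rewrite (key u v s r K K' s0 r0 K0 K'0 cu cv uK vK us vr).
rewrite (key v u r s K' K r0 s0 K'0 K0 cv cu vK uK vr us).
apply: eq_Rintegral => z _; congr (_ * _); rewrite /k.
have cz := @continuous_translate v z cv.
have s1 : s < s + 1 by rewrite ltrDl.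
have [ic _] := convolution_bound y cu uK us (locint_continuous cz) s1.
(* The substitution [w -> y + z - w] exchanges the arguments [y - w] and [w - z]. *)
have := Rintegral_rV_affine (y + z) (_ : -1 != 0 :> R) ic.
rewrite oppr_eq0 oner_eq0 normrN normr1 expr1n invr1 mul1r => /(_ isT) <-.
apply: eq_Rintegral => w _; rewrite scaleN1r mulrC; congr (v _ * u _).
  by rewrite addrAC addrK.
by rewrite !opprD opprK addrA addrA subrr add0r addrC.
Qed.

(** Since [u] is a probability density, the difference is an average of [F z - F y] over points [z]
    within [r] of [y]. *)
Lemma convolution_near (u F : 'rV[R]_n -> R) y (s r L K K' : R) : 0 <= s -> s < r -> 0 <= L ->
  C1c u s K K' -> (forall x, 0 <= u x) -> \int[mu]_x u x = 1 ->
  continuous F -> (forall i x, derivable F x (e_ i)) ->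
  (forall i x, ball y r x -> `|partial i F x| <= L) ->
  `|convolution u F y - F y| <= n%:R * L * r.
Proof.
move=> s0 sr L0 Cu u0 u1 cF dF FL; have [cu _ _ us [uK _]] := Cu.
have r0 : 0 < r by exact: le_lt_trans sr.
have [iF _] := convolution_bound y cu uK us (locint_continuous cF) sr.
have [i1 _] := convolution_bound y cu uK us (locint_cst 1) sr.
have c1 : \int[mu]_z (u (y - z) * 1) = 1.
  rewrite -[RHS]u1 -[RHS]mul1r.
  have iu : mu.-integrable setT (EFin \o u).
    have := integrable_rV_affine y (_ : -1 != 0 :> R) i1.
    rewrite oppr_eq0 oner_eq0 => /(_ isT); congr (mu.-integrable _ _).
    by apply/funext => z /=; rewrite mulr1 scaleN1r opprD opprK addrA subrr add0r.
  have := Rintegral_rV_affine y (_ : -1 != 0 :> R) iu.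
  rewrite oppr_eq0 oner_eq0 normrN normr1 expr1n invr1 => /(_ isT) <-.
  by apply: eq_Rintegral => z _; rewrite mulr1 scaleN1r.
have -> : convolution u F y - F y = \int[mu]_z (u (y - z) * (F z - F y)).
  rewrite -[X in _ - X]mul1r -c1 -RintegralZr//.
  rewrite /convolution -RintegralB//; last first.
    rewrite (_ : (EFin \o _) = (fun z => (u (y - z) * 1)%:E * (F y)%:E)%E).
      exact: integrableZr.
    by apply/funext => z; rewrite /= EFinM.
  by apply: eq_Rintegral => z _; rewrite mulr1 mulrBr.
have cF' : continuous (fun z => F z - F y).
  by move=> z; apply: continuousB; [exact: cF|exact: cst_continuous].
have [iB _] := convolution_bound y cu uK us (locint_continuous cF') sr.
rewrite (le_trans (le_normr_Rintegral _ iB))//.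
apply: (@le_trans _ _ (\int[mu]_z (u (y - z) * 1 * (n%:R * L * r)))); last first.
  by rewrite RintegralZr// c1 mul1r.
apply: le_Rintegral => //.
- by have := integrable_abse iB.
- rewrite (_ : (EFin \o _) = (fun z => (u (y - z) * 1)%:E * (n%:R * L * r)%:E)%E).
    exact: integrableZr.
  by apply/funext => z; rewrite /= EFinM.
move=> z _; rewrite mulr1 normrM (ger0_norm (u0 _)).
have [yz|yz] := ltP `|y - z| r; last by rewrite us ?mul0r// (lt_le_trans sr).
rewrite ler_wpM2l//.
have yzB : ball y r z by exact/ball_normP.
apply: (le_trans (ball_lipschitz dF FL (ballxx y r0) yzB)).
by rewrite ler_wpM2l ?mulr_ge0// distrC ltW.
Qed.

End convolution_more.

(** * Mollification, comparison of scales, and averages *)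

Section mollifier.
Context {R : realType} {n : nat}.
Local Notation mu := (@lebesgue_rV R n).
Implicit Types (h f G : 'rV[R]_n -> R) (x y z : 'rV[R]_n).
Local Notation e_ i := (delta_mx ord0 i : 'rV[R]_n).

Lemma norm_le_enorm x : `|x| <= enorm x.
Proof.
apply: norm_le_coord => [|i]; first exact: sqrtr_ge0.
rewrite -sqrtr_sqr ler_wsqrtr// /dot (bigD1 i)//= -expr2 lerDl.
by apply: sumr_ge0 => j _; rewrite -expr2 sqr_ge0.
Qed.

Lemma hardy_kernel_C1c h : hardy_kernel h ->
  exists2 K, 0 <= K & C1c h 1 K K.
Proof.
move=> [sh _ h1 _]; apply: (Ck1_C1c ler01 (sh 1%N)) => x x1.
apply/eqP; apply: contraTT x1 => /h1 hx.
by rewrite -leNgt ltW// (le_lt_trans (norm_le_enorm x)).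
Qed.

Lemma dilateE h (s : R) : dilate h s = fun x => s ^- n * h (0 + s^-1 *: x).
Proof. by apply/funext => x; rewrite /dilate add0r. Qed.

Lemma partial_dilate h (s : R) (i : 'I_n) x :
  (forall i y, derivable h y (e_ i)) ->
  partial i (dilate h s) x = s ^- n * (s^-1 * partial i h (s^-1 *: x)).
Proof.
move=> dh; rewrite dilateE.
have [_ ->] := derivable_partial_affine 0 s^-1 (s ^- n) x (dh i).
by rewrite add0r.
Qed.

Lemma C1c_dilate h (s K : R) : C1c h 1 K K -> 0 < s ->
  C1c (dilate h s) s (s ^- n * K) (s ^- n * (s^-1 * K)).
Proof.
move=> [ch dh cdh h1 [hK hL]] s0.
have sn0 : 0 <= s ^- n by rewrite invr_ge0 exprn_ge0// ltW.
split.
- rewrite dilateE.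
  exact: (@Ck_affine _ _ 0%N h 0 s^-1 (s ^- n) (conj ch I)).1.
- by move=> i x; rewrite dilateE; have [] := derivable_partial_affine 0 s^-1 (s ^- n) x (dh i).
- move=> i; rewrite (_ : partial i _ = (fun x => s ^- n * s^-1 * partial i h (0 + s^-1 *: x))).
    exact: (@Ck_affine _ _ 0%N _ 0 s^-1 (s ^- n * s^-1) (conj (cdh i) I)).1.
  by apply/funext => x; rewrite partial_dilate// mulrA add0r.
- move=> x sx; rewrite /dilate h1 ?mulr0// normrZ gtr0_norm ?invr_gt0//.
  by rewrite mulrC ltr_pdivlMr// mul1r.
split=> [x|i x].
  by rewrite /dilate normrM ger0_norm// ler_wpM2l.
have si0 : 0 <= s^-1 by rewrite invr_ge0 ltW.
by rewrite partial_dilate// normrM ger0_norm// ler_wpM2l// normrM ger0_norm// ler_wpM2l.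
Qed.

Lemma dilate_ge0 h (s : R) x : 0 < s -> (forall x, 0 <= h x) -> 0 <= dilate h s x.
Proof. by move=> s0 h0; rewrite mulr_ge0// invr_ge0 exprn_ge0// ltW. Qed.

Lemma integral_dilate h (s K : R) : C1c h 1 K K -> 0 < s ->
  \int[mu]_x dilate h s x = \int[mu]_x h x.
Proof.
move=> Ch s0; have [ch _ _ h1 _] := Ch.
have ih := integrable_continuous_support ler01 ch h1.
have s10 : s^-1 != 0 by rewrite invr_eq0 gt_eqF.
have ihs := integrable_rV_affine 0 s10 ih.
rewrite dilateE RintegralZl// Rintegral_rV_affine//.
have -> : `|s^-1| ^- n = s ^+ n by rewrite gtr0_norm ?invr_gt0// exprVn invrK.
by rewrite mulrA mulVf ?mul1r// expf_neq0// gt_eqF.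
Qed.

Lemma test_function_dilate h (s : R) y : 0 < s -> smooth h ->
  (forall x, 1 < `|x| -> h x = 0) ->
  test_function (fun z => dilate h s (y - z)).
Proof.
move=> s0 sh h1.
have E : (fun z => dilate h s (y - z)) =
    (fun z => s ^- n * h (s^-1 *: y + (- s^-1) *: z)).
  by apply/funext => z; rewrite /dilate scalerBr scaleNr.
split; first by move=> k; rewrite E; exact/Ck_affine/sh.
have sub : closure [set z | dilate h s (y - z) != 0] `<=` [set z | `|z| <= `|y| + s].
  have cl : closed [set z : 'rV[R]_n | `|z| <= `|y| + s].
    rewrite (_ : [set _ | _] = (fun y : 'rV[R]_n => `|y|) @^-1` `]-oo, `|y| + s]%classic).
      apply: closed_comp; first by move=> z _; exact: norm_continuous.
      exact: interval_closed.
    by apply/seteqP; split => z /=; rewrite in_itv.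
  rewrite [X in _ `<=` X](closure_id _).1//; apply: closure_subset => z /= hz.
  have yzs : `|y - z| <= s.
    rewrite leNgt; apply: contra hz => yzs; rewrite /dilate h1 ?mulr0//.
    rewrite normrZ gtr0_norm ?invr_gt0//.
    by rewrite mulrC ltr_pdivlMr// mul1r.
  have : `|z| <= `|y| + `|y - z|.
    by rewrite distrC (le_trans _ (ler_normD _ _))// addrC subrK.
  by move: yzs; lra.
apply: bounded_closed_compact; last exact: closed_closure.
exists (`|y| + s); split; first by rewrite ger0_real// addr_ge0// ltW.
by move=> e se z /sub /= /le_trans; apply; exact: ltW.
Qed.

(** The reflected kernel [dilate h s (y - z)] is a test function of [z]; the sign produced by the
    reflection cancels the one in the definition of the weak gradient. *)
Lemma weak_gradient_convolution h f (g : 'rV[R]_n -> 'rV[R]_n) (s K : R) (i : 'I_n) y :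
  0 < s -> smooth h -> C1c h 1 K K -> locint f -> weak_gradient f g ->
  convolution (partial i (dilate h s)) f y =
  convolution (dilate h s) (fun x => g x ord0 i) y.
Proof.
move=> s0 sh Ch lf wg; have [ch dh cdh h1 [hK hL]] := Ch.
have [_ _ cd ds [_ dL]] := C1c_dilate Ch s0.
have := wg _ (test_function_dilate y s0 sh h1) i.
have E z : partial i (fun z => dilate h s (y - z)) z = - partial i (dilate h s) (y - z).
  rewrite partial_dilate//.
  rewrite (_ : (fun z => _) = (fun z => s ^- n * h (s^-1 *: y + (- s^-1) *: z))); last first.
    by apply/funext => w; rewrite /dilate scalerBr scaleNr.
  have [_ ->] := derivable_partial_affine (s^-1 *: y) (- s^-1) (s ^- n) z (dh i).
  by rewrite mulNr mulrN scaleNr scalerBr.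
under eq_Rintegral do rewrite E mulrN -mulNr mulrC mulrN -mulN1r.
have s1 : s < s + 1 by rewrite ltrDl.
have [iF _] := convolution_bound y (cd i) (dL i) (partial_support ds i) lf s1.
rewrite RintegralZl// mulN1r => /oppr_inj => H.
rewrite /convolution H; apply: eq_Rintegral => z _; exact: mulrC.
Qed.

Definition sqint f := measurable_fun setT f /\
  mu.-integrable setT (EFin \o (fun x => f x ^+ 2)).

Lemma Lfun2_sqint f : f \in Lfun mu 2%:E -> sqint f.
Proof.
move=> f2; have i2 := Lfun2_integrable_sqr f2.
by move: f2; rewrite inE => /andP[mf _]; rewrite inE/= in mf.
Qed.

Lemma sqint_locint f : sqint f -> locint f.
Proof.
move=> [mf i2]; split=> // y r.
have mb : measurable (ball y r : set 'rV[R]_n) by exact: measurable_rV_ball.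
have i2b := integrableS measurableT mb (@subsetT _ _) i2.
apply: (le_integrable mb _ _ (integrableD mb ((locint_cst 1).2 y r) i2b)).
  by apply/measurable_EFinP; exact: measurable_funTS.
move=> x _; change (`|f x|%:E <= `|1 + f x ^+ 2|%:E)%E.
rewrite lee_fin [X in _ <= X]ger0_norm ?addr_ge0 ?sqr_ge0//.
rewrite -[f x ^+ 2]real_normK ?num_real//.
have := sqr_ge0 (`|f x| - 1); have := normr_ge0 (f x); move: `|f x| => a.
by rewrite sqrrB; nra.
Qed.

Lemma ball_in_ball x y (a b : R) : `|y - x| + a <= b -> ball x a `<=` ball y b.
Proof.
move=> ab z /ball_normP xz; apply/ball_normP.
have : `|y - z| <= `|y - x| + `|x - z|.
  by rewrite (le_trans _ (ler_normD _ _))// addrA subrK.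
by move: ab xz; lra.
Qed.

Lemma mollify_le h f (s K : R) x y (b : R) : 0 < s -> C1c h 1 K K -> locint f ->
  `|y - x| + 2 * s <= b ->
  `|convolution (dilate h s) f x| <= s ^- n * K * absint f y b.
Proof.
move=> s0 Ch lf sb; have [cd _ _ ds [dK _]] := C1c_dilate Ch s0.
have s2 : s < 2 * s by lra.
have [_ H] := convolution_bound x cd dK ds lf s2.
apply: (le_trans H); apply: ler_wpM2l; last first.
  by apply: absint_le => //; exact: ball_in_ball sb.
exact: le_trans (dK 0).
Qed.

(** A substitute for a Poincare inequality. With [r = s / 4], both terms are compared with the
    double mollification at scales [r] and [s]. By commutativity it is an average at scale [r] of
    the function mollified at [s], and also an average at scale [s] of the function mollified at
    [r]; in each case the gradient is bounded by an average of [G]. The first comparison contributes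
    1 to the constant, the second [2 * 4 ^+ n], because [r ^- n = 4 ^+ n * s ^- n]. *)
Lemma mollify_diff h f (g : 'rV[R]_n -> 'rV[R]_n) G (s K : R) y :
  0 < s -> hardy_kernel h -> C1c h 1 K K ->
  locint f -> (forall i, locint (fun x => g x ord0 i)) -> locint G ->
  (forall i x, `|g x ord0 i| <= `|G x|) -> weak_gradient f g ->
  `|convolution (dilate h s) f y - convolution (dilate h (s / 4)) f y| <=
  n%:R * K * (1 + 2 * 4 ^+ n) * s * (s ^- n * absint G y (4 * s)).
Proof.
move=> s0 [sh h0 _ h1] Ch lf lg lG gG wg.
pose r := s / 4; have r0 : 0 < r by rewrite divr_gt0.
have K0 : 0 <= K by have [_ _ _ _ [hK _]] := Ch; exact: le_trans (hK 0).
have Cs := C1c_dilate Ch s0; have Cr := C1c_dilate Ch r0.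
have sn0 : 0 <= s ^- n by rewrite invr_ge0 exprn_ge0// ltW.
have rn0 : 0 <= r ^- n by rewrite invr_ge0 exprn_ge0// ltW.
have L0 (a : R) : 0 < a -> 0 <= a ^- n * (a^-1 * K).
  by move=> a0; rewrite !mulr_ge0// invr_ge0 ?exprn_ge0// ltW.
have dconv (a : R) i x : 0 < a ->
    derivable (convolution (dilate h a) f) x (e_ i) /\
    partial i (convolution (dilate h a) f) x = convolution (dilate h a) (fun x => g x ord0 i) x.
  move=> a0.
  have [d ->] := convolution_partial i x (ltW a0) (L0 a a0) (C1c_dilate Ch a0) lf.
  by split => //; exact: (weak_gradient_convolution i x a0 sh Ch lf wg).
have cconv (a : R) : 0 < a -> continuous (convolution (dilate h a) f).
  by move=> a0; exact: (convolution_continuous (L0 a a0) (C1c_dilate Ch a0) lf).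
have pbound (a : R) i x : 0 < a -> `|y - x| + 2 * a <= 4 * s ->
    `|partial i (convolution (dilate h a) f) x| <= a ^- n * K * absint G y (4 * s).
  move=> a0 ab; rewrite (dconv a i x a0).2.
  apply: (le_trans (mollify_le a0 Ch (lg i) ab)).
  apply: ler_wpM2l; first by rewrite mulr_ge0// invr_ge0 exprn_ge0// ltW.
  by apply: absint_le_fun => // z; exact: gG.
have near1 : `|convolution (dilate h r) (convolution (dilate h s) f) y -
    convolution (dilate h s) f y| <= n%:R * (s ^- n * K * absint G y (4 * s)) * (2 * r).
  apply: (convolution_near (ltW r0) _ _ Cr).
  - by clear -s0 r0; lra.
  - exact: (mulr_ge0 (mulr_ge0 sn0 K0) (absint_ge0 _ _ _)).
  - by move=> x; exact: dilate_ge0.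
  - by rewrite (integral_dilate Ch r0).
  - exact: cconv.
  - by move=> i x; exact: (dconv s i x s0).1.
  - move=> i x /ball_normP yx; apply: pbound => //.
    by move: yx; rewrite /r; clear -s0; lra.
have near2 : `|convolution (dilate h s) (convolution (dilate h r) f) y -
    convolution (dilate h r) f y| <= n%:R * (r ^- n * K * absint G y (4 * s)) * (2 * s).
  apply: (convolution_near (ltW s0) _ _ Cs).
  - by clear -s0 r0; lra.
  - exact: (mulr_ge0 (mulr_ge0 rn0 K0) (absint_ge0 _ _ _)).
  - by move=> x; exact: dilate_ge0.
  - by rewrite (integral_dilate Ch s0).
  - exact: cconv.
  - by move=> i x; exact: (dconv r i x r0).1.
  - move=> i x /ball_normP yx; apply: pbound => //.
    by move: yx; rewrite /r; clear -s0; lra.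
have comm := convolution_comm y (ltW s0) (ltW r0) Cs Cr lf.
rewrite -/r.
have rnE : r ^- n = 4 ^+ n * s ^- n by rewrite /r expr_div_n invf_div.
have -> : n%:R * K * (1 + 2 * 4 ^+ n) * s * (s ^- n * absint G y (4 * s)) =
    n%:R * (s ^- n * K * absint G y (4 * s)) * s +
    n%:R * (r ^- n * K * absint G y (4 * s)) * (2 * s).
  by rewrite rnE; ring.
have near1' : n%:R * (s ^- n * K * absint G y (4 * s)) * (2 * r) <=
    n%:R * (s ^- n * K * absint G y (4 * s)) * s.
  apply: ler_wpM2l.
    by apply: mulr_ge0; [exact: ler0n|exact: (mulr_ge0 (mulr_ge0 sn0 K0) (absint_ge0 _ _ _))].
  by rewrite /r; clear -s0; lra.
move: near1 near2 near1'; rewrite comm.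
set p := convolution _ (convolution _ _) _; set q := convolution (dilate h s) f y.
set q' := convolution _ _ _; set A := _ * s; set B := _ * (2 * s).
by move: p q q' A B; clear => p q q' A B; rewrite !ler_norml; lra.
Qed.

Lemma mollify_sum_le h f (s K : R) y :
  0 < s -> C1c h 1 K K -> locint f ->
  `|convolution (dilate h s) f y + convolution (dilate h (s / 4)) f y| <=
  K * (1 + 4 ^+ n) * (s ^- n * absint f y (4 * s)).
Proof.
move=> s0 Ch lf; have r0 : 0 < s / 4 by rewrite divr_gt0.
have H1 : `|y - y| + 2 * s <= 4 * s by rewrite subrr normr0; lra.
have H2 : `|y - y| + 2 * (s / 4) <= 4 * s by rewrite subrr normr0; lra.
apply: (le_trans (ler_normD _ _)).
have := mollify_le s0 Ch lf H1; have := mollify_le r0 Ch lf H2.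
have -> : (s / 4) ^- n = 4 ^+ n * s ^- n by rewrite expr_div_n invf_div.
by move: (absint _ _ _) => A; move: (convolution _ _ _) (convolution _ _ _) => p q; lra.
Qed.

Local Notation M f := (maximal (fun x => `|f x|%:E)).

Lemma absint_le_maximal f x y (r : R) : locint f -> `|x - y| < r ->
  ((absint f y r)%:E <= ((6 * r) ^+ n)%:E * M f x)%E.
Proof.
move=> lf xy; rewrite EFin_absint//; apply: integral_ball_le_maximal.
- apply/measurable_EFinP; apply: measurableT_comp => //.
  by case: lf.
- by move=> z; rewrite lee_fin.
- by apply/ball_normP; rewrite distrC.
Qed.

(** The constant is [6 * 4]: the radius is [4 s], and passing to the maximal function costs 6 times
    the radius, to the power [n]. *)
Lemma average_le_maximal f y (s : R) : 0 < s -> locint f ->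
  ((s ^- n * absint f y (4 * s))%:E <= (24 ^+ n)%:E * M f y)%E.
Proof.
move=> s0 lf.
have s4 : `|y - y| < 4 * s by rewrite subrr normr0 mulr_gt0.
rewrite EFinM; apply: (@le_trans _ _ ((s ^- n)%:E * (((6 * (4 * s)) ^+ n)%:E * M f y))%E).
  apply: lee_wpmul2l; last exact: absint_le_maximal.
  by rewrite lee_fin invr_ge0 exprn_ge0// ltW.
rewrite muleA -EFinM [X in (X%:E * _ <= _)%E](_ : _ = 24 ^+ n)//.
by rewrite -exprVn -exprMn; congr (_ ^+ _); field; rewrite gt_eqF.
Qed.

(** The ball of radius [4 s] about [y] lies in the ball of radius [5 t] about [x]; normalizing by
    [s ^- n] instead of [t ^- n] costs [(t / s) ^+ n], and [30 = 6 * 5]. *)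
Lemma average_le_maximal_far f x y (s t : R) : 0 < s -> s <= t -> locint f ->
  `|x - y| < t ->
  ((s ^- n * absint f y (4 * s))%:E <= (30 ^+ n * (t / s) ^+ n)%:E * M f x)%E.
Proof.
move=> s0 st lf xy.
have t0 : 0 < t by exact: lt_le_trans st.
have t5 : `|x - x| < 5 * t by rewrite subrr normr0 mulr_gt0.
apply: (@le_trans _ _ (s ^- n * absint f x (5 * t))%:E).
  rewrite lee_fin; apply: ler_wpM2l; first by rewrite invr_ge0 exprn_ge0// ltW.
  apply: absint_le => //; apply: ball_in_ball.
  by move: st xy; lra.
rewrite EFinM; apply: (@le_trans _ _ ((s ^- n)%:E * (((6 * (5 * t)) ^+ n)%:E * M f x))%E).
  apply: lee_wpmul2l; last exact: absint_le_maximal.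
  by rewrite lee_fin invr_ge0 exprn_ge0// ltW.
rewrite muleA -EFinM [X in (X%:E * _ <= _)%E](_ : _ = 30 ^+ n * (t / s) ^+ n)//.
by rewrite -exprVn -!exprMn; congr (_ ^+ _); field; rewrite gt_eqF.
Qed.

End mollifier.

(** * Convergence of mollifiers in L^2 *)

Section square_integral.
Context {R : realType} {n : nat}.
Local Notation mu := (@lebesgue_rV R n).
Implicit Types (f g u v : 'rV[R]_n -> R) (x y z : 'rV[R]_n).

Definition normsq f : \bar R := (\int[mu]_x (f x ^+ 2)%:E)%E.

Lemma normsq_ge0 f : (0 <= normsq f)%E.
Proof. by apply: integral_ge0 => x _; rewrite lee_fin sqr_ge0. Qed.

Lemma measurable_sqr f : measurable_fun setT f ->
  measurable_fun setT (fun x => (f x ^+ 2)%:E).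
Proof. by move=> mf; apply/measurable_EFinP; exact: measurable_funX. Qed.

Lemma normsq_le f g : measurable_fun setT f -> measurable_fun setT g ->
  (forall x, `|f x| <= `|g x|) -> (normsq f <= normsq g)%E.
Proof.
move=> mf mg fg; apply: ge0_le_integral => //; try exact: measurable_sqr.
  by move=> x _; rewrite lee_fin sqr_ge0.
move=> x _; rewrite lee_fin -(real_normK (num_real (f x))).
by rewrite -(real_normK (num_real (g x))) lerXn2r ?nnegrE.
Qed.

Lemma sqintP f : sqint f <-> measurable_fun setT f /\ (normsq f < +oo)%E.
Proof.
have E : (\int[mu]_x `|(EFin \o (fun x => f x ^+ 2)%R) x| = normsq f)%E.
  by apply: eq_integral => x _; rewrite /= ger0_norm ?sqr_ge0.
split=> [[mf /integrableP[_]]|[mf fy]]; first by rewrite E.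
split => //; apply/integrableP; split; first exact: measurable_sqr.
by rewrite E.
Qed.

Lemma normsqD f g : measurable_fun setT f -> measurable_fun setT g ->
  (normsq (fun x => f x + g x)%R <= 2%:E * normsq f + 2%:E * normsq g)%E.
Proof.
move=> mf mg; have m2 (u : 'rV[R]_n -> R) : measurable_fun setT u ->
    measurable_fun setT (fun x => (2 * u x ^+ 2)%:E).
  by move=> mu'; apply/measurable_EFinP; apply: measurable_funM => //; exact: measurable_funX.
rewrite /normsq -!ge0_integralZl//; try exact: measurable_sqr; last 2 first.
- by move=> x _; rewrite lee_fin sqr_ge0.
- by move=> x _; rewrite lee_fin sqr_ge0.
rewrite -ge0_integralD//; first last.
- exact: m2.
- by move=> x _; rewrite -EFinM lee_fin mulr_ge0// sqr_ge0.
- exact: m2.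
- by move=> x _; rewrite -EFinM lee_fin mulr_ge0// sqr_ge0.
apply: ge0_le_integral => //.
- by move=> x _; rewrite lee_fin sqr_ge0.
- by apply: measurable_sqr; exact: measurable_funD.
- by apply: emeasurable_funD; exact: m2.
move=> x _; rewrite -!EFinM -EFinD lee_fin.
by have := sqr_ge0 (f x - g x); rewrite sqrrB sqrrD; lra.
Qed.

Lemma normsqZ c f : measurable_fun setT f ->
  (normsq (fun x => c * f x)%R = (c ^+ 2)%:E * normsq f)%E.
Proof.
move=> mf; rewrite /normsq -ge0_integralZl//; last 3 first.
- exact: measurable_sqr.
- by move=> x _; rewrite lee_fin sqr_ge0.
- by rewrite lee_fin sqr_ge0.
by apply: eq_integral => x _; rewrite exprMn.
Qed.

Lemma sqintD f g : sqint f -> sqint g -> sqint (fun x => f x + g x).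
Proof.
move=> /sqintP[mf fy] /sqintP[mg gy]; apply/sqintP; split.
  exact: measurable_funD.
by apply: (le_lt_trans (normsqD mf mg)); rewrite lte_add_pinfty// lte_mul_pinfty.
Qed.

Lemma sqintZ c f : sqint f -> sqint (fun x => c * f x).
Proof.
move=> /sqintP[mf fy]; apply/sqintP; split; first exact: measurable_funM.
by rewrite normsqZ// lte_mul_pinfty// lee_fin sqr_ge0.
Qed.

Lemma sqint_le f g : measurable_fun setT f -> sqint g ->
  (forall x, `|f x| <= `|g x|) -> sqint f.
Proof.
move=> mf /sqintP[mg gy] fg; apply/sqintP; split => //.
exact: le_lt_trans (normsq_le mf mg fg) gy.
Qed.

Lemma sqint_indic_ball (A : set 'rV[R]_n) x (r : R) : measurable A ->
  A `<=` ball x r -> sqint (\1_A).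
Proof.
move=> mA AB; apply/sqintP; split; first exact: measurable_indic.
rewrite /normsq (_ : (fun x => _) = (fun x => (\1_A x)%:E)); last first.
  by apply/funext => z; rewrite indicE; case: (z \in A); rewrite ?expr1n ?expr0n.
rewrite integral_indic// setIT.
have [r0|r0] := ltP 0 r; last first.
  suff -> : A = set0 by rewrite measure0.
  by apply/seteqP; split => // z /AB [/lt_le_trans/(_ r0)]; rewrite ltxx.
apply: (@le_lt_trans _ _ (((r *+ 2) ^+ n)%:E)); last exact: ltry.
rewrite -(lebesgue_rV_ball x r0).
by apply: le_measure; rewrite ?inE//; exact: measurable_rV_ball.
Qed.

End square_integral.

Section null_boundary.
Context {R : realType}.

Lemma measurable_boundary (A : set R) : open A -> measurable (closure A `\` A).
Proof.
move=> oA; apply: measurableD; last exact: open_measurable.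
by apply: closed_measurable; exact: closed_closure.
Qed.

(** For open [A] the set [closure A] minus [A] is the topological boundary. Off it the indicator of
    [A] is locally constant, which is what mollification needs. *)
Definition null_boundary (A : set R) :=
  open A /\ lebesgue_measure (closure A `\` A) = 0%E.

Lemma null_boundaryI (A B : set R) :
  null_boundary A -> null_boundary B -> null_boundary (A `&` B).
Proof.
move=> [oA A0] [oB B0]; split; first exact: openI.
have m1 := measurable_boundary oA; have m2 := measurable_boundary oB.
apply/eqP; rewrite -measure_le0.
apply: (@le_trans _ _ (lebesgue_measure ((closure A `\` A) `|` (closure B `\` B)))).
  apply: le_measure; rewrite ?inE.
  - by apply: measurable_boundary; exact: openI.
  - exact: measurableU.
  move=> x [cx nx]; have cA : closure A x by apply: closure_subset cx; exact: subIsetl.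
  have cB : closure B x by apply: closure_subset cx; exact: subIsetr.
  have [Ax|] := pselect (A x); last by left.
  by right; split => // Bx; apply: nx.
apply: (@le_trans _ _ (lebesgue_measure (closure A `\` A) +
  lebesgue_measure (closure B `\` B))%E); first exact: measureU2.
by rewrite [X in (X + _ <= _)%E]A0 [X in (_ + X <= _)%E]B0 adde0.
Qed.

Lemma null_boundaryT : null_boundary setT.
Proof. by split; [exact: openT|rewrite setDT measure0]. Qed.

Lemma null_boundary_ray (c : R) : null_boundary `]c, +oo[%classic.
Proof.
split; first exact: interval_open.
apply: (@subset_measure0 _ _ _ lebesgue_measure _ [set c]) => //.
- by apply: measurable_boundary; exact: interval_open.
- move=> x []; rewrite (_ : `]c, +oo[%classic = [set x | c < x]); last first.
    by apply/seteqP; split => y /=; rewrite in_itv/= andbT.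
  move=> cx /= /negP; rewrite -leNgt le_eqVlt => /predU1P[->//|xc].
  have /cx[y [/= cy /= yx]] : nbhs x [set y | y < c] by exact: lt_nbhsl.
  by move: (lt_trans cy yx); rewrite ltxx.
- exact: lebesgue_measure_set1.
Qed.

Lemma null_boundary_ray' (c : R) : null_boundary `]-oo, c[%classic.
Proof.
split; first exact: interval_open.
apply: (@subset_measure0 _ _ _ lebesgue_measure _ [set c]) => //.
- by apply: measurable_boundary; exact: interval_open.
- move=> x []; rewrite (_ : `]-oo, c[%classic = [set x | x < c]); last first.
    by apply/seteqP; split => y /=; rewrite in_itv.
  move=> cx /= /negP; rewrite -leNgt le_eqVlt => /predU1P[->//|xc].
  have /cx[y [/= cy /= yx]] : nbhs x [set y | c < y] by exact: lt_nbhsr.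
  by move: (lt_trans cy yx); rewrite ltxx.
- exact: lebesgue_measure_set1.
Qed.

End null_boundary.

Import HBNNSimple.

Section mollifier_convergence.
Context {R : realType} {n : nat}.
Local Notation mu := (@lebesgue_rV R n).
Context (h : 'rV[R]_n -> R) (K : R) (s : nat -> R) (S : R).
Context (hh : hardy_kernel h) (Ch : C1c h 1 K K).
Context (s_gt0 : forall k, 0 < s k) (s_le : forall k, s k <= S).
Context (s_cvg : s k @[k --> \oo] --> 0).
Implicit Types (f g u v : 'rV[R]_n -> R) (x y z : 'rV[R]_n).
Local Notation M f := (maximal (fun x => `|f x|%:E)).

Let K_ge0 : 0 <= K.
Proof. by have [_ _ _ _ [hK _]] := Ch; exact: le_trans (hK 0). Qed.

Let dilate_cst_ge0 (a : R) : 0 < a -> 0 <= a ^- n * (a^-1 * K).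
Proof. by move=> a0; rewrite !mulr_ge0// invr_ge0 ?exprn_ge0// ltW. Qed.

Lemma mollify_continuous f (a : R) : 0 < a -> locint f ->
  continuous (convolution (dilate h a) f).
Proof.
move=> a0 lf.
exact: (convolution_continuous (dilate_cst_ge0 a0) (C1c_dilate Ch a0) lf).
Qed.

Lemma measurable_mollify f (a : R) : 0 < a -> locint f ->
  measurable_fun setT (convolution (dilate h a) f).
Proof.
by move=> a0 lf; apply: continuous_measurable_rV; exact: mollify_continuous.
Qed.

Definition mollify_cst : R := (K * 24 ^+ n) ^+ 2 * @maximal_cst R n 2.

Lemma mollify_cst_ge0 : 0 <= mollify_cst.
Proof. by rewrite mulr_ge0 ?sqr_ge0// maximal_cst_ge0// ltr1n. Qed.

Lemma poweR2 (x : \bar R) : (0 <= x -> x `^ 2 = x * x)%E.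
Proof.
case: x => [x||//]; last by move=> _; rewrite poweRyr ?mulyy.
by rewrite lee_fin => x0; rewrite poweR_EFin -EFinM -[2]/(2%:R) powR_mulrn.
Qed.

(** At every point the mollification is at most [K * 24 ^+ n] times the maximal function of [f], and
    the maximal theorem with exponent 2 applies. Uniformity in [a] lets convergence pass to [L^2]
    limits. *)
Lemma normsq_mollify f (a : R) : 0 < a -> sqint f ->
  (normsq (convolution (dilate h a) f) <= mollify_cst%:E * normsq f)%E.
Proof.
move=> a0 sf; have lf := sqint_locint sf; have [mf _] := sf.
have mF : measurable_fun setT (fun x => `|f x|%:E).
  by apply/measurable_EFinP; exact: measurableT_comp.
have mM : measurable_fun setT (fun x => M f x `^ 2)%E.
  by apply: (measurableT_comp (measurable_poweR _)); exact: measurable_maximal.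
apply: (@le_trans _ _ (\int[mu]_x (((K * 24 ^+ n) ^+ 2)%:E * M f x `^ 2))%E).
  apply: ge0_le_integral => //.
  - by move=> x _; rewrite lee_fin sqr_ge0.
  - by apply: measurable_sqr; exact: measurable_mollify.
  - exact: measurable_funeM.
  move=> y _.
  have M0 : (0 <= M f y)%E by apply: maximal_ge0 => x; rewrite lee_fin.
  have H : (`|convolution (dilate h a) f y|%:E <= (K * 24 ^+ n)%:E * M f y)%E.
    have b : `|y - y| + 2 * a <= 4 * a by rewrite subrr normr0; lra.
    apply: (@le_trans _ _ (K%:E * (a ^- n * absint f y (4 * a))%:E)%E).
      by rewrite -EFinM lee_fin mulrCA mulrA; exact: mollify_le.
    rewrite [X in (_ <= X * _)%E]EFinM -muleA; apply: lee_wpmul2l => //.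
    exact: average_le_maximal.
  rewrite -(real_normK (num_real (convolution _ _ _))) expr2 EFinM poweR2//.
  rewrite expr2 EFinM muleACA; apply: lee_pmul => //.
rewrite ge0_integralZl//; last 2 first.
- by move=> x _; exact: poweR_ge0.
- by rewrite lee_fin sqr_ge0.
rewrite /mollify_cst [X in (_ <= X * _)%E]EFinM -[X in (_ <= X)%E]muleA; apply: lee_wpmul2l.
  by rewrite lee_fin sqr_ge0.
apply: le_trans (maximal_strong mF _ _) _ => //; first by rewrite ltr1n.
rewrite le_eqVlt; apply/orP; left; apply/eqP; congr (_ * _)%E.
apply: eq_integral => x _; rewrite poweR2// -EFinM -expr2 real_normK//.
exact: num_real.
Qed.

Lemma convolutionD u f g y : mu.-integrable setT (EFin \o (fun z => u (y - z) * f z)) ->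
  mu.-integrable setT (EFin \o (fun z => u (y - z) * g z)) ->
  convolution u (fun z => f z + g z) y = convolution u f y + convolution u g y.
Proof.
move=> iF iG; rewrite /convolution -RintegralD//.
by apply: eq_Rintegral => z _; rewrite mulrDr.
Qed.

Lemma integrable_mollify f y (a : R) : 0 < a -> locint f ->
  mu.-integrable setT (EFin \o (fun z => dilate h a (y - z) * f z)).
Proof.
move=> a0 lf; have [cd _ _ ds [dK _]] := C1c_dilate Ch a0.
have a1 : a < a + 1 by rewrite ltrDl.
by have [] := convolution_bound y cd dK ds lf a1.
Qed.

(** Convergence in [L^2] along the scales [s k], phrased with the squared norm, for which [normsqD]
    plays the part of the triangle inequality with a loss of 2. *)
Definition approximable f := sqint f /\ forall e : R, 0 < e -> exists k0, forall k,
  (k0 <= k)%N -> (normsq (fun x => convolution (dilate h (s k)) f x - f x)%R <= e%:E)%E.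

Lemma approximableD f g : approximable f -> approximable g -> approximable (fun x => f x + g x).
Proof.
move=> [sf Hf] [sg Hg]; split; first exact: sqintD.
move=> e e0; have e4 : 0 < e / 4 by rewrite divr_gt0.
have [k1 H1] := Hf _ e4; have [k2 H2] := Hg _ e4.
exists (maxn k1 k2) => k; rewrite geq_max => /andP[/H1 h1 /H2 h2].
have lf := sqint_locint sf; have lg := sqint_locint sg.
rewrite (_ : (fun x => _) = (fun x => (convolution (dilate h (s k)) f x - f x) +
    (convolution (dilate h (s k)) g x - g x))); last first.
  apply/funext => x; rewrite convolutionD; [|exact: integrable_mollify..].
  by rewrite opprD addrACA.
apply: le_trans (normsqD _ _) _.
- by apply: measurable_funB; [exact: measurable_mollify|case: sf].
- by apply: measurable_funB; [exact: measurable_mollify|case: sg].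
rewrite [X in (_ <= X)%E](_ : _ = 2%:E * (e / 4)%:E + 2%:E * (e / 4)%:E)%E.
  by apply: leeD; apply: lee_wpmul2l.
by rewrite -!EFinM -EFinD; congr (_%:E); field.
Qed.

Lemma approximableZ c f : approximable f -> approximable (fun x => c * f x).
Proof.
move=> [sf Hf]; split; first exact: sqintZ.
move=> e e0; have c1 : 0 < c ^+ 2 + 1 by rewrite ltr_wpDl ?sqr_ge0.
have [k0 Hk] := Hf _ (divr_gt0 e0 c1).
exists k0 => k /Hk hk; have lf := sqint_locint sf.
rewrite (_ : (fun x => _) = (fun x => c * (convolution (dilate h (s k)) f x - f x))); last first.
  apply/funext => x; rewrite mulrBr -RintegralZl//; last exact: integrable_mollify.
  by congr (_ - _); apply: eq_Rintegral => z _; rewrite mulrCA.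
rewrite normsqZ; last by apply: measurable_funB; [exact: measurable_mollify|case: sf].
apply: (@le_trans _ _ ((c ^+ 2)%:E * (e / (c ^+ 2 + 1))%:E)%E).
  by apply: lee_wpmul2l; rewrite ?lee_fin ?sqr_ge0.
rewrite -EFinM lee_fin mulrCA ler_piMr ?(ltW e0)// ler_pdivrMr// mul1r.
by rewrite lerDl.
Qed.

Lemma approximable_closure f : sqint f ->
  (forall e : R, 0 < e -> exists2 g, approximable g & (normsq (fun x => f x - g x)%R <= e%:E)%E) ->
  approximable f.
Proof.
move=> sf H; split => // e e0.
(* With all errors at most [e / C], splitting by [normsqD] gives [2 * mollify_cst] for the
   mollification of [f - g], and [2 * (2 + 2)] for the mollification error of [g] together with
   [g - f]. *)
pose C := 2 * mollify_cst + 8.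
have C0 : 0 < C by rewrite /C; have := mollify_cst_ge0; lra.
have eC0 : 0 < e / C by rewrite divr_gt0.
have [g [sg Hg] fg] := H _ eC0.
have [k0 Hk] := Hg _ eC0; exists k0 => k /Hk {}Hk.
have sfg : sqint (fun x => f x - g x).
  rewrite (_ : (fun x => _) = (fun x => f x + (-1) * g x)).
    by apply: sqintD => //; exact: sqintZ.
  by apply/funext => x; rewrite mulN1r.
have lg := sqint_locint sg; have lfg := sqint_locint sfg.
have [mf _] := sf; have [mg _] := sg; have [mfg _] := sfg.
have mgf : measurable_fun setT (fun x => g x - f x) by exact: measurable_funB.
have mc := measurable_mollify (s_gt0 k).
have E : (fun x => convolution (dilate h (s k)) f x - f x) =
  (fun x => convolution (dilate h (s k)) (fun x => f x - g x) x +
    ((convolution (dilate h (s k)) g x - g x) + (g x - f x))).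
  apply/funext => x; rewrite {1}(_ : f = (fun x => (f x - g x) + g x)).
    rewrite convolutionD; [|exact: integrable_mollify..].
    by rewrite subrKA -addrA.
  by apply/funext => z; rewrite subrK.
rewrite E.
apply: le_trans (normsqD _ _) _.
- exact: mc.
- by apply: measurable_funD => //; apply: measurable_funB => //; exact: mc.
have gf : normsq (fun x => g x - f x) = normsq (fun x => f x - g x).
  by apply: eq_integral => x _; rewrite -sqrrN opprB.
have hk2 : (normsq (fun x => convolution (dilate h (s k)) g x - g x + (g x - f x))%R <=
    (4 * (e / C))%:E)%E.
  apply: le_trans (normsqD _ _) _ => //; first by apply: measurable_funB => //; exact: mc.
  rewrite gf [X in (_ <= X)%E](_ : _ = 2%:E * (e / C)%:E + 2%:E * (e / C)%:E)%E.
    by apply: leeD; apply: lee_wpmul2l.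
  by rewrite -!EFinM -EFinD; congr (_%:E); ring.
apply: (@le_trans _ _ (2%:E * (mollify_cst%:E * (e / C)%:E) + 2%:E * (4 * (e / C))%:E)%E).
  apply: leeD; apply: lee_wpmul2l => //.
  apply: le_trans (normsq_mollify (s_gt0 k) sfg) _.
  by apply: lee_wpmul2l => //; rewrite lee_fin mollify_cst_ge0.
rewrite -!EFinM -EFinD lee_fin.
rewrite (_ : 2 * (mollify_cst * (e / C)) + 2 * (4 * (e / C)) = e / C * (2 * mollify_cst + 8)); last by ring.
rewrite -[leRHS](divfK (lt0r_neq0 C0)) ler_wpM2l ?(ltW eC0)//.
Qed.

Lemma cvge0_le (u : (\bar R)^nat) (e : R) : (u @ \oo --> 0)%E -> 0 < e ->
  exists k0, forall k, (k0 <= k)%N -> (u k <= e%:E)%E.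
Proof.
move=> /fine_cvgP[uf /cvgrPdist_le u0] e0.
have [k1 _ H1] := uf; have [k2 _ H2] := u0 _ e0.
exists (maxn k1 k2) => k; rewrite geq_max => /andP[/H1 h1 /H2 /= h2].
rewrite -(fineK h1) lee_fin (le_trans (ler_norm _))//.
by move: h2; rewrite sub0r normrN.
Qed.

Lemma approximable_lim f (g : nat -> 'rV[R]_n -> R) (D : 'rV[R]_n -> R) : sqint f ->
  (forall m, approximable (g m)) -> mu.-integrable setT (EFin \o D) ->
  (forall x, g m x @[m --> \oo] --> f x) ->
  (forall m x, (f x - g m x) ^+ 2 <= D x) -> approximable f.
Proof.
move=> sf Hg iD gf gD; apply: approximable_closure => // e e0.
have [mf _] := sf.
have mg m : measurable_fun setT (g m) by have [[]] := Hg m.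
have := @dominated_convergence _ _ _ mu setT measurableT
  (fun m x => ((f x - g m x) ^+ 2)%:E) (cst 0) (EFin \o D).
case => //.
- by move=> m; apply: measurable_sqr; exact: measurable_funB.
- apply: aeW => x _; apply: cvg_EFin; first exact: nearW.
  have d0 : f x - g m x @[m --> \oo] --> 0.
    by rewrite -[X in _ --> X](subrr (f x)); apply: cvgB => //; exact: cvg_cst.
  have d2 : (f x - g m x) * (f x - g m x) @[m --> \oo] --> (0 * 0 : R) by exact: cvgM.
  rewrite mulr0 in d2; apply: cvg_trans d2; apply: near_eq_cvg.
  by apply: nearW => m; rewrite /= expr2.
- by apply: aeW => x m _; rewrite /= lee_fin ger0_norm ?sqr_ge0.
move=> _ _; rewrite integral_cst// mul0e => /cvge0_le /(_ e0)[m Hm].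
by exists (g m) => //; exact: Hm.
Qed.

Lemma convolution_dilate1 y (a : R) : 0 < a ->
  \int[mu]_z (dilate h a (y - z) * 1) = 1.
Proof.
move=> a0; have [_ _ _ h1] := hh; rewrite -[RHS]h1 -(integral_dilate Ch a0).
rewrite -[RHS]mul1r; have [cd _ _ ds _] := C1c_dilate Ch a0.
have id := integrable_continuous_support (ltW a0) cd ds.
have := Rintegral_rV_affine y (_ : -1 != 0 :> R) id.
rewrite oppr_eq0 oner_eq0 normrN normr1 expr1n invr1 => /(_ isT) <-.
by apply: eq_Rintegral => z _; rewrite mulr1 scaleN1r.
Qed.

Lemma mollify_locally_cst f x (a d : R) : 0 < a -> a < d ->
  (forall z, ball x d z -> f z = f x) -> convolution (dilate h a) f x = f x.
Proof.
move=> a0 ad fx; have [_ _ _ ds _] := C1c_dilate Ch a0.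
transitivity (\int[mu]_z (dilate h a (x - z) * 1 * f x)).
  apply: eq_Rintegral => z _; rewrite mulr1.
  have [xz|xz] := ltP `|x - z| d; first by rewrite fx//; exact/ball_normP.
  by rewrite ds ?mul0r// (lt_le_trans ad).
rewrite RintegralZr//; first by rewrite convolution_dilate1// mul1r.
by apply: integrable_mollify => //; exact: locint_cst.
Qed.

Lemma mollify_indic_itv (A : set 'rV[R]_n) x (a : R) : 0 < a -> measurable A ->
  0 <= convolution (dilate h a) (\1_A) x <= 1.
Proof.
move=> a0 mA; have [_ h0 _ _] := hh.
have lA : locint (\1_A : 'rV[R]_n -> R).
  split; first exact: measurable_indic.
  move=> y r; have mb : measurable (ball y r : set 'rV[R]_n) by exact: measurable_rV_ball.
  apply: (le_integrable mb _ _ ((locint_cst 1).2 y r)).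
    by apply/measurable_EFinP; apply: measurable_funTS; exact: measurable_indic.
  move=> z _; rewrite /= lee_fin normr1 indicE.
  by case: (z \in A); rewrite ?normr1 ?normr0.
have da z : 0 <= dilate h a (x - z) by exact: dilate_ge0.
apply/andP; split.
  by apply: Rintegral_ge0 => z _; rewrite mulr_ge0.
rewrite -(convolution_dilate1 x a0); apply: le_Rintegral => //.
- exact: integrable_mollify.
- by apply: integrable_mollify => //; exact: locint_cst.
- by move=> z _; rewrite ler_wpM2l// indicE; case: (z \in A).
Qed.

Lemma open_rV_box_nbhs (A : 'I_n -> set R) x : (forall i, open (A i)) ->
  rV_box A x -> nbhs x (rV_box A).
Proof.
move=> oA Ax; exists (fun _ j => A j) => /=.
  move=> i j; rewrite (ord1 i); apply: open_nbhs_nbhs; split; [exact: oA|exact: Ax].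
by move=> y /= Hy i; exact: Hy.
Qed.

(** Outside the null set where some coordinate lies on the boundary of its side, the indicator is
    constant near the point, so the mollification equals it as soon as [s k] is small. Dominated
    convergence then applies, the mollifications taking values between 0 and 1. *)
Lemma approximable_indic_box (A : 'I_n -> set R) (N : R) : 0 < N ->
  (forall i, null_boundary (A i)) -> rV_box A `<=` ball 0 N ->
  approximable (\1_(rV_box A)).
Proof.
move=> N0 nA AN; have mA : measurable (rV_box A).
  by apply: measurable_rV_box => i; apply: open_measurable; case: (nA i).
have sA := sqint_indic_ball mA AN; split => //.
have lA := sqint_locint sA; have [mf _] := sA.
set f := \1_(rV_box A) in sA lA mf *.
have aeA : {ae mu, forall x, forall i : 'I_n, ~ (closure (A i) `\` A i) (x ord0 i)}.
  apply: filter_forall => i; have [oA A0] := nA i.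
  pose B j := if j == i then closure (A i) `\` A i else setT.
  have mB j : measurable (B j).
    by rewrite /B; case: ifP => // _; exact: measurable_boundary.
  exists (rV_box B); split; first exact: measurable_rV_box.
    rewrite [LHS](_ : _ = (\prod_(j < n) lebesgue_measure (B j))%E); last exact: lebesgue_rV_box.
    by rewrite (bigD1 i)//= {1}/B eqxx A0 mul0e.
  move=> x /= /contrapT [cx nx] j; rewrite /B.
  by have [->|] := eqVneq j i.
(* For [|x| >= N + S + 1] the ball of radius [S + 1] about [x] misses [ball 0 N]. As [s k <= S],
   both the indicator and all its mollifications vanish at [x]. *)
pose D := (\1_(ball 0 (N + S + 1)) : 'rV[R]_n -> R).
have mB : measurable (ball 0 (N + S + 1) : set 'rV[R]_n) by exact: measurable_rV_ball.
have S0 : 0 < S by exact: lt_le_trans (s_gt0 0) (s_le 0).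
have mc k := measurable_mollify (s_gt0 k) lA.
have := @dominated_convergence _ _ _ mu setT measurableT
  (fun k x => ((convolution (dilate h (s k)) f x - f x) ^+ 2)%:E) (cst 0) (EFin \o D).
case => //.
- by move=> k; apply: measurable_sqr; exact: measurable_funB.
- apply: filterS aeA => x Hx _.
  have [d d0 fd] : exists2 d, 0 < d & forall z, ball x d z -> f z = f x.
    have [Ax|nAx] := pselect (rV_box A x).
      have /nbhs_ballP[d /= d0 dA] := open_rV_box_nbhs (fun i => (nA i).1) Ax.
      exists d => // z /dA Az; rewrite /f !indicE !mem_set//.
    have [i nAi] : exists i, ~ A i (x ord0 i) by apply/existsNP.
    have nci : ~ closure (A i) (x ord0 i) by move=> ci; exact: (Hx i).
    have oC : open (~` closure (A i)) by apply: closed_openC; exact: closed_closure.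
    have /nbhs_ballP[d /= d0 dA] : nbhs (x ord0 i) (~` closure (A i)).
      by apply: open_nbhs_nbhs; split.
    exists d => // z [_ /(_ ord0 i) /dA zi].
    rewrite /f !indicE !memNset// => Az; apply: zi; apply: subset_closure.
    exact: Az.
  apply: cvg_EFin; first exact: nearW.
  rewrite /=; apply: cvg_near_cst.
  have : \forall k \near \oo, `|0 - s k| < d.
    by apply: cvgr_dist_lt.
  apply: filterS => k; rewrite sub0r normrN gtr0_norm// => sd.
  change ((convolution (dilate h (s k)) f x - f x) ^+ 2 = 0).
  by rewrite (mollify_locally_cst (s_gt0 k) sd fd) subrr expr0n.
- rewrite /D; have := (sqint_indic_ball mB (@subset_refl _ _)).2.
  congr (mu.-integrable _ _); apply/funext => x /=.
  by rewrite indicE; case: (x \in _); rewrite ?expr1n ?expr0n.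
- apply: aeW => x k _; rewrite /= lee_fin ger0_norm ?sqr_ge0//.
  have [xB|xB] := ltP `|x| (N + S + 1).
    rewrite /D indicE mem_set; last by apply/ball_normP; rewrite sub0r normrN.
    have /andP[c0 c1] := mollify_indic_itv x (s_gt0 k) mA.
    rewrite -/f in c0 c1; move: c0 c1; move: (convolution _ _ _) => c c0 c1.
    rewrite (_ : true%:R = 1)//; have : f x = 0 \/ f x = 1.
      by rewrite /f indicE; case: (x \in rV_box A); [right|left].
    case=> ->; first by rewrite subr0 exprn_ile1.
    by rewrite -sqrrN opprB exprn_ile1//; lra.
  have fx0 : f x = 0.
    rewrite /f indicE memNset// => /AN /ball_normP; rewrite sub0r normrN.
    by move: xB S0; lra.
  rewrite (@mollify_locally_cst f x (s k) (S + 1)) ?subrr ?expr0n//.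
  - by rewrite (le_lt_trans (s_le k))// ltrDl.
  - move=> z /ball_normP xz; rewrite fx0 /f indicE memNset// => /AN /ball_normP.
    rewrite sub0r normrN; have : `|x| <= `|x - z| + `|z|.
      by rewrite (le_trans _ (ler_normD _ _))// subrK.
    by move: xB xz; lra.
move=> _ _; rewrite integral_cst// mul0e => Hc e e0.
exact: (cvge0_le Hc e0).
Qed.

(* On indicators of boxes with null boundary the mollifications converge almost
   everywhere; these boxes generate the Borel sets, so a Dynkin argument
   reaches all of L^2. *)
Definition null_boundary_boxes : set (set 'rV[R]_n) :=
  [set rV_box A | A in [set A : 'I_n -> set R | forall i, null_boundary (A i)]].

(** Boxes with one side an open ray and all other coordinates free already make the coordinates
    measurable. *)
Lemma null_boundary_boxesE :
  (measurable : set (set 'rV[R]_n)) = <<s null_boundary_boxes >>.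
Proof.
apply/seteqP; split; last first.
  apply: smallest_sub; first exact: sigma_algebra_measurable.
  move=> _ [A nA <-]; apply: measurable_rV_box => i.
  by apply: open_measurable; case: (nA i).
rewrite [X in X `<=` _](_ : _ = g_sigma_preimage (@rV_coord R n))//.
apply: smallest_sub; first exact: smallest_sigma_algebra.
move=> A; rewrite -bigcup_seq => -[i _ [B mB <-]].
have mc : measurable_fun [set: g_sigma_algebraType null_boundary_boxes]
    (@rV_coord R n i : g_sigma_algebraType null_boundary_boxes -> R).
  apply: (measurability _ (RGenOInfty.measurableE R)) => //.
  move=> _ [_ [c ->] <-]; rewrite setTI; apply: sub_sigma_algebra.
  exists (fun j => if j == i then `]c, +oo[%classic else setT).
    by move=> j; case: ifP => _; [exact: null_boundary_ray|exact: null_boundaryT].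
  apply/seteqP; split => x /=.
    by move=> /(_ i); rewrite eqxx.
  by move=> Bx j; case: eqP => // ->.
exact: (mc measurableT B mB).
Qed.

(** The Dynkin induction runs inside a fixed ball: this keeps every indicator square integrable, and
    complements become differences from the indicator of that ball. *)
Lemma approximable_indic_ball (N : R) (A : set 'rV[R]_n) : 0 < N -> measurable A ->
  approximable (\1_(A `&` ball 0 N)).
Proof.
move=> N0 mA.
have mB : measurable (ball 0 N : set 'rV[R]_n) by exact: measurable_rV_ball.
have ballE : (ball 0 N : set 'rV[R]_n) = rV_box (fun=> `]-oo, N[%classic `&` `](- N)%R, +oo[%classic).
  rewrite rV_ballE//; apply/seteqP; split => x Hx i; have := Hx i;
    rewrite /ball/= !in_itv/= mxE sub0r normrN ltr_norml ?andbT.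
    by move=> /andP[-> ->].
  by move=> [-> ->].
have approximable_box A' : null_boundary_boxes A' -> approximable (\1_(A' `&` ball 0 N)).
  move=> [a na <-]; rewrite ballE.
  rewrite (_ : _ `&` _ = rV_box (fun i => a i `&` (`]-oo, N[%classic `&` `](- N)%R, +oo[%classic))).
    apply: (approximable_indic_box N0) => [i|].
      apply: null_boundaryI => //; apply: null_boundaryI.
        exact: null_boundary_ray'.
      exact: null_boundary_ray.
    by rewrite ballE => x Hx i; have [] := Hx i.
  apply/seteqP; split => x /=; first by move=> [H1 H2] i; split; [exact: H1|exact: H2].
  by move=> H; split => i; have [] := H i.
have approximableT : approximable (\1_([set: 'rV[R]_n] `&` ball 0 N)).
  apply: approximable_box; exists (fun=> setT).
    by move=> i; exact: null_boundaryT.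
  by apply/seteqP; split.
have sAN (A' : set 'rV[R]_n) : measurable A' -> sqint (\1_(A' `&` ball 0 N) : 'rV[R]_n -> R).
  move=> mA'; apply: (sqint_indic_ball _ (@subIsetr _ _ _)).
  exact: measurableI.
move: (mA); rewrite null_boundary_boxesE.
apply: (@dynkin_induction _ _ null_boundary_boxes
  (fun U => approximable (\1_(U `&` ball 0 N))) null_boundary_boxesE) => //.
- move=> _ _ [a na <-] [b nb <-]; exists (fun i => a i `&` b i).
    by move=> i; exact: null_boundaryI.
  apply/seteqP; split => x /=; first by move=> H; split => i; have [] := H i.
  by move=> [H1 H2] i; split; [exact: H1|exact: H2].
- move=> U mU gU.
  rewrite (_ : \1_(_) = (fun x => \1_([set: 'rV[R]_n] `&` ball 0 N) x +
     (-1) * \1_(U `&` ball 0 N) x)); first by apply: approximableD => //; exact: approximableZ.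
  apply/funext => x; generalize (ball 0 N : set 'rV[R]_n) => B.
  rewrite !indicE !in_setI in_setC in_setT/=.
  by case: (x \in U); case: (x \in _) => /=; rewrite ?mulr1 ?mulr0 ?subrr ?addr0.
move=> F mF tF gF.
pose g m := \1_((\bigcup_(k < m) F k) `&` ball 0 N) : 'rV[R]_n -> R.
have mbF : measurable (\bigcup_k F k) by exact: bigcup_measurable.
apply: (@approximable_lim _ g (\1_(ball 0 N))).
- exact: sAN.
- elim=> [|m IH].
    rewrite /g bigcup_mkord big_ord0 set0I (_ : \1_set0 = (fun x => 0 * \1_([set: 'rV[R]_n] `&` ball 0 N) x)).
      exact: approximableZ.
    by apply/funext => x; rewrite indic0 mul0r.
  rewrite (_ : g m.+1 = (fun x => g m x + \1_(F m `&` ball 0 N) x)); first exact: approximableD.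
  apply/funext => x; rewrite /g !bigcup_mkord big_ord_recr/= setIUl.
  rewrite indicE in_setU !indicE.
  case: (boolP (x \in F m `&` ball 0 N)) => [|_]; last by rewrite orbF addr0.
  rewrite inE => -[Fx Bx]; rewrite memNset ?add0r// => -[+ _].
  rewrite -bigcup_mkord => -[k /= km Fkx].
  have km' : k = m by apply: tF => //; exists x.
  by rewrite km' ltnn in km.
- have := (sqint_indic_ball mB (@subset_refl _ _)).2.
  congr (mu.-integrable _ _); apply/funext => x /=.
  by rewrite indicE; case: (x \in _); rewrite ?expr1n ?expr0n.
- move=> x; rewrite /g; generalize (ball 0 N : set 'rV[R]_n) => B.
  have [[k _ Fkx]|nF] := pselect ((\bigcup_k F k) x).
    apply: cvg_near_cst; exists k.+1 => // m /= km.
    rewrite !indicE !in_setI !(@mem_set _ (\bigcup_(_ in _) _) x)//; by exists k.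
  rewrite [X in X @ _](_ : _ = (fun=> \1_(\bigcup_k F k `&` B) x)); first exact: cvg_cst.
  apply/funext => m; rewrite !indicE !in_setI !(@memNset _ (\bigcup_(_ in _) _) x)//.
  by move=> [k _ Fkx]; apply: nF; exists k.
move=> m x; rewrite /g; generalize (ball 0 N : set 'rV[R]_n) => B.
rewrite !indicE !in_setI; case: (x \in B); rewrite ?andbF/= ?subrr ?expr0n// !andbT.
by case: (_ \in _); case: (_ \in _); rewrite ?subrr ?subr0 ?sub0r ?sqrrN ?expr1n ?expr0n.
Qed.

Lemma approximable_sum (I : Type) (r : seq I) (F : I -> 'rV[R]_n -> R) :
  (forall i, approximable (F i)) -> approximable (fun x => \sum_(i <- r) F i x).
Proof.
move=> gF; elim: r => [|i r IH].
  rewrite (_ : (fun x => _) = (fun x => 0 * \1_(setT `&` ball 0 1) x)).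
    by apply: approximableZ; exact: approximable_indic_ball.
  by apply/funext => x; rewrite big_nil mul0r.
rewrite (_ : (fun x => _) = (fun x => F i x + \sum_(i <- r) F i x)); first exact: approximableD.
by apply/funext => x; rewrite big_cons.
Qed.

Lemma approximable_ge0 f : sqint f -> (forall x, 0 <= f x) -> approximable f.
Proof.
move=> sf f0; have [mf i2] := sf.
have mEf : measurable_fun setT (EFin \o f) by exact/measurable_EFinP.
pose a m : {nnsfun 'rV[R]_n >-> R} := nnsfun_approx measurableT mEf m.
have ea x : EFin \o (fun m => a m x) @ \oo --> (f x)%:E.
  by apply: (cvg_nnsfun_approx measurableT mEf) => // z _; rewrite lee_fin.
have ca x : a m x @[m --> \oo] --> f x.
  by have /fine_cvgP[_] := ea x.
have le_a m x : a m x <= f x.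
  rewrite -(cvg_lim _ (ca x))//; apply: limr_ge => //.
    by apply/cvg_ex; exists (f x).
  exists m => // k /= mk; have := nd_nnsfun_approx measurableT mEf mk.
  by move/lefP; apply.
(* The cut-off to a growing ball turns each simple function into a finite combination of indicators
   of bounded sets, while keeping [0 <= g m x <= f x], so that [f ^ 2] dominates the squared
   errors. *)
pose g m (x : 'rV[R]_n) := a m x * \1_(ball 0 m.+1%:R) x.
apply: (@approximable_lim _ g (fun x => f x ^+ 2)) => //.
- move=> m; rewrite (_ : g m = (fun x => \sum_(y <- finmap.enum_fset (fset_set (range (a m))))
     (y * \1_((a m @^-1` [set y]) `&` ball 0 m.+1%:R) x))).
    by apply: approximable_sum => y; apply: approximableZ; exact: approximable_indic_ball.
  apply/funext => x; rewrite /g fimfunE fsbig_finite//= mulr_suml.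
  by apply: eq_bigr => y _; rewrite -mulrA indicI.
- move=> x; apply: cvg_trans (ca x); apply: near_eq_cvg.
  exists (Num.trunc `|x|).+1 => // m /= xm; rewrite /g indicE mem_set ?mulr1//.
  apply/ball_normP; rewrite sub0r normrN (lt_le_trans (truncnS_gt _))//.
  by rewrite ler_nat ltnW.
move=> m x; have g0 : 0 <= g m x by rewrite mulr_ge0.
have gf : g m x <= f x.
  by rewrite (le_trans _ (le_a m x))// ler_piMr// indicE.
by rewrite lerXn2r ?nnegrE// ?subr_ge0// gerBl.
Qed.

Lemma mollify_cvg f : sqint f -> approximable f.
Proof.
move=> sf; have [mf _] := sf.
have E : f = (fun x => Num.max (f x) 0 + (-1) * Num.max (- f x) 0).
  apply/funext => x; rewrite mulN1r.
  by case: (leP (f x) 0); case: (leP (- f x) 0); lra.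
rewrite E; apply: approximableD; last apply: approximableZ.
  apply: approximable_ge0 => [|x]; last by rewrite le_max lexx orbT.
  apply: (sqint_le _ sf) => [|x]; first exact: measurable_maxr.
  by rewrite /Num.max; case: ifP; rewrite ?normr0.
apply: approximable_ge0 => [|x]; last by rewrite le_max lexx orbT.
apply: (sqint_le _ sf) => [|x].
  by apply: measurable_maxr => //; exact: measurableT_comp.
by rewrite /Num.max; case: ifP; rewrite ?normr0 ?normrN.
Qed.

End mollifier_convergence.

(** * The bilinear estimate *)

Section by_parts.
Context {R : realType} {n : nat}.
Local Notation mu := (@lebesgue_rV R n).
Implicit Types (F u v : 'rV[R]_n -> R) (x y z : 'rV[R]_n).
Local Notation e_ i := (delta_mx ord0 i : 'rV[R]_n).

(** The function [F ^ 2 * u] is [C^1] with compact support, so the integral of its [i]-th derivative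
    vanishes. This is the cancellation in the product of [F] and its derivative. *)
Lemma integral_sqr_by_parts F u (s : R) (i : 'I_n) : 0 <= s ->
  Ck 1 F -> Ck 1 u -> (forall x, s < `|x| -> u x = 0) ->
  \int[mu]_x (F x * partial i F x * u x) =
  - (\int[mu]_x (F x ^+ 2 * partial i u x) / 2).
Proof.
move=> s0 [cF HF] [cu Hu] us.
pose w := ((F : 'rV[R]_n -> R^o) * F) * u.
have dw j x : is_derive x (e_ j) w
    (2 * (F x * partial j F x * u x) + F x ^+ 2 * partial j u x).
  have dF : is_derive x (e_ j) (F : 'rV[R]_n -> R^o) (partial j F x).
    by apply: DeriveDef => //; exact: (HF j).1.
  have du : is_derive x (e_ j) (u : 'rV[R]_n -> R^o) (partial j u x).
    by apply: DeriveDef => //; exact: (Hu j).1.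
  apply: is_derive_eq.
  change (F x * F x * partial j u x + u x * (F x * partial j F x + F x * partial j F x) =
    2 * (F x * partial j F x * u x) + F x ^+ 2 * partial j u x).
  by ring.
have pw j : partial j w = fun x =>
    2 * (F x * partial j F x * u x) + F x ^+ 2 * partial j u x.
  by apply/funext => x; rewrite /partial; have [_ ->] := dw j x.
have cM (a b : 'rV[R]_n -> R) : continuous a -> continuous b ->
    continuous (fun x => a x * b x).
  by move=> ca cb x; apply: (@continuousM R _ a b x); [exact: ca|exact: cb].
have c1 j : continuous (fun x => F x * partial j F x * u x).
  by apply: (cM (fun x => F x * partial j F x) u) => //; apply: cM => //; exact: (HF j).2.1.
have c2 j : continuous (fun x => F x ^+ 2 * partial j u x).
  by apply: (cM (fun x => F x ^+ 2)); [exact: (cM F F)|exact: (Hu j).2.1].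
have cw : Ck 1 w.
  split; first by apply: (cM (fun x => F x * F x) u) => //; exact: cM.
  move=> j; split; first by move=> x; have [] := dw j x.
  split => //; rewrite pw => x.
  apply: (@continuousD R R^o _ (fun x => 2 * (F x * partial j F x * u x))
    (fun x => F x ^+ 2 * partial j u x)); last exact: c2.
  by apply: (cM (fun=> 2)) => //; exact: cst_continuous.
have ws x : s < `|x| -> w x = 0 by move=> /us ux; rewrite /w/= /GRing.mul/= ux mulr0.
have [K K0 Cw] := Ck1_C1c s0 cw ws.
have := integral_partial_eq0 i s0 K0 Cw; rewrite pw.
have i1 := integrable_continuous_support s0 (c1 i).
have i2 := integrable_continuous_support s0 (c2 i).
have {}i1 := i1 (fun x sx => etrans (congr1 _ (us x sx)) (mulr0 _)).
have {}i2 := i2 (fun x sx => etrans (congr1 _ (partial_support us i sx)) (mulr0 _)).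
rewrite RintegralD// ?RintegralZl//; last first.
  by have := integrableZl measurableT 2 i1.
lra.
Qed.

End by_parts.

Section product_limit.
Context {R : realType} {n : nat}.
Local Notation mu := (@lebesgue_rV R n).
Implicit Types (u v w : 'rV[R]_n -> R) (x y z : 'rV[R]_n).

(** Rests on [2 |u v| <= u ^ 2 + v ^ 2]. The sum of squares in the bound is made effective later by
    scaling [u] and [v] by reciprocal factors. *)
Lemma sqint_mul_integrable u v w (c : R) : sqint u -> sqint v ->
  measurable_fun setT w -> (forall x, `|w x| <= c) ->
  mu.-integrable setT (EFin \o (fun x => u x * v x * w x)) /\
  (`|\int[mu]_x (u x * v x * w x)|%:E <= c%:E * (normsq u + normsq v))%E.
Proof.
move=> [mu_ iu] [mv iv] mw wc.
have c0 : 0 <= c by exact: le_trans (wc 0).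
have mf : measurable_fun setT (fun x => (u x * v x * w x)%:E).
  by apply/measurable_EFinP; do !apply: measurable_funM.
have le1 x : (`|(u x * v x * w x)%:E| <= c%:E * ((u x ^+ 2)%:E + (v x ^+ 2)%:E))%E.
  rewrite -EFinD -EFinM lee_fin normrM mulrC.
  apply: ler_pM => //; rewrite normrM -[u x ^+ 2]real_normK ?num_real//.
  rewrite -[v x ^+ 2]real_normK ?num_real//.
  have := sqr_ge0 (`|u x| - `|v x|); have := sqr_ge0 (`|u x| + `|v x|).
  by rewrite sqrrB sqrrD; lra.
have i12 := integrableZl measurableT c (integrableD measurableT iu iv).
have iw : mu.-integrable setT (EFin \o (fun x => u x * v x * w x)).
  apply: (le_integrable measurableT _ _ i12) => // x _.
  by apply: (le_trans (le1 x)); exact: lee_abs.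
split => //; rewrite EFin_normr_Rintegral//.
apply: (le_trans (le_abse_integral _ measurableT mf)).
have m2 (f : 'rV[R]_n -> R) : measurable_fun setT f ->
    measurable_fun setT (fun x => (f x ^+ 2)%:E).
  exact: measurable_sqr.
rewrite /normsq -ge0_integralD//; last 4 first.
- by move=> x _; rewrite lee_fin sqr_ge0.
- exact: m2.
- by move=> x _; rewrite lee_fin sqr_ge0.
- exact: m2.
rewrite -ge0_integralZl//; last 2 first.
- by apply: emeasurable_funD; exact: m2.
- by move=> x _; rewrite -EFinD lee_fin addr_ge0 ?sqr_ge0.
apply: ge0_le_integral => //.
- exact: measurableT_comp.
- by apply: measurable_funeM; apply: emeasurable_funD; exact: m2.
Qed.

Lemma normsq_fin u : sqint u -> exists2 b, 0 <= b & normsq u = b%:E.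
Proof.
move=> /sqintP[mu' uoo]; exists (fine (normsq u)).
  by rewrite fine_ge0// normsq_ge0.
by rewrite fineK// ge0_fin_numE// normsq_ge0.
Qed.

(** Expand [uk * vk - u * v] into the product of the two errors and two mixed terms. In a mixed term
    the small error is multiplied by [r^-1] and the fixed factor by [r], which replaces
    Cauchy-Schwarz. *)
Lemma integral_product_cvg (uk vk : nat -> 'rV[R]_n -> R) u v w (c : R) :
  (forall k, measurable_fun setT (uk k)) -> (forall k, measurable_fun setT (vk k)) ->
  sqint u -> sqint v -> measurable_fun setT w -> (forall x, `|w x| <= c) ->
  (forall e : R, 0 < e -> exists k0, forall k, (k0 <= k)%N ->
     (normsq (fun x => uk k x - u x)%R <= e%:E)%E) ->
  (forall e : R, 0 < e -> exists k0, forall k, (k0 <= k)%N ->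
     (normsq (fun x => vk k x - v x)%R <= e%:E)%E) ->
  forall e : R, 0 < e -> exists k,
  `|\int[mu]_x (uk k x * vk k x * w x) - \int[mu]_x (u x * v x * w x)| <= e.
Proof.
move=> muk mvk su sv mw wc Hu Hv e e0.
have c0 : 0 <= c by exact: le_trans (wc 0).
have [a a0 ua] := normsq_fin su; have [b b0 vb] := normsq_fin sv.
(* [l = r ^ 2] weights the fixed squared norms [a] and [b]; it is chosen first, so that their total
   contribution is at most [e / 4]. *)
pose l := e / ((c + 1) * 4 * (a + b + 1)).
have d0 : 0 < (c + 1) * 4 * (a + b + 1).
  by rewrite !mulr_gt0// ?ltr_wpDl// addr_ge0.
have l0 : 0 < l by rewrite divr_gt0.
(* The tolerance for the errors is chosen after [l], since it has to absorb the factor [l^-1]; the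
   errors then contribute at most [e / 2]. *)
pose d := e / ((c + 1) * 4 * (1 + l^-1)).
have li0 : 0 < l^-1 by rewrite invr_gt0.
have dd0 : 0 < (c + 1) * 4 * (1 + l^-1).
  by rewrite !mulr_gt0// ?ltr_wpDl// addr_gt0.
have d0' : 0 < d by rewrite divr_gt0.
have [k1 H1] := Hu _ d0'; have [k2 H2] := Hv _ d0'.
exists (maxn k1 k2); set k := maxn k1 k2.
have {}H1 := H1 k (leq_maxl _ _); have {}H2 := H2 k (leq_maxr _ _).
have sU : sqint (fun x => uk k x - u x).
  apply/sqintP; split; first by apply: measurable_funB => //; case: su.
  by apply: le_lt_trans H1 _; exact: ltry.
have sV : sqint (fun x => vk k x - v x).
  apply/sqintP; split; first by apply: measurable_funB => //; case: sv.
  by apply: le_lt_trans H2 _; exact: ltry.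
pose r := Num.sqrt l; have r0 : 0 < r by rewrite sqrtr_gt0.
have r2 : r ^+ 2 = l by rewrite sqr_sqrtr// ltW.
have [i1 n1] := sqint_mul_integrable sU sV mw wc.
have [i2 n2] := sqint_mul_integrable (sqintZ r^-1 sU) (sqintZ r sv) mw wc.
have [i3 n3] := sqint_mul_integrable (sqintZ r su) (sqintZ r^-1 sV) mw wc.
have [i0 _] := sqint_mul_integrable su sv mw wc.
have E : (fun x => uk k x * vk k x * w x) = (fun x =>
  (uk k x - u x) * (vk k x - v x) * w x + r^-1 * (uk k x - u x) * (r * v x) * w x +
  r * u x * (r^-1 * (vk k x - v x)) * w x + u x * v x * w x).
  apply/funext => x.
  have rr : r^-1 * r = 1 by rewrite mulVf// gt_eqF.
  transitivity ((uk k x - u x) * (vk k x - v x) * w x + (r^-1 * r) * (uk k x - u x) * v x * w x +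
   (r^-1 * r) * u x * (vk k x - v x) * w x + u x * v x * w x).
    by rewrite rr; ring.
  by ring.
have i12 := integrableD measurableT i1 i2.
have i123 := integrableD measurableT i12 i3.
rewrite E RintegralD// RintegralD// RintegralD// addrK.
have nZ q f : sqint f -> (normsq (fun x => q * f x)%R = (q ^+ 2)%:E * normsq f)%E.
  by case=> mf _; exact: normsqZ.
have {}n1 : `|\int[mu]_x ((uk k x - u x) * (vk k x - v x) * w x)| <= c * (d + d).
  rewrite -lee_fin; apply: (le_trans n1); rewrite EFinM EFinD.
  by apply: lee_wpmul2l => //; exact: leeD.
have {}n2 : `|\int[mu]_x (r^-1 * (uk k x - u x) * (r * v x) * w x)| <= c * (l^-1 * d + l * b).
  rewrite -lee_fin; apply: (le_trans n2); rewrite EFinM EFinD.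
  apply: lee_wpmul2l => //; apply: leeD; last by rewrite nZ// r2 vb.
  by rewrite nZ// exprVn r2 EFinM; apply: lee_wpmul2l => //; rewrite lee_fin ltW.
have {}n3 : `|\int[mu]_x (r * u x * (r^-1 * (vk k x - v x)) * w x)| <= c * (l * a + l^-1 * d).
  rewrite -lee_fin; apply: (le_trans n3); rewrite EFinM EFinD.
  apply: lee_wpmul2l => //; apply: leeD; first by rewrite nZ// r2 ua.
  by rewrite nZ// exprVn r2 EFinM; apply: lee_wpmul2l => //; rewrite lee_fin ltW.
have E1 : (c + 1) * (l * (a + b + 1)) = e / 4.
  by rewrite /l; field; rewrite !gt_eqF// ?ltr_wpDl// ?addr_ge0.
have E2 : (c + 1) * (d * (1 + l^-1)) = e / 4.
  have q1 : 1 + l^-1 != 0 by rewrite gt_eqF// addr_gt0.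
  have q2 : c + 1 != 0 by rewrite gt_eqF// ltr_wpDl.
  rewrite /d; move: q1 q2; clear; move: (l^-1) => q q1 q2.
  by field; rewrite q1 q2.
apply: (le_trans (ler_normD _ _)); rewrite (le_trans (lerD (ler_normD _ _) (lexx _)))//.
apply: (le_trans (lerD (lerD n1 n2) n3)).
apply: (@le_trans _ _ (2 * ((c + 1) * (d * (1 + l^-1))) + (c + 1) * (l * (a + b + 1)))).
  have p1 : 0 <= l^-1 * d by rewrite mulr_ge0// ltW.
  have p2 : 0 <= l * b by rewrite mulr_ge0// ltW.
  have p3 : 0 <= l * a by rewrite mulr_ge0// ltW.
  have p4 : 0 <= c * l by rewrite mulr_ge0// ltW.
  move: p1 p2 p3 p4 (ltW d0') (ltW l0); clear.
  by move: (l^-1) => q; nra.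
by rewrite E1 E2; move: e0; clear; lra.
Qed.

End product_limit.

(** * Geometric means of extended reals and the interpolation exponent *)

Section geometric_mean.
Context {R : realType}.

Lemma poweR_split (m : \bar R) (th : R) : (0 <= m)%E -> 0 < th < 1 ->
  (m `^ th * m `^ (1 - th) = m)%E.
Proof.
move=> m0 /andP[th0 th1]; have th1' : 0 < 1 - th by rewrite subr_gt0.
case: m m0 => [m||//]; last by rewrite !poweRyr ?mulyy ?gt_eqF.
rewrite lee_fin => m0; rewrite !poweR_EFin -EFinM -powRD ?subrKC ?powRr1//.
by rewrite oner_eq0.
Qed.

Lemma le_poweR_split (a u v : \bar R) (th : R) : (0 <= a)%E -> 0 < th < 1 ->
  (a <= u -> a <= v -> a <= u `^ th * v `^ (1 - th))%E.
Proof.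
move=> a0 thI au av; have /andP[th0 th1] := thI.
have in0 (z : \bar R) : (0 <= z)%E -> z \in `[0%E, +oo%E].
  by move=> z0; rewrite in_itv/= z0 leey.
rewrite -[X in (X <= _)%E](poweR_split a0 thI); apply: lee_pmul.
- exact: poweR_ge0.
- exact: poweR_ge0.
- by apply: gt0_ler_poweR => //; [exact: ltW|exact: in0|exact/in0/(le_trans a0)].
- apply: gt0_ler_poweR => //; [|exact: in0|exact/in0/(le_trans a0)].
  by rewrite subr_ge0 ltW.
Qed.

Lemma poweR_young (u v : \bar R) (th : R) : (0 <= u)%E -> (0 <= v)%E -> 0 < th < 1 ->
  (u `^ th * v <= u + v `^ (1 - th)^-1)%E.
Proof.
move=> u0 v0 thI; have /andP[th0 th1] := thI; set p := (1 - th)^-1.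
have m0 : (0 <= u + v `^ p)%E by rewrite adde_ge0// poweR_ge0.
have in0 (z : \bar R) : (0 <= z)%E -> z \in `[0%E, +oo%E].
  by move=> z0; rewrite in_itv/= z0 leey.
rewrite -[X in (_ <= X)%E](poweR_split m0 thI); apply: lee_pmul => //.
- exact: poweR_ge0.
- apply: gt0_ler_poweR => //; [exact: ltW|exact: in0|exact: in0|].
  by rewrite leeDl// poweR_ge0.
- rewrite -[X in (X <= _)%E](_ : (v `^ p) `^ (1 - th) = v)%E; last first.
    by rewrite -poweRrM /p mulVf ?poweRe1// gt_eqF// subr_gt0.
  apply: gt0_ler_poweR => //; [by rewrite subr_ge0 ltW|exact/in0/poweR_ge0|exact: in0|].
  by rewrite leeDr.
Qed.

(* Any exponent with [2 n theta <= 1/2] works; [n.+1] covers [n = 0]. *)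
Definition theta (n : nat) : R := (4 * n.+1%:R)^-1.

Lemma theta_itv n : 0 < theta n < 1.
Proof.
have n1 : 1 <= n.+1%:R :> R by rewrite ler1n.
have p : 1 < 4 * n.+1%:R :> R by move: n1; lra.
by rewrite /theta invr_gt0 (lt_trans _ p)//= invf_lt1// (lt_trans _ p).
Qed.

Lemma powR_theta n (a : R) : 1 <= a -> ((a ^+ n) ^+ 2) `^ theta n <= Num.sqrt a.
Proof.
move=> a1; have a0 : 0 <= a by exact: le_trans a1.
rewrite -exprM -powR_mulrn// -powRrM -powR12_sqrt//; apply: ler_powR => //.
rewrite /theta natrM -[X in _ / (_ * X)]natr1.
have : 0 <= n%:R :> R by [].
move: (n%:R : R) => m m0; rewrite ler_pdivrMr; last by lra.
lra.
Qed.

End geometric_mean.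

(** * The mollified integrals at a fixed point and kernel scale *)

Section paraproduct.
Context {R : realType} {n : nat}.
Local Notation mu := (@lebesgue_rV R n).
Context (h : 'rV[R]_n -> R) (K : R) (f G : 'rV[R]_n -> R) (g : 'rV[R]_n -> 'rV[R]_n).
Context (hh : hardy_kernel h) (Ch : C1c h 1 K K).
Context (sf : sqint f) (sg : forall i, sqint (fun x => g x ord0 i)) (sG : sqint G).
Context (gG : forall i x, `|g x ord0 i| <= `|G x|) (wg : weak_gradient f g).
Implicit Types (u v : 'rV[R]_n -> R) (x y z : 'rV[R]_n).
Local Notation e_ i := (delta_mx ord0 i : 'rV[R]_n).
Local Notation M v := (maximal (fun x => `|v x|%:E)).
Local Notation F s := (convolution (dilate h s) f).
Local Notation D i s := (convolution (dilate h s) (fun x => g x ord0 i)).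
Local Notation th := (theta n : R).

Let lf : locint f. Proof. exact: sqint_locint. Qed.
Let lg i : locint (fun x => g x ord0 i). Proof. exact: sqint_locint. Qed.
Let lG : locint G. Proof. exact: sqint_locint. Qed.

Let K_ge0 : 0 <= K.
Proof. by have [_ _ _ _ [hK _]] := Ch; exact: le_trans (hK 0). Qed.

Let expV_ge0 (s : R) : 0 < s -> 0 <= s ^- n.
Proof. by move=> s0; rewrite invr_ge0 exprn_ge0// ltW. Qed.

Lemma continuous_mollified (s : R) v : 0 < s -> locint v ->
  continuous (convolution (dilate h s) v).
Proof. by move=> s0 lv; exact: (mollify_continuous Ch). Qed.

Lemma partial_mollified (s : R) i : 0 < s -> partial i (F s) = D i s.
Proof.
move=> s0; apply/funext => x; have [sh _ _ _] := hh.
have L0 : 0 <= s ^- n * (s^-1 * K) by rewrite mulr_ge0 ?expV_ge0// mulr_ge0// invr_ge0 ltW.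
have [_ ->] := convolution_partial i x (ltW s0) L0 (C1c_dilate Ch s0) lf.
exact: (weak_gradient_convolution i x s0 sh Ch lf wg).
Qed.

Lemma mollified_Ck1 (s : R) : 0 < s -> Ck 1 (F s).
Proof.
move=> s0; split; first exact: continuous_mollified.
move=> i; split; last by rewrite partial_mollified//; split => //; exact: continuous_mollified.
move=> x; have L0 : 0 <= s ^- n * (s^-1 * K).
  by rewrite mulr_ge0 ?expV_ge0// mulr_ge0// invr_ge0 ltW.
by have [] := convolution_partial i x (ltW s0) L0 (C1c_dilate Ch s0) lf.
Qed.

Section fixed_ball.
Context (x : 'rV[R]_n) (t : R) (t0 : 0 < t) (i : 'I_n).

Definition kernel_at y := dilate h t (x - y).
Local Notation psi := kernel_at.

Lemma kernel_atE : psi = fun y => t ^- n * h (t^-1 *: x + (- t^-1) *: y).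
Proof. by apply/funext => z; rewrite /kernel_at /dilate scalerBr scaleNr. Qed.

Lemma kernel_at_Ck1 : Ck 1 psi.
Proof. by rewrite kernel_atE; apply: Ck_affine; case: hh. Qed.

Lemma kernel_at_le y : `|psi y| <= t ^- n * K.
Proof. by have [_ _ _ _ [dK _]] := C1c_dilate Ch t0; exact: dK. Qed.

Lemma kernel_at_far y : t < `|x - y| -> psi y = 0.
Proof. by have [_ _ _ ds _] := C1c_dilate Ch t0 => /ds. Qed.

Lemma kernel_at_support y : `|x| + t < `|y| -> psi y = 0.
Proof.
move=> ty; apply: kernel_at_far.
have : `|y| <= `|x| + `|x - y|.
  by rewrite distrC (le_trans _ (ler_normD _ _))// addrC subrK.
by move: ty; lra.
Qed.

Lemma partial_kernel_at y : partial i psi y = - partial i (dilate h t) (x - y).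
Proof.
have [_ dh _ _ _] := Ch.
rewrite partial_dilate// kernel_atE.
have [_ ->] := derivable_partial_affine (t^-1 *: x) (- t^-1) (t ^- n) y (dh i).
by rewrite mulNr mulrN scaleNr scalerBr.
Qed.

Lemma partial_kernel_at_le y : `|partial i psi y| <= t ^- n * (t^-1 * K).
Proof. by rewrite partial_kernel_at normrN; have [_ _ _ _ [_ dL]] := C1c_dilate Ch t0. Qed.

Lemma partial_kernel_at_far y : t < `|x - y| -> partial i psi y = 0.
Proof.
move=> ty; rewrite partial_kernel_at; have [_ _ _ ds _] := C1c_dilate Ch t0.
by rewrite (partial_support ds)// oppr0.
Qed.

Definition mollified_integral (s : R) : R := \int[mu]_y (F s y * D i s y * psi y).
Local Notation T := mollified_integral.

Lemma mollified_integral_by_parts (s : R) : 0 < s ->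
  T s = - (\int[mu]_y (F s y ^+ 2 * partial i psi y) / 2).
Proof.
move=> s0.
have xt0 : 0 <= `|x| + t by rewrite addr_ge0// ltW.
rewrite -(integral_sqr_by_parts i xt0 (mollified_Ck1 s0) kernel_at_Ck1 kernel_at_support).
by rewrite partial_mollified.
Qed.

Lemma absint_cst1 (r : R) : 0 < r -> absint (fun=> 1) x r = (r *+ 2) ^+ n.
Proof.
move=> r0; apply: EFin_inj; rewrite (EFin_absint x r (locint_cst 1)).
rewrite [LHS](_ : _ = \int[mu]_(y in ball x r) cst 1 y)%E; last first.
  by apply: eq_integral => y _; rewrite normr1.
rewrite integral_cst; last exact: measurable_rV_ball.
rewrite mul1e; exact: lebesgue_rV_ball.
Qed.

Definition maximal_product y := (M f y * M G y)%E.
Local Notation H := maximal_product.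

Lemma maximal_product_ge0 y : (0 <= H y)%E.
Proof. by rewrite mule_ge0// maximal_ge0// => z; rewrite lee_fin. Qed.

Lemma measurable_maximal_product : measurable_fun setT H.
Proof. by apply: emeasurable_funM; exact: measurable_maximal. Qed.

(** One factor [K] for each of the two mollifications and one for the kernel; [4 ^+ n] is the volume
    of the ball of radius [2 t] relative to [t ^+ n], and each average costs [24 ^+ n]. *)
Definition start_cst : R := K ^+ 3 * 4 ^+ n * (24 ^+ n) ^+ 2.

(** At scale [t] no cancellation is called for: wherever the kernel is nonzero, both mollifications
    are bounded by averages over the ball of radius [4 t] about the single point [x]. *)
Lemma mollified_integral_start : (`|T t|%:E <= start_cst%:E * H x)%E.
Proof.
pose a := t ^- n * absint f x (4 * t); pose b := t ^- n * absint G x (4 * t).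
have a0 : 0 <= a by rewrite mulr_ge0 ?expV_ge0// absint_ge0.
have b0 : 0 <= b by rewrite mulr_ge0 ?expV_ge0// absint_ge0.
have t20 : 0 < 2 * t by rewrite mulr_gt0.
have near y : `|x - y| <= t -> `|x - y| + 2 * t <= 4 * t by move=> ?; lra.
have c0 : 0 <= K * a * (K * b) * (t ^- n * K).
  by apply: mulr_ge0; [apply: mulr_ge0; exact: mulr_ge0|apply: mulr_ge0 => //; exact: expV_ge0].
have bound : `|T t| <= (K * a) * (K * b) * (t ^- n * K) * absint (fun=> 1) x (2 * t).
  apply: (dominated_on_ball _ (locint_cst 1) _ _ _).2.
  - apply: measurable_funM; [apply: measurable_funM|];
      apply: continuous_measurable_rV; [exact: continuous_mollified..|].
    by case: kernel_at_Ck1.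
  - exact: c0.
  - move=> y _; rewrite normr1 mulr1.
    have [ty|yt] := ltP t `|x - y|.
      by rewrite kernel_at_far// mulr0 normr0.
    rewrite normrM; apply: ler_pM => //; last exact: kernel_at_le.
    rewrite normrM; apply: ler_pM => //.
      apply: (le_trans (mollify_le t0 Ch lf (near _ yt))).
      by rewrite -mulrA mulrCA.
    apply: (le_trans (mollify_le t0 Ch (lg i) (near _ yt))).
    rewrite -mulrA mulrCA; apply: ler_wpM2l => //; apply: ler_wpM2l; first exact: expV_ge0.
    by apply: absint_le_fun => // z; exact: gG.
  - move=> y /ball_normP /negP; rewrite -leNgt => ty.
    by rewrite kernel_at_far ?mulr0// (lt_le_trans _ ty)// ltr_pMl// ltr1n.
have {bound} bound : `|T t| <= K ^+ 3 * 4 ^+ n * (a * b).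
  apply: (le_trans bound); rewrite absint_cst1// le_eqVlt; apply/orP; left; apply/eqP.
  rewrite (_ : (2 * t) *+ 2 = 4 * t); last by rewrite -mulr_natr; ring.
  rewrite exprMn; have tn : t ^- n * t ^+ n = 1 by rewrite mulVf// expf_neq0// gt_eqF.
  transitivity (K ^+ 3 * 4 ^+ n * (a * b) * (t ^- n * t ^+ n)); last by rewrite tn mulr1.
  by ring.
apply: (@le_trans _ _ ((K ^+ 3 * 4 ^+ n)%:E * (a%:E * b%:E))%E).
  by rewrite -!EFinM lee_fin.
rewrite /start_cst [X in (_ <= X * _)%E]EFinM -[X in (_ <= X)%E]muleA; apply: lee_wpmul2l.
  by rewrite lee_fin mulr_ge0// exprn_ge0.
rewrite expr2 [X in (_ <= X * _)%E]EFinM muleACA; apply: lee_pmul; [by rewrite lee_fin..| |];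
  exact: average_le_maximal.
Qed.

Lemma averages_le (y : 'rV[R]_n) (s : R) : 0 < s -> s <= t -> `|x - y| < 2 * t ->
  (((s ^- n * absint f y (4 * s)) * (s ^- n * absint G y (4 * s)))%:E <=
   ((24 ^+ n) ^+ 2 * Num.sqrt (60 * (t / s)))%:E * (H x `^ th * H y `^ (1 - th)))%E.
Proof.
move=> s0 st xy.
have a0 v : 0 <= s ^- n * absint v y (4 * s) by rewrite mulr_ge0 ?expV_ge0// absint_ge0.
have s2t : s <= 2 * t by move: st t0; lra.
have [th0 th1] := andP (theta_itv n : 0 < th < 1).
set a := _ * _; have aE : a%:E = ((s ^- n * absint f y (4 * s))%:E * (s ^- n * absint G y (4 * s))%:E)%E.
  by rewrite -EFinM.
have e0 v : (0%:E <= (s ^- n * absint v y (4 * s))%:E)%E by rewrite lee_fin.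
have near : (a%:E <= ((24 ^+ n) ^+ 2)%:E * H y)%E.
  by rewrite aE expr2 [X in (_ <= X * _)%E]EFinM muleACA; apply: lee_pmul => //; exact: average_le_maximal.
have far : (a%:E <= (((60 * (t / s)) ^+ n) ^+ 2)%:E * H x)%E.
  (* The point [y] is only within [2 t] of [x], so the distant bound is used at scale [2 t], and
     [60 = 30 * 2]. *)
  have E : (60 * (t / s)) ^+ n = 30 ^+ n * (2 * t / s) ^+ n.
    by rewrite -exprMn; congr (_ ^+ _); ring.
  rewrite aE expr2 E [X in (_ <= X * _)%E]EFinM muleACA.
  by apply: lee_pmul => //; exact: average_le_maximal_far.
have a0e : (0 <= a%:E)%E by rewrite lee_fin mulr_ge0.
apply: (le_trans (le_poweR_split a0e (theta_itv n) far near)).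
have q1 : 1 <= 60 * (t / s).
  have : 1 <= t / s by rewrite ler_pdivlMr// mul1r.
  by move: (t / s) => q; lra.
have q0 : 0 <= 60 * (t / s) by exact: le_trans q1.
rewrite poweRM ?maximal_product_ge0 ?lee_fin ?exprn_ge0//.
rewrite poweRM ?maximal_product_ge0 ?lee_fin ?exprn_ge0//.
rewrite muleACA !poweR_EFin -EFinM; apply: lee_wpmul2r.
  by rewrite mule_ge0// poweR_ge0.
rewrite lee_fin mulrC; apply: ler_pM; rewrite ?powR_ge0//; last exact: powR_theta.
apply: ler1_powR; last by rewrite gerBl ltW.
by rewrite !exprn_ege1// ler1n.
Qed.

(** The factors [n * K * (1 + 2 * 4 ^+ n)] and [K * (1 + 4 ^+ n)] bound the difference and the sum
    of the two mollifications, the third [K] the derivative of the kernel. Then [(24 ^+ n) ^+ 2]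
    comes from the averages, and [12 = 6 * 2] from integrating over the ball of radius [2 t]. *)
Definition jump_cst : R :=
  n%:R * K ^+ 3 * (1 + 2 * 4 ^+ n) * (1 + 4 ^+ n) * (24 ^+ n) ^+ 2 * 12 ^+ n.

Lemma jump_cst_ge0 : 0 <= jump_cst.
Proof. by rewrite !mulr_ge0// ?addr_ge0 ?mulr_ge0 ?exprn_ge0. Qed.

(** After integration by parts the integrand is a difference of squares, hence difference times sum.
    The difference gains [s] and the derivative of the kernel costs [t^-1], which produces [s / t];
    the square root is the loss from interpolating the averages. *)
Lemma mollified_integral_jump (s : R) : 0 < s -> s <= t -> (H x < +oo)%E ->
  (`|T s - T (s / 4)|%:E <= (jump_cst * (s / t * Num.sqrt (60 * (t / s))))%:E *
     (H x `^ th * maximal (fun y => H y `^ (1 - th)) x))%E.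
Proof.
move=> s0 st Hoo; have r0 : 0 < s / 4 by rewrite divr_gt0.
(* Finiteness of the maximal product at [x] makes its power a real number, which can be merged with
   the constants and taken out of the integral over [y]. *)
have [b bE] : exists b : R, (H x `^ th = b%:E)%E.
  exists (fine (H x `^ th)%E); rewrite fineK// ge0_fin_numE ?poweR_ge0//.
  exact: poweR_lty.
have b0 : 0 <= b by rewrite -lee_fin -bE poweR_ge0.
pose q := Num.sqrt (60 * (t / s)); have q0 : 0 <= q by exact: sqrtr_ge0.
rewrite bE -/q; pose W y := (H y `^ (1 - th))%E.
have W0 y : (0 <= W y)%E by exact: poweR_ge0.
have mW : measurable_fun setT W.
  by apply: (measurableT_comp (measurable_poweR _)); exact: measurable_maximal_product.
rewrite -/W.
have xt0 : 0 <= `|x| + t by rewrite addr_ge0// ltW.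
have [cpsi Hpsi] := kernel_at_Ck1.
have cF2 (a : R) : 0 < a -> continuous (fun y => F a y ^+ 2 * partial i psi y).
  move=> a0 y; have cF := continuous_mollified a0 lf.
  apply: (@continuousM R _ (fun y => F a y ^+ 2) (partial i psi)); last exact: (Hpsi i).2.1.
  by apply: (@continuousM R _ (F a) (F a)); exact: cF.
have psis := partial_support kernel_at_support i.
have iF2 (a : R) : 0 < a -> mu.-integrable setT (EFin \o (fun y => F a y ^+ 2 * partial i psi y)).
  move=> a0; apply: (integrable_continuous_support xt0 (cF2 _ a0)) => y xy.
  by rewrite psis// mulr0.
pose w y := F s y ^+ 2 * partial i psi y - F (s / 4) y ^+ 2 * partial i psi y.
have TE : T s - T (s / 4) = - ((\int[mu]_y w y) / 2).
  rewrite !mollified_integral_by_parts// /w RintegralB//; last 2 first.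
  - exact: iF2.
  - exact: iF2.
  by rewrite opprK mulrBl opprB addrC.
have mw : measurable_fun setT w.
  by apply: measurable_funB; apply: continuous_measurable_rV; exact: cF2.
pose c := n%:R * K ^+ 3 * (1 + 2 * 4 ^+ n) * (1 + 4 ^+ n) * (24 ^+ n) ^+ 2 *
  (s / t * q) * t ^- n.
have c0 : 0 <= c.
  by rewrite !mulr_ge0// ?expV_ge0 ?addr_ge0 ?mulr_ge0 ?exprn_ge0 ?invr_ge0// ltW.
have wball y : ball x (2 * t) y -> (`|w y|%:E <= (c * b)%:E * W y)%E.
  move=> /ball_normP xy.
  pose a := (s ^- n * absint f y (4 * s)) * (s ^- n * absint G y (4 * s)).
  have a0 v : 0 <= s ^- n * absint v y (4 * s) by rewrite mulr_ge0 ?expV_ge0// absint_ge0.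
  have wa : `|w y| <= n%:R * K ^+ 3 * (1 + 2 * 4 ^+ n) * (1 + 4 ^+ n) * (s / t) * t ^- n * a.
    have := mollify_diff y s0 hh Ch lf lg lG gG wg.
    have := mollify_sum_le y s0 Ch lf; have := partial_kernel_at_le y.
    rewrite (_ : w y = (F s y - F (s / 4) y) * (F s y + F (s / 4) y) * partial i psi y); last first.
      by rewrite /w; ring.
    move=> B1 B2 B3; rewrite normrM normrM.
    apply: (le_trans (ler_pM _ _ (ler_pM _ _ B3 B2) B1)) => //.
    rewrite le_eqVlt; apply/orP; left; apply/eqP; rewrite /a.
    by ring.
  apply: (@le_trans _ _ ((n%:R * K ^+ 3 * (1 + 2 * 4 ^+ n) * (1 + 4 ^+ n) * (s / t) * t ^- n)%:E * a%:E)%E).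
    by rewrite -EFinM lee_fin.
  have := averages_le s0 st xy; rewrite bE -/q -/a => Ha.
  apply: (le_trans (lee_wpmul2l _ Ha)).
    rewrite lee_fin !mulr_ge0// ?expV_ge0 ?addr_ge0 ?mulr_ge0 ?exprn_ge0 ?invr_ge0//; exact: ltW.
  rewrite muleA muleA -!EFinM [X in (X%:E * _ <= _)%E](_ : _ = c * b)//.
  by rewrite /c; ring.
have wfar y : ~ ball x (2 * t) y -> w y = 0.
  move=> /ball_normP /negP; rewrite -leNgt => ty.
  rewrite /w partial_kernel_at_far ?mulr0 ?subrr// (lt_le_trans _ ty)// ltr_pMl//.
  by rewrite ltr1n.
have mb : measurable (ball x (2 * t) : set 'rV[R]_n) by exact: measurable_rV_ball.
have iw : mu.-integrable setT (EFin \o w).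
  by have := integrableB measurableT (iF2 _ s0) (iF2 _ r0).
have wle : (`|\int[mu]_y w y|%:E <= (c * b)%:E * \int[mu]_(y in ball x (2 * t)) W y)%E.
  rewrite EFin_normr_Rintegral//.
  have mEw : measurable_fun setT (EFin \o w) by exact/measurable_EFinP.
  apply: (le_trans (le_abse_integral _ measurableT mEw)).
  rewrite -ge0_integralZl//; last 2 first.
  - exact: measurable_funTS.
  - by rewrite lee_fin mulr_ge0.
  rewrite [leRHS]integral_mkcond; apply: ge0_le_integral => //.
  - exact: measurableT_comp.
  - apply/(measurable_restrictT _ mb); apply: measurable_funTS.
    exact: measurable_funeM.
  - move=> y _; rewrite patchE; case: ifPn => [|]; first by rewrite inE; exact: wball.
    by rewrite notin_setE => /wfar/= ->; rewrite normr0.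
rewrite TE normrN normrM [`|2^-1|]gtr0_norm ?invr_gt0//.
apply: (@le_trans _ _ (`|\int[mu]_y w y|%:E)).
  by rewrite lee_fin ler_piMr// invf_le1// ler1n.
apply: (le_trans wle); have ball_x : ball x (2 * t) x by apply: ballxx; rewrite mulr_gt0.
apply: (le_trans (lee_wpmul2l _ (integral_ball_le_maximal mW W0 ball_x))).
  by rewrite lee_fin mulr_ge0.
rewrite muleA muleA -!EFinM [X in (X%:E * _ <= _)%E](_ : _ = jump_cst * (s / t * q) * b)//.
have tn : t ^- n * t ^+ n = 1 by rewrite mulVf// expf_neq0// gt_eqF.
transitivity (jump_cst * (s / t * q) * b * (t ^- n * t ^+ n)); last by rewrite tn mulr1.
rewrite /jump_cst /c (_ : 6 * (2 * t) = 12 * t); last by ring.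
by rewrite exprMn; ring.
Qed.

End fixed_ball.
End paraproduct.

(** * Summation over scales and the pointwise bound for the Hardy maximal function *)

Section pointwise_bound.
Context {R : realType} {n : nat}.
Local Notation mu := (@lebesgue_rV R n).
Context (h : 'rV[R]_n -> R) (K : R) (f G : 'rV[R]_n -> R) (g : 'rV[R]_n -> 'rV[R]_n).
Context (hh : hardy_kernel h) (Ch : C1c h 1 K K).
Context (sf : sqint f) (sg : forall i, sqint (fun x => g x ord0 i)) (sG : sqint G).
Context (gG : forall i x, `|g x ord0 i| <= `|G x|) (wg : weak_gradient f g).
Implicit Types (u v : 'rV[R]_n -> R) (x y z : 'rV[R]_n).
Local Notation th := (theta n : R).
Local Notation H := (maximal_product f G).
Local Notation MW := (maximal (fun y => H y `^ (1 - th))%E).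

Let K_ge0 : 0 <= K.
Proof. by have [_ _ _ _ [hK _]] := Ch; exact: le_trans (hK 0). Qed.

Lemma start_cst_ge0 : 0 <= @start_cst R n K.
Proof. by rewrite !mulr_ge0// ?exprn_ge0// exprn_ge0. Qed.

Lemma maximal_power_ge0 x : (0 <= MW x)%E.
Proof. by apply: maximal_ge0 => y; exact: poweR_ge0. Qed.

(** The factor [s / t * sqrt (60 * (t / s))] at [s = t / 4 ^+ k]. As [sqrt 60 <= 8], it decays like
    [2 ^- k]. *)
Lemma jump_factor (k : nat) :
  (4 ^+ k)^-1 * Num.sqrt (60 * 4 ^+ k) <= 8 * (2 ^+ k)^-1 :> R.
Proof.
have q0 : 0 < 2 ^+ k :> R by rewrite exprn_gt0.
have E4 : 4 ^+ k = 2 ^+ k ^+ 2 :> R by rewrite -exprM mulnC exprM; congr (_ ^+ _); ring.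
have : Num.sqrt (60 * 4 ^+ k) <= 8 * 2 ^+ k :> R.
  rewrite -[leRHS]ger0_norm ?mulr_ge0 ?(ltW q0)// -sqrtr_sqr ler_wsqrtr// exprMn -E4.
  by rewrite ler_wpM2r ?exprn_ge0//; lra.
move=> /(ler_wpM2l (_ : 0 <= (4 ^+ k)^-1)); rewrite invr_ge0 exprn_ge0// => /(_ isT).
move=> /le_trans; apply; rewrite E4 le_eqVlt; apply/orP; left; apply/eqP.
by field; rewrite gt_eqF.
Qed.

Section fixed_scale.
Context (x : 'rV[R]_n) (t : R) (t0 : 0 < t) (i : 'I_n) (Hoo : (H x < +oo)%E).
Local Notation T := (mollified_integral h f g x t i).
Local Notation s k := (t / 4 ^+ k).

Let s_gt0 k : 0 < s k. Proof. by rewrite divr_gt0// exprn_gt0. Qed.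

Let s_le k : s k <= t.
Proof. by rewrite ler_pdivrMr ?exprn_gt0// ler_pMr// exprn_ege1// ler1n. Qed.

Let s_cvg : s k @[k --> \oo] --> 0.
Proof.
have q1 : `|4^-1 : R| < 1 by rewrite gtr0_norm ?invr_gt0// invf_lt1// ltr1n.
rewrite (_ : (fun k => s k) = geometric t 4^-1); first exact: cvg_geometric.
by apply/funext => k; rewrite /geometric/= exprVn.
Qed.

(** Telescoping over the scales. The factor [16 * (1 - 2^-k)] is exactly the sum of [8 * 2^-j] for
    [j < k], the form in which the induction closes. *)
Lemma mollified_integral_le k :
  (`|T (s k)|%:E <= (@start_cst R n K)%:E * H x +
     (16 * @jump_cst R n K * (1 - (2 ^+ k)^-1))%:E * (H x `^ th * MW x))%E.
Proof.
have B0 : (0 <= H x `^ th * MW x)%E by rewrite mule_ge0 ?poweR_ge0// maximal_power_ge0.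
have J0 : 0 <= @jump_cst R n K by apply: jump_cst_ge0 Ch.
elim: k => [|k IH].
  have -> : s 0%N = t by rewrite expr0 divr1.
  rewrite expr0 invr1 subrr mulr0 mul0e adde0.
  exact: mollified_integral_start.
have Sk : s k.+1 = s k / 4 by rewrite exprSr invfM mulrA.
have jump := mollified_integral_jump hh Ch sf sg sG gG wg t0 i (s_gt0 k) (s_le k) Hoo.
rewrite -Sk in jump.
have q2 : 0 < (2 ^+ k)^-1 :> R by rewrite invr_gt0 exprn_gt0.
have q21 : (2 ^+ k)^-1 <= 1 :> R by rewrite invf_le1 ?exprn_gt0// exprn_ege1// ler1n.
apply: (@le_trans _ _ (`|T (s k)|%:E + `|T (s k) - T (s k.+1)|%:E)%E).
  rewrite -EFinD lee_fin; move: (T (s k)) (T (s k.+1)) => p q.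
  by rewrite (le_trans _ (ler_normB _ _))// subKr.
apply: (le_trans (leeD IH jump)); rewrite -addeA; apply: leeD2l.
rewrite -ge0_muleDl; last 2 first.
- by rewrite lee_fin !mulr_ge0// subr_ge0.
- rewrite lee_fin !mulr_ge0// ?sqrtr_ge0// ?invr_ge0; exact: ltW.
apply: lee_wpmul2r => //; rewrite -EFinD lee_fin.
have -> : s k / t = (4 ^+ k)^-1 by rewrite mulrAC mulfV ?mul1r// gt_eqF.
have -> : t / s k = 4 ^+ k by rewrite invf_div mulrCA mulfV ?mulr1// gt_eqF.
have := ler_wpM2l J0 (jump_factor k).
rewrite exprS invfM; move: (_ * Num.sqrt _) => A; move: ((2 ^+ k)^-1) => q.
by move: (jump_cst K) => J; lra.
Qed.

(** The bound for [T (s k)] is uniform in [k], and [L^2] convergence of both mollified factors makes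
    some [T (s k)] differ from the convolution by at most a prescribed [e]. *)
Lemma convolution_component_finite_le :
  (`|convolution (dilate h t) (fun y => f y * g y ord0 i) x|%:E <=
   (@start_cst R n K)%:E * H x + (16 * @jump_cst R n K)%:E * (H x `^ th * MW x))%E.
Proof.
have B0 : (0 <= H x `^ th * MW x)%E by rewrite mule_ge0 ?poweR_ge0// maximal_power_ge0.
have J0 : 0 <= @jump_cst R n K by apply: jump_cst_ge0 Ch.
have lf := sqint_locint sf; have lg := sqint_locint (sg i).
have mpsi : measurable_fun setT (kernel_at h x t).
  by apply: continuous_measurable_rV; have [] := kernel_at_Ck1 hh x t.
apply/lee_addgt0Pr => e e0.
have [||k Hk] := @integral_product_cvg R n
  (fun k => convolution (dilate h (s k)) f)
  (fun k => convolution (dilate h (s k)) (fun y => g y ord0 i))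
  f (fun y => g y ord0 i) (kernel_at h x t) (t ^- n * K) _ _ sf (sg i) mpsi
  (kernel_at_le Ch x t0)
  (mollify_cvg hh Ch s_gt0 s_le s_cvg sf).2
  (mollify_cvg hh Ch s_gt0 s_le s_cvg (sg i)).2 e e0.
- by move=> k; exact: (measurable_mollify Ch (s_gt0 k)).
- by move=> k; exact: (measurable_mollify Ch (s_gt0 k)).
have -> : convolution (dilate h t) (fun y => f y * g y ord0 i) x =
    \int[mu]_y (f y * g y ord0 i * kernel_at h x t y).
  by apply: eq_Rintegral => y _; rewrite mulrC.
move: Hk; move: (\int[mu]_y (f y * g y ord0 i * kernel_at h x t y)) => L Hk.
apply: (@le_trans _ _ (`|T (s k)|%:E + e%:E)%E).
  rewrite -EFinD lee_fin.
  move: Hk; rewrite -/(mollified_integral h f g x t i (s k)).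
  move: (T (s k)) => p Hk; rewrite -[L](subKr p).
  by apply: (le_trans (ler_normB _ _)); rewrite lerD2l.
apply: leeD2r; apply: (le_trans (mollified_integral_le k)); apply: leeD2l.
apply: lee_wpmul2r => //; by rewrite lee_fin ler_piMr ?mulr_ge0// gerBl invr_ge0 exprn_ge0.
Qed.

End fixed_scale.

(** The added 1 makes the constant positive, so that its product with an infinite majorant is
    infinite. *)
Definition pointwise_cst : R := @start_cst R n K + 16 * @jump_cst R n K + 1.

Definition majorant x := (H x + MW x `^ (1 - th)^-1)%E.

Lemma pointwise_cst_gt0 : 0 < pointwise_cst.
Proof.
have J0 : 0 <= @jump_cst R n K by apply: jump_cst_ge0 Ch.
by rewrite ltr_wpDl// addr_ge0 ?mulr_ge0 ?start_cst_ge0.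
Qed.

Lemma majorant_ge0 x : (0 <= majorant x)%E.
Proof. by rewrite adde_ge0 ?poweR_ge0// maximal_product_ge0. Qed.

Lemma measurable_majorant : measurable_fun setT majorant.
Proof.
apply: emeasurable_funD; first exact: measurable_maximal_product.
by apply: (measurableT_comp (measurable_poweR _)); exact: measurable_maximal.
Qed.

Lemma convolution_component_le x (t : R) i : 0 < t ->
  (`|convolution (dilate h t) (fun y => f y * g y ord0 i) x|%:E <=
   pointwise_cst%:E * majorant x)%E.
Proof.
move=> t0; have H0 := maximal_product_ge0 f G x.
have J0 : 0 <= @jump_cst R n K by apply: jump_cst_ge0 Ch.
have Z0 := poweR_ge0 (MW x) (1 - th)^-1.
(* Where the maximal product is infinite the majorant is infinite as well, and the bound is
   trivial. *)
have [Hoo|] := ltP (H x) (+oo)%E; last first.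
  rewrite leye_eq => /eqP Hoo.
  rewrite /majorant Hoo addye ?gt0_muley ?leey// ?lte_fin ?pointwise_cst_gt0//.
  by rewrite gt_eqF// (lt_le_trans _ Z0)// ltNy0.
apply: (le_trans (convolution_component_finite_le t0 i Hoo)).
rewrite /pointwise_cst /majorant.
apply: (@le_trans _ _ ((@start_cst R n K)%:E * (H x + MW x `^ (1 - th)^-1) +
    (16 * @jump_cst R n K)%:E * (H x + MW x `^ (1 - th)^-1))%E).
  apply: leeD; apply: lee_wpmul2l; rewrite ?lee_fin ?start_cst_ge0 ?mulr_ge0//.
    by rewrite leeDl.
  by apply: poweR_young => //; [exact: maximal_power_ge0|exact: theta_itv].
rewrite -ge0_muleDl ?lee_fin ?start_cst_ge0 ?mulr_ge0// -EFinD.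
apply: lee_wpmul2r; first exact: majorant_ge0.
by rewrite lee_fin lerDl.
Qed.

(** The inner product is split into its components by induction on the list of indices.
    Integrability is carried along because additivity of the convolution requires it. Each component
    costs a factor [enorm xi], whence the size of the list in the constant. *)
Lemma convolution_sum_le x (t : R) (xi : 'rV[R]_n) (r : seq 'I_n) : 0 < t ->
  mu.-integrable setT (EFin \o (fun y => dilate h t (x - y) *
    (f y * \sum_(i <- r) xi ord0 i * g y ord0 i))) /\
  (`|convolution (dilate h t) (fun y => f y * \sum_(i <- r) xi ord0 i * g y ord0 i) x|%:E
   <= ((size r)%:R * (enorm xi * pointwise_cst))%:E * majorant x)%E.
Proof.
move=> t0; have m0 := majorant_ge0 x.
have e0 : 0 <= enorm xi by exact: sqrtr_ge0.
have p0 := ltW pointwise_cst_gt0.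
elim: r => [|i r [iIH IH]].
  have E : (fun y => dilate h t (x - y) *
      (f y * \sum_(i <- [::]) xi ord0 i * g y ord0 i)) = cst 0.
    by apply/funext => y; rewrite big_nil !mulr0.
  split; first by rewrite E; exact: integrable0.
  by rewrite /convolution E Rintegral_cst// mul0r normr0 mul0r mul0e.
have mpsi : measurable_fun setT (kernel_at h x t).
  by apply: continuous_measurable_rV; have [] := kernel_at_Ck1 hh x t.
have [ii _] := sqint_mul_integrable sf (sg i) mpsi (kernel_at_le Ch x t0).
have {}ii : mu.-integrable setT (EFin \o (fun y => dilate h t (x - y) * (f y * g y ord0 i))).
  move: ii; congr (mu.-integrable _ _); apply/funext => y /=.
  by rewrite mulrC.
have ixi := integrableZl measurableT (xi ord0 i) ii.
have E : (fun y => f y * \sum_(j <- i :: r) xi ord0 j * g y ord0 j) =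
    (fun y => xi ord0 i * (f y * g y ord0 i) + f y * \sum_(j <- r) xi ord0 j * g y ord0 j).
  by apply/funext => y; rewrite big_cons mulrDr mulrCA.
have {}ixi : mu.-integrable setT (EFin \o (fun y => dilate h t (x - y) * (xi ord0 i * (f y * g y ord0 i)))).
  move: ixi; congr (mu.-integrable _ _); apply/funext => y.
  by rewrite /= -EFinM mulrCA.
split.
  have := integrableD measurableT ixi iIH; congr (mu.-integrable _ _).
  by apply/funext => y; rewrite /= -EFinD big_cons !mulrDr [f y * (_ * _)]mulrCA.
rewrite E convolutionD// /=.
have -> : convolution (dilate h t) (fun y => xi ord0 i * (f y * g y ord0 i)) x =
    xi ord0 i * convolution (dilate h t) (fun y => f y * g y ord0 i) x.
  by rewrite -RintegralZl//; apply: eq_Rintegral => y _; rewrite mulrCA.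
apply: (@le_trans _ _ ((enorm xi * pointwise_cst)%:E * majorant x +
   ((size r)%:R * (enorm xi * pointwise_cst))%:E * majorant x)%E).
  apply: le_trans (leeD (_ :
    (`|xi ord0 i * convolution (dilate h t) (fun y => f y * g y ord0 i) x|%:E <= _)%E) IH).
    by rewrite -EFinD lee_fin ler_normD.
  rewrite normrM EFinM [X in (_ <= X * _)%E]EFinM -muleA.
  apply: lee_pmul; rewrite ?lee_fin//; last exact: convolution_component_le.
  exact: le_trans (coord_le_norm _ _) (norm_le_enorm _).
rewrite -ge0_muleDl ?lee_fin ?mulr_ge0// -EFinD.
by rewrite /= -(natr1 (size r)) mulrDl mul1r addrC.
Qed.

Lemma hardy_maximal_le (xi : 'rV[R]_n) x :
  (hardy_maximal h (fun y => f y * dot xi (g y))%R x <=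
   (n%:R * (enorm xi * pointwise_cst))%:E * majorant x)%E.
Proof.
apply: ge_ereal_sup => _ [t /= t0 <-].
have [_] := convolution_sum_le x xi (index_enum 'I_n) t0.
have -> : size (index_enum 'I_n) = n by rewrite -sum1_size big_const_ord iter_addn_0 mul1n.
exact.
Qed.

(** A supremum over uncountably many [t], but of continuous functions: its superlevel sets are
    unions of open sets, hence open. *)
Lemma measurable_hardy_maximal v : locint v -> measurable_fun setT (hardy_maximal h v).
Proof.
move=> lv _; apply: (measurability _ (ErealGenOInfty.measurableE R)) => //.
move=> _ [_ [a ->] <-]; rewrite setTI; apply: open_measurable_rV.
rewrite preimage_itvoy.
rewrite (_ : [set _ | _] = \bigcup_(t in [set t : R | 0 < t])
    [set x | a < `|convolution (dilate h t) v x|]).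
  apply: bigcup_open => t /= t0.
  have cv := mollify_continuous Ch t0 lv.
  rewrite (_ : [set x | _] = (fun x => `|convolution (dilate h t) v x|) @^-1` `]a, +oo[%classic).
    apply: open_comp; last exact: interval_open.
    move=> x _; apply: (continuous_comp (f := convolution (dilate h t) v)); first exact: cv.
    exact: norm_continuous.
  by apply/seteqP; split => x /=; rewrite in_itv/= andbT.
apply/seteqP; split => x /=.
  by move=> /ereal_sup_gt[_ [t t0 <-]]; rewrite lte_fin => ?; exists t.
move=> [t /= t0 at_]; apply: (@lt_le_trans _ _ `|convolution (dilate h t) v x|%:E).
  by rewrite lte_fin.
by apply: ereal_sup_ubound; exists t.
Qed.

End pointwise_bound.

(** * Integration of the pointwise majorant *)

Section integration.
Context {R : realType} {n : nat}.
Local Notation mu := (@lebesgue_rV R n).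
Implicit Types (f G u v : 'rV[R]_n -> R) (x y z : 'rV[R]_n).
Local Notation M v := (maximal (fun x => `|v x|%:E)).

Lemma L2norm_normsq f : (L2norm f * L2norm f)%E = normsq f.
Proof.
rewrite -poweR2 ?Lnorm_ge0// /L2norm poweR_Lnorm ?pnatr_eq0//.
apply: eq_integral => x _; rewrite poweR2// /= -EFinM -expr2 real_normK//.
exact: num_real.
Qed.

Lemma L2norm_fin f : sqint f -> exists2 a, 0 <= a & L2norm f = a%:E.
Proof.
move=> /sqintP[_]; rewrite -L2norm_normsq.
have : (0 <= L2norm f)%E by exact: Lnorm_ge0.
case: (L2norm f) => [a| |//]; first by rewrite lee_fin => a0 _; exists a.
by rewrite mulyy.
Qed.

Lemma integral_maximal_sqr f : sqint f ->
  (\int[mu]_x (M f x `^ 2) <= (@maximal_cst R n 2)%:E * normsq f)%E.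
Proof.
move=> [mf _].
have mF : measurable_fun setT (fun x => `|f x|%:E).
  by apply/measurable_EFinP; exact: measurableT_comp.
apply: le_trans (maximal_strong mF _ _) _ => //; first by rewrite ltr1n.
rewrite le_eqVlt; apply/orP; left; apply/eqP; congr (_ * _)%E.
apply: eq_integral => x _; rewrite poweR2// -EFinM -expr2 real_normK//.
exact: num_real.
Qed.

Lemma mule_le_scaled_squares (u v : \bar R) (l : R) : 0 < l ->
  (0 <= u -> 0 <= v -> u * v <= l%:E * u `^ 2 + l^-1%:E * v `^ 2)%E.
Proof.
move=> l0 u0 v0; have li0 : 0 < l^-1 by rewrite invr_gt0.
rewrite !poweR2//; case: u u0 => [a| |] // u0; last first.
  rewrite mulyy gt0_muley ?lte_fin// addye ?leey//.
  by rewrite gt_eqF// (lt_le_trans ltNy0)// mule_ge0 ?lee_fin ?mule_ge0 ?(ltW li0).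
case: v v0 => [b| |] // v0; last first.
  by rewrite mulyy [X in (_ <= _ + X)%E]gt0_muley ?lte_fin// -!EFinM addey ?leey.
rewrite -!EFinM -EFinD lee_fin.
have ll : l * l^-1 = 1 by rewrite mulfV// gt_eqF.
have := mulr_ge0 (ltW l0) (sqr_ge0 (a - l^-1 * b)).
have -> : l * (a - l^-1 * b) ^+ 2 = l * (a * a) - 2 * (l * l^-1) * (a * b) + (l * l^-1) * (l^-1 * (b * b)).
  by ring.
rewrite ll; move: u0 v0; rewrite !lee_fin => a0 b0.
have := mulr_ge0 a0 b0; have := mulr_ge0 (ltW l0) (mulr_ge0 a0 a0).
by move: (l^-1) => q; lra.
Qed.

(** Optimization over [l]: for positive [a] and [b] the choice [l = b / a] gives the claim. If [a]
    or [b] is zero, a positive [X] is refuted by taking [l] so large, respectively so small, that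
    the right-hand side falls below [X]. *)
Lemma le_scaled_squares (X a b c : R) : 0 <= a -> 0 <= b -> 0 <= c ->
  (forall l, 0 < l -> X <= c * (l * a ^+ 2 + l^-1 * b ^+ 2)) -> X <= 2 * c * (a * b).
Proof.
move=> a0 b0 c0 HX.
have [ab|] := ltP 0 (a * b).
  have [/lt0r_neq0 + /lt0r_neq0] : 0 < a /\ 0 < b by split; nra.
  move=> an bn; have := HX (b / a) _; rewrite divr_gt0 ?lt0r ?an ?bn// => /(_ isT).
  congr (_ <= _); field; by rewrite an.
rewrite le_eqVlt ltNge mulr_ge0// orbF mulf_eq0 => /orP[] /eqP E.
  rewrite E mul0r mulr0 leNgt; apply/negP => X0.
  have cb : 0 < c * b ^+ 2 + 1 by rewrite ltr_wpDl// mulr_ge0// sqr_ge0.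
  have := HX ((c * b ^+ 2 + 1) / X) (divr_gt0 cb X0).
  rewrite E expr0n/= mulr0 add0r invf_div mulrCA mulrAC -mulrA ler_pMr//.
  by rewrite ler_pdivlMr// mul1r; lra.
rewrite E !mulr0 leNgt; apply/negP => X0.
have ca : 0 < c * a ^+ 2 + 1 by rewrite ltr_wpDl// mulr_ge0// sqr_ge0.
have := HX (X / (c * a ^+ 2 + 1)) (divr_gt0 X0 ca).
rewrite E expr0n/= mulr0 addr0 mulrCA mulrAC -mulrA ler_pMr//.
by rewrite ler_pdivlMr// mul1r; lra.
Qed.

(** For every [l > 0] the product of the two maximal functions is bounded by weighted squares, to
    which the maximal theorem with exponent 2 applies. Optimizing over [l] restores the product of
    the two norms. *)
Lemma integral_maximal_product f G : sqint f -> sqint G ->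
  (\int[mu]_x maximal_product f G x <=
   (2 * @maximal_cst R n 2)%:E * (L2norm f * L2norm G))%E.
Proof.
move=> sf sG; have [a a0 fa] := L2norm_fin sf; have [b b0 Gb] := L2norm_fin sG.
have c0 : 0 <= @maximal_cst R n 2 by apply: maximal_cst_ge0; rewrite ltr1n.
have m2 v : measurable_fun setT (fun x => M v x `^ 2)%E.
  by apply: (measurableT_comp (measurable_poweR _)); exact: measurable_maximal.
have key (l : R) : 0 < l -> (\int[mu]_x maximal_product f G x <=
    (@maximal_cst R n 2 * (l * a ^+ 2 + l^-1 * b ^+ 2))%:E)%E.
  move=> l0; have li0 : 0 < l^-1 by rewrite invr_gt0.
  have n0 v x : (0 <= M v x)%E by apply: maximal_ge0 => y; rewrite lee_fin.
  apply: (@le_trans _ _ (\int[mu]_x (l%:E * M f x `^ 2 + l^-1%:E * M G x `^ 2))%E).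
    apply: ge0_le_integral => //.
    - by move=> x _; exact: maximal_product_ge0.
    - exact: measurable_maximal_product.
    - by apply: emeasurable_funD; exact: measurable_funeM.
    - by move=> x _; exact: mule_le_scaled_squares.
  rewrite ge0_integralD//; last 4 first.
  - by move=> x _; rewrite mule_ge0 ?poweR_ge0// lee_fin ltW.
  - exact: measurable_funeM.
  - by move=> x _; rewrite mule_ge0 ?poweR_ge0// lee_fin ltW.
  - exact: measurable_funeM.
  rewrite !ge0_integralZl ?lee_fin ?(ltW l0) ?(ltW li0)//; last 2 first.
  - by move=> x _; exact: poweR_ge0.
  - by move=> x _; exact: poweR_ge0.
  apply: (@le_trans _ _ (l%:E * ((@maximal_cst R n 2)%:E * normsq f) +
      l^-1%:E * ((@maximal_cst R n 2)%:E * normsq G))%E).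
    by apply: leeD; apply: lee_wpmul2l; rewrite ?lee_fin ?(ltW l0) ?(ltW li0)//;
      exact: integral_maximal_sqr.
  rewrite -!L2norm_normsq fa Gb -!EFinM -EFinD lee_fin le_eqVlt; apply/orP; left.
  by apply/eqP; ring.
have I0 : (0 <= \int[mu]_x maximal_product f G x)%E.
  by apply: integral_ge0 => x _; exact: maximal_product_ge0.
rewrite fa Gb -!EFinM; move: key I0; case: (\int[mu]_x _)%E => [X| |] key I0 //.
  by rewrite lee_fin; apply: le_scaled_squares => // l /key.
by have := key 1 ltr01; rewrite leye_eq.
Qed.

Lemma integral_majorant f G :
  (\int[mu]_x majorant f G x <=
   (1 + @maximal_cst R n (1 - (theta n : R))^-1)%:E * \int[mu]_x maximal_product f G x)%E.
Proof.
have /andP[th0 th1] := theta_itv n : 0 < (theta n : R) < 1.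
have q0 : 0 < 1 - (theta n : R) by rewrite subr_gt0.
have p1 : 1 < (1 - (theta n : R))^-1 by rewrite invf_gt1// gtrBl.
have H0 := maximal_product_ge0 f G.
have mH := measurable_maximal_product f G.
have mW : measurable_fun setT (fun y => maximal_product f G y `^ (1 - (theta n : R)))%E.
  by apply: (measurableT_comp (measurable_poweR _)).
rewrite /majorant ge0_integralD//; last 2 first.
- by move=> x _; exact: poweR_ge0.
- by apply: (measurableT_comp (measurable_poweR _)); exact: measurable_maximal.
have c0 := @maximal_cst_ge0 R n _ p1.
rewrite EFinD ge0_muleDl ?lee_fin// mul1e; apply: leeD2l.
apply: (le_trans (maximal_strong mW (fun=> poweR_ge0 _ _) p1)).
rewrite le_eqVlt; apply/orP; left; apply/eqP; congr (_ * _)%E.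
apply: eq_integral => x _; rewrite -poweRrM mulfV ?poweRe1//.
by rewrite gt_eqF.
Qed.

Lemma sqint_sum (I : Type) (r : seq I) (u : I -> 'rV[R]_n -> R) :
  (forall i, sqint (u i)) -> sqint (fun x => \sum_(i <- r) u i x).
Proof.
move=> su; elim: r => [|i r IH].
  apply/sqintP; split; first by under eq_fun do rewrite big_nil; exact: measurable_cst.
  rewrite /normsq; under eq_integral do rewrite big_nil expr0n.
  by rewrite integral0 ltry.
rewrite (_ : (fun x => _) = (fun x => u i x + \sum_(i <- r) u i x)); first exact: sqintD.
by apply/funext => x; rewrite big_cons.
Qed.

(** The Euclidean length is at most the sum of the absolute values of the components, a finite sum
    of square-integrable functions. *)
Lemma sqint_enorm (g : 'rV[R]_n -> 'rV[R]_n) :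
  (forall i, sqint (fun x => g x ord0 i)) -> sqint (fun x => enorm (g x)).
Proof.
move=> sg; have sa : sqint (fun x => \sum_(i < n) `|g x ord0 i|).
  apply: sqint_sum => i; apply: (sqint_le _ (sg i)) => [|x]; last by rewrite normr_id.
  by apply: measurableT_comp => //; case: (sg i).
apply: (sqint_le _ sa) => [|x].
  have ms : measurable_fun [set: R] (@Num.sqrt R).
    by apply: continuous_measurable_fun; exact: sqrt_continuous.
  apply: (measurableT_comp ms); rewrite /dot; apply: measurable_sum => i.
  by apply: measurable_funM; case: (sg i).
rewrite !ger0_norm ?sqrtr_ge0 ?sumr_ge0//.
rewrite -[leRHS]ger0_norm ?sumr_ge0// -sqrtr_sqr ler_wsqrtr// expr2 mulr_suml.
apply: ler_sum => i _; rewrite (le_trans (ler_norm _))// normrM ler_wpM2l//.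
by rewrite (bigD1 i)//= lerDl sumr_ge0.
Qed.

End integration.

Theorem proposition3p2 (R : realType) (n : nat) (h : 'rV[R]_n -> R)
    (hh : hardy_kernel h) :
  exists C : R,
    forall (f : 'rV[R]_n -> R) (g : 'rV[R]_n -> 'rV[R]_n) (xi : 'rV[R]_n),
      sobolev12 f g ->
      (hardy_norm h (fun x => (f x * dot xi (g x))%R)
       <= (C * enorm xi)%:E * L2norm (fun x => enorm (g x)) * L2norm f)%E.
Proof.
have [K _ Ch] := hardy_kernel_C1c hh.
pose c := n%:R * @pointwise_cst R n K.
pose d := 1 + @maximal_cst R n (1 - (theta n : R))^-1.
(* Here [c] comes from the pointwise bound, its factor [n] counting the components of the gradient;
   [d] passes from the majorant to the maximal product, and the last factor passes from there to the
   [L^2] norms. None of them involves [f], [g] or [xi]. *)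
exists (c * d * (2 * @maximal_cst R n 2)) => f g xi [f2 g2 wg].
have sf := Lfun2_sqint f2; have sg i := Lfun2_sqint (g2 i).
pose G x := enorm (g x); have sG : sqint G by exact: sqint_enorm.
have gG i x : `|g x ord0 i| <= `|G x|.
  rewrite [leRHS]ger0_norm ?sqrtr_ge0//.
  exact: le_trans (coord_le_norm _ _) (norm_le_enorm _).
have e0 : 0 <= enorm xi by exact: sqrtr_ge0.
have /andP[th0 th1] := theta_itv n : 0 < (theta n : R) < 1.
have p1 : 1 < (1 - (theta n : R))^-1 by rewrite invf_gt1 ?subr_gt0// gtrBl.
have d0 : 0 <= d by rewrite addr_ge0// maximal_cst_ge0.
have c0 : 0 <= c by rewrite mulr_ge0// ltW// (pointwise_cst_gt0 Ch).
have sdot : sqint (fun x => dot xi (g x)).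
  by apply: sqint_sum => i; exact: sqintZ.
have lfd : locint (fun x => f x * dot xi (g x)).
  split; first by apply: measurable_funM; [case: sf|case: sdot].
  move=> y r; apply: (integrableS measurableT) => //; first exact: measurable_rV_ball.
  have c1 (x : 'rV[R]_n) : `|1 : R| <= 1 by rewrite normr1.
  have [+ _] := sqint_mul_integrable sf sdot (measurable_cst _) c1.
  by congr (integrable _ _ _); apply/funext => x /=; rewrite mulr1.
have mX := measurable_hardy_maximal Ch lfd.
rewrite /hardy_norm Lnorm1.
apply: (@le_trans _ _ (\int[@lebesgue_rV R n]_x ((c * enorm xi)%:E * majorant f G x))%E).
  apply: ge0_le_integral => //.
  - exact: measurableT_comp.
  - by apply: measurable_funeM; exact: measurable_majorant.
  (* The norm takes the absolute value of the maximal function, which is nonnegative because the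
     supremum includes the term for [t = 1]. *)
  move=> x _; rewrite gee0_abs; last first.
    apply: (@le_trans _ _ `|convolution (dilate h 1) (fun y => f y * dot xi (g y)) x|%:E).
      by rewrite lee_fin.
    by apply: ereal_sup_ubound; exists 1 => //=.
  rewrite /c mulrAC -mulrA.
  exact: (hardy_maximal_le hh Ch sf sg sG gG wg).
rewrite ge0_integralZl//; last 3 first.
- exact: measurable_majorant.
- by move=> x _; exact: majorant_ge0.
- by rewrite lee_fin; exact: mulr_ge0.
have := lee_wpmul2l (_ : 0 <= (c * enorm xi)%:E)%E (integral_majorant f G).
rewrite lee_fin (mulr_ge0 c0 e0) => /(_ isT) /le_trans; apply.
rewrite -/d muleA -EFinM.
have := lee_wpmul2l (_ : 0 <= (c * enorm xi * d)%:E)%E (integral_maximal_product sf sG).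
rewrite lee_fin (mulr_ge0 (mulr_ge0 c0 e0) d0) => /(_ isT) /le_trans; apply.
rewrite muleA -EFinM [X in (_ * X <= _)%E]muleC muleA.
rewrite le_eqVlt; apply/orP; left; apply/eqP; congr (_%:E * _ * _)%E.
by ring.
Qed.
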